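(* Let $A=R[x,y]/(f)$ be the coordinate ring of the affine part of a smooth plane curve $C\subset\mathbb{P}^2_R$ of degree $d$, as in the context. For $n\ge\max\{2d-3,d\}$ consider the commutative diagram of $R$-modules with exact rows $$\begin{array}{ccccccccc}0&\to&M_1&\xrightarrow{\ \gamma\ }&M_2&\to&M_3&\to&0\\&&\downarrow&&\downarrow&&\downarrow&&\\0&\to&A&\xrightarrow{\ \cdot df\ }&A\,dx\oplus A\,dy&\xrightarrow{\ \delta\ }&\Omega^1_{A/R}&\to&0\end{array}$$ where all vertical maps are inclusions, $M_1$ is generated as an $R$-module by all $x^iy^j$ with $i+j\le n+1-d$, $M_2$ is generated as an $R$-module by all $x^iy^j\,dx$ and $x^iy^j\,dy$ with $i+j\le n-1$ together with all $x^iy^j(y\,dx-x\,dy)$ with $i+j=n-1$, $\gamma$ is multiplication by $df=f_x\,dx+f_y\,dy$, and $\delta$ is the quotient map to $\Omega^1_{A/R}=(A\,dx\oplus A\,dy)/A\,df$. Then $M_3=\delta(M_2)$ is the image of $H^0(C,\Omega^1_{C/R}(D'))$ in $\Omega^1_{A/R}$ under localisation, for $D'=(n+1)C_\infty$. Moreover, one can effectively compute in $A\,dx\oplus A\,dy$ an $R$-basis of $M_2/\gamma(M_1)$.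
   Context: $R$ is the valuation ring of a finite extension of $\mathbb{Q}_p$, $F(X,Y,Z)\in R[X,Y,Z]$ is homogeneous of degree $d$ and defines a curve $C\subset\mathbb{P}^2_R$ smooth over $R$, with the reduction of $F$ modulo the maximal ideal not divisible by $Z$. $f(x,y)=F(x,y,1)$, and $C_\infty=C\cdot\{Z=0\}$, so that $C\setminus C_\infty=\mathrm{Spec}(A)$. *)

(* Defs.v *)
From HB Require Import structures.
From mathcomp Require Import all_boot all_order all_algebra all_field.
From mathcomp Require Export mpoly.

Set Implicit Arguments.
Unset Strict Implicit.
Unset Printing Implicit Defensive.

Import GRing.Theory Num.Theory.
Local Open Scope ring_scope.

(** * Valuation rings of finite extensions of Q_p *)

(* A valuation is a function v : K -> int of which only the values on K \ {0}
   matter; [val_ge v m x] is "v(x) >= m" with the convention v(0) = +oo. *)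
Definition val_ge (K : fieldType) (v : K -> int) (m : int) (x : K) : bool :=
  (x == 0) || (m <= v x).

Record is_valuation (K : fieldType) (v : K -> int) : Prop := IsValuation {
  valuationM : forall x y, x != 0 -> y != 0 -> v (x * y) = v x + v y;
  valuationD : forall m x y,
    val_ge v m x -> val_ge v m y -> val_ge v m (x + y) }.

Definition padic_val (p : nat) (q : rat) : int :=
  (logn p `|numq q|%N)%:Z - (logn p `|denq q|%N)%:Z.

(* Q_p, as the completion of Q for the p-adic valuation. *)
Record is_Qp (p : nat) (Qp : fieldType) (v : Qp -> int)
    (i : {rmorphism rat -> Qp}) : Prop := IsQp {
  Qp_prime : prime p;
  Qp_valuation : is_valuation v;
  Qp_extends : forall q, q != 0 -> v (i q) = padic_val p q;
  Qp_dense : forall (x : Qp) m, exists q, val_ge v m (x - i q);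
  Qp_complete : forall u : nat -> Qp,
    (forall m, exists N, forall j k, (N <= j)%N -> (N <= k)%N ->
       val_ge v m (u j - u k)) ->
    exists l, forall m, exists N, forall j, (N <= j)%N ->
       val_ge v m (u j - l) }.

(* R is (a copy, via the embedding j, of) the valuation ring of a finite
   extension K of Q_p. The valuation w of K need not be normalised: it
   restricts to a positive multiple of the one of Q_p. *)
Definition padic_integer_ring (R : idomainType) : Prop :=
  exists (p : nat) (Qp : fieldType) (v : Qp -> int) (i : {rmorphism rat -> Qp})
         (K : fieldExtType Qp) (w : K -> int) (j : {rmorphism R -> K}),
    [/\ is_Qp p v i,
        is_valuation w,
        exists2 e : nat, (0 < e)%N &
          forall x : Qp, x != 0 -> w x%:A = e%:Z * v x,
        injective j &
        forall x : K, val_ge w 0 x <-> exists r : R, x = j r].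

(** * Plane curves in P^2_R *)

(* The homogeneous coordinates X, Y, Z have indices 0, 1, 2, and the affine
   ones x, y have indices 0, 1. *)
Notation iX := (@Ordinal 3 0 isT).
Notation iY := (@Ordinal 3 1 isT).
Notation iZ := (@Ordinal 3 2 isT).
Notation ix := (@Ordinal 2 0 isT).
Notation iy := (@Ordinal 2 1 isT).

Section Curve.
Variable R : idomainType.
Implicit Type F : {mpoly R[3]}.

(* The maximal ideal of R consists of the non-units. *)
Definition reduction_divisible_by_Z F : Prop :=
  exists G : {mpoly R[3]},
    forall m, (F - G * 'X_iZ)@_m \isn't a GRing.unit.

(* Jacobian criterion on each standard chart, viewed as the subscheme
   F = 0, X_i = 1 of A^3: the partial derivatives of F with respect to the two
   coordinates X_k, k != i, generate the unit ideal of the ring of the chart,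
   i.e., the chart is covered by the two open subschemes on which one of them
   is invertible, which are standard smooth of relative dimension 1 over R. *)
Definition smooth_curve F : Prop :=
  forall i : 'I_3, exists (a b : {mpoly R[3]}) (c : 'I_3 -> {mpoly R[3]}),
    1 = a * F + b * ('X_i - 1) + \sum_(k | k != i) c k * F^`M(k).

Definition affine_eq F : {mpoly R[2]} :=
  F \mPo [tuple 'X_ix; 'X_iy; 1].

(** ** Global sections of Omega^1_{C/R}((n+1) C_oo) *)

(* All rings of functions on the open subsets of P^2_R met below are subrings
   of the function field Frac R[x, y], and all their modules of differentials
   are contained in the free module with basis dx, dy over this field. *)
Local Notation Fun := {fraction {mpoly R[2]}}.
Local Notation Form := 'rV[Fun]_2.

Definition dx : Form := delta_mx ord0 ix.
Definition dy : Form := delta_mx ord0 iy.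

(* P^2 has homogeneous coordinates (x : y : 1). *)
Definition hcoord (k : 'I_3) : Fun :=
  tnth [tuple tofrac 'X_ix; tofrac 'X_iy; 1] k.
Definition dhcoord (k : 'I_3) : Form := tnth [tuple dx; dy; 0] k.

(* X_k / X_i and, by the quotient rule, d (X_k / X_i). *)
Definition coord (i k : 'I_3) : Fun := hcoord k / hcoord i.
Definition dcoord (i k : 'I_3) : Form :=
  (hcoord i ^- 2) *: (hcoord i *: dhcoord k - hcoord k *: dhcoord i).

(* G (X / X_i, Y / X_i, Z / X_i) *)
Definition at_chart (i : 'I_3) (G : {mpoly R[3]}) : Fun :=
  mmap (fun c : R => tofrac c%:MP_[2]) (coord i) G.

(* The ring of regular functions on U_i :&: U_j, where U_i is the locus
   X_i != 0 of P^2_R: it is R[X / X_i, Y / X_i, Z / X_i][X_i / X_j]. *)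
Definition regular (i j : 'I_3) (a : Fun) : Prop :=
  exists (G : {mpoly R[3]}) (N : nat), a = at_chart i G / coord i j ^+ N.

(* Omega^1_{P^2_R / R} (U_i :&: U_j) *)
Definition Omega_P2 (i j : 'I_3) (w : Form) : Prop :=
  exists2 c : 'I_3 -> Fun, forall k, regular i j (c k) &
    w = \sum_k c k *: dcoord i k.

(* On U_i :&: U_j the curve C is defined by g = F / X_i^d, and
   Omega^1_{C/R} is the quotient of Omega^1_{P^2_R / R} by the submodule
   g Omega^1_{P^2_R / R} + O dg. *)
Definition null_on_C F (i j : 'I_3) (w : Form) : Prop :=
  exists (u : Form) (a : Fun), [/\ Omega_P2 i j u, regular i j a &
    w = at_chart i F *: u
        + a *: (\sum_k at_chart i F^`M(k) *: dcoord i k)].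

(* A global section of Omega^1_{C/R} (m C_oo) is given by its restrictions to
   the charts U_i, lifted to forms on P^2. On U_i the divisor C_oo is cut out
   by Z / X_i, so the lifts belong to (Z / X_i)^-m Omega^1_{P^2_R / R} (U_i),
   and they have to agree on the overlaps modulo (Z / X_i)^-m times the
   submodule above. *)
Definition global_section F (m : nat) (e : 'I_3 -> Form) : Prop :=
  (forall i, Omega_P2 i i (coord i iZ ^+ m *: e i)) /\
  (forall i j, null_on_C F i j (coord i iZ ^+ m *: (e i - e j))).

(** ** The affine part and the diagram *)

(* pi presents A as R[x, y] / (f). *)
Definition is_coordinate_ring F (A : comAlgType R)
    (pi : {lrmorphism {mpoly R[2]} -> A}) : Prop :=
  (forall a, exists g, a = pi g) /\
  (forall g, pi g = 0 <-> exists h, g = h * affine_eq F).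

Section Diagram.
Variables (F : {mpoly R[3]}) (A : comAlgType R).
Variable pi : {lrmorphism {mpoly R[2]} -> A}.

(* The pair (a, b) stands for a dx + b dy; A * A carries the structure of an
   R-module, and A^o * A^o is the same type with its A-module structure. *)
Definition mul_df (a : A) : A * A :=
  (a * pi (affine_eq F)^`M(ix), a * pi (affine_eq F)^`M(iy)).

(* delta presents Omega as (A dx (+) A dy) / A df. *)
Definition is_differentials (Omega : lmodType A)
    (delta : {linear (A^o * A^o)%type -> Omega}) : Prop :=
  (forall w, exists u, w = delta u) /\
  (forall u, delta u = 0 <-> exists a, u = mul_df a).

Definition Rspan (V : lmodType R) (gen : V -> Prop) (v : V) : Prop :=
  exists2 s : seq (R * V), forall t, t \in s -> gen t.2 &
    v = \sum_(t <- s) t.1 *: t.2.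

Definition monA (i j : nat) : A := pi ('X_ix ^+ i * 'X_iy ^+ j).

Definition M1 (d n : nat) : A -> Prop :=
  Rspan (fun a => exists i j, (i + j <= n + 1 - d)%N /\ a = monA i j).

Definition M2 (n : nat) : A * A -> Prop :=
  Rspan (fun u : A * A => exists i j,
    [\/ (i + j <= n - 1)%N /\ u = (monA i j, 0),
        (i + j <= n - 1)%N /\ u = (0, monA i j) |
        (i + j = n - 1)%N /\ u = (monA i j.+1, - monA i.+1 j)]).

Definition M3 (n : nat) (Omega : lmodType A)
    (delta : {linear (A^o * A^o)%type -> Omega}) (w : Omega) : Prop :=
  exists2 u, M2 n u & w = delta u.

(* Image in Omega of H^0 (C, Omega^1_{C/R} (m C_oo)) under restriction to the
   affine part U_2 :&: C. *)
Definition image_H0 (m : nat) (Omega : lmodType A)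
    (delta : {linear (A^o * A^o)%type -> Omega}) (w : Omega) : Prop :=
  exists (e : 'I_3 -> Form) (a b : {mpoly R[2]}),
    [/\ global_section F m e,
        e iZ = tofrac a *: dx + tofrac b *: dy &
        w = delta (pi a, pi b)].

(* b is a list of elements of N2 whose classes form an R-basis of N2/N1. *)
Definition quotient_basis (V : lmodType R) (N1 N2 : V -> Prop) (b : seq V) :
    Prop :=
  [/\ forall v, v \in b -> N2 v,
      forall v, N2 v -> exists c : 'I_(size b) -> R,
        N1 (v - \sum_i c i *: b`_i) &
      forall c : 'I_(size b) -> R,
        N1 (\sum_i c i *: b`_i) -> forall i, c i = 0].

End Diagram.
End Curve.

(* 0 -> S1 -> S2 -> S3 -> 0 is exact, for the restrictions of g and h to
   subgroups S1, S2, S3 of V1, V2, V3. *)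
Definition short_exact (V1 V2 V3 : zmodType) (g : V1 -> V2) (h : V2 -> V3)
    (S1 : V1 -> Prop) (S2 : V2 -> Prop) (S3 : V3 -> Prop) : Prop :=
  [/\ forall a, S1 a -> S2 (g a),
      forall u, S2 u -> S3 (h u),
      forall a b, S1 a -> S1 b -> g a = g b -> a = b,
      forall u, S2 u -> (h u = 0 <-> exists2 a, S1 a & u = g a) &
      forall w, S3 w -> exists2 u, S2 u & w = h u].

(** * Effective computations over R *)

(* Elements of R are known through approximations, so that the operations
   which can be performed effectively on them are those of the ring, the test
   whether an element is a unit, and the inversion of units; equality in R is
   not decidable from approximations and there is no test for it. Programs are
   built from these operations and from operations on natural numbers, pairs
   and lists, with unbounded loops; the only constants are 0 and 1. *)

Inductive ty := Nat | Scal | Prod of ty & ty | List of ty.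

Fixpoint sem (R : Type) (t : ty) : Type :=
  match t with
  | Nat => nat
  | Scal => R
  | Prod a b => (sem R a * sem R b)%type
  | List a => seq (sem R a)
  end.

Inductive prog : ty -> ty -> Type :=
| Id a : prog a a
| Comp a b c of prog b c & prog a b : prog a c
| Pair a b c of prog a b & prog a c : prog a (Prod b c)
| Fst a b : prog (Prod a b) a
| Snd a b : prog (Prod a b) b
| Zero a : prog a Nat
| Succ : prog Nat Nat
| NatCase a b of prog a b & prog (Prod Nat a) b : prog (Prod Nat a) b
| Nil a b : prog a (List b)
| Cons a : prog (Prod a (List a)) (List a)
| ListCase a b c of prog a c & prog (Prod b (Prod (List b) a)) c :
    prog (Prod (List b) a) c
| While a of prog a Nat & prog a a : prog a a
| Scal0 a : prog a Scal
| Scal1 a : prog a Scal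
| Opp : prog Scal Scal
| Add : prog (Prod Scal Scal) Scal
| Mul : prog (Prod Scal Scal) Scal
| Inv : prog Scal Scal
| IsUnit : prog Scal Nat.

(* Iteration of body from x, as long as test is non-zero. *)
Inductive loop (T : Type) (test : T -> nat -> Prop) (body : T -> T -> Prop) :
    T -> T -> Prop :=
| LoopStop x of test x 0%N : loop test body x x
| LoopStep x y z k of test x k.+1 & body x y & loop test body y z :
    loop test body x z.

(* [run R P x y]: on input x, the program P halts with output y. *)
Fixpoint run (R : unitRingType) a b (P : prog a b) : sem R a -> sem R b -> Prop
  :=
  match P in prog a b return sem R a -> sem R b -> Prop with
  | Id _ => fun x y => y = x
  | Comp _ _ _ g f => fun x z => exists2 y, run f x y & run g y z
  | Pair _ _ _ f g => fun x y => run f x y.1 /\ run g x y.2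
  | Fst _ _ => fun x y => y = x.1
  | Snd _ _ => fun x y => y = x.2
  | Zero _ => fun _ y => y = 0%N
  | Succ => fun x y => y = x.+1
  | NatCase _ _ f g => fun x y =>
      match x.1 with
      | 0 => run f x.2 y
      | k.+1 => run g (k, x.2) y
      end
  | Nil _ _ => fun _ y => y = [::]
  | Cons _ => fun x y => y = x.1 :: x.2
  | ListCase _ _ _ f g => fun x y =>
      match x.1 with
      | [::] => run f x.2 y
      | h :: s => run g (h, (s, x.2)) y
      end
  | While _ test body => loop (run test) (run body)
  | Scal0 _ => fun _ y => y = 0
  | Scal1 _ => fun _ y => y = 1
  | Opp => fun x y => y = - x
  | Add => fun x y => y = x.1 + x.2
  | Mul => fun x y => y = x.1 * x.2
  | Inv => fun x y => y = x^-1
  | IsUnit => fun x y => y = nat_of_bool (x \is a GRing.unit)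
  end.

Lemma loop_fun (T : Type) (test : T -> nat -> Prop) (body : T -> T -> Prop) :
  (forall x k l, test x k -> test x l -> k = l) ->
  (forall x y z, body x y -> body x z -> y = z) ->
  forall x y z, loop test body x y -> loop test body x z -> y = z.
Proof.
move=> testF bodyF x y z Hxy; elim: Hxy z => {x y}.
  move=> x t0 z Hxz; case: Hxz t0 => // {}x u v k tk _ _ t0.
  by have := testF _ _ _ t0 tk.
move=> x y z k tk bxy _ IH z' Hx; case: Hx tk bxy IH => {x}.
  by move=> x t0 tk; have := testF _ _ _ t0 tk.
move=> x y' {}z' l _ bxy' Hy' _ bxy IH; apply: IH.
by rewrite (bodyF _ _ _ bxy bxy').
Qed.

Lemma run_fun (R : unitRingType) a b (P : prog a b) (x : sem R a) y z :
  run P x y -> run P x z -> y = z.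
Proof.
elim: P x y z => {a b} /=;
  try by [move=> *; subst | move=> ? *; subst | move=> ? ? *; subst].
- move=> a b c g IHg f IHf x y z [u fu gu] [v fv gv].
  by apply: IHg gu _; rewrite (IHf _ _ _ fu fv).
- move=> a b c f IHf g IHg x [y1 y2] [z1 z2] /= [f1 g1] [f2 g2].
  by rewrite (IHf _ _ _ f1 f2) (IHg _ _ _ g1 g2).
- by move=> a b f IHf g IHg [[|k] x] y z /=; [apply: IHf | apply: IHg].
- by move=> a b c f IHf g IHg [[|h s] x] y z /=; [apply: IHf | apply: IHg].
- by move=> a f IHf g IHg x y z; apply: loop_fun.
Qed.

(* Polynomials are input and output as lists of terms, in any order and
   possibly with repetitions. *)
Definition Poly3 := List (Prod Scal (Prod Nat (Prod Nat Nat))).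
Definition Poly2 := List (Prod Scal (Prod Nat Nat)).

Definition poly3 (R : idomainType) (s : sem R Poly3) : {mpoly R[3]} :=
  \sum_(t <- (s : seq (R * (nat * (nat * nat)))))
    t.1 *: ('X_iX ^+ t.2.1 * 'X_iY ^+ t.2.2.1 * 'X_iZ ^+ t.2.2.2).
Definition poly2 (R : idomainType) (s : sem R Poly2) : {mpoly R[2]} :=
  \sum_(t <- (s : seq (R * (nat * nat))))
    t.1 *: ('X_ix ^+ t.2.1 * 'X_iy ^+ t.2.2).

Definition basis_of_output (R : idomainType) (A : comAlgType R)
    (pi : {lrmorphism {mpoly R[2]} -> A})
    (out : sem R (List (Prod Poly2 Poly2))) : seq (A * A) :=
  [seq (pi (poly2 u.1), pi (poly2 u.2))
     | u <- (out : seq (sem R Poly2 * sem R Poly2))].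

(* Main.v *)
(* A form on a chart is treated as a vector w = (w_0, w_1, w_2) orthogonal to
   E = (X, Y, Z): P dx + Q dy corresponds to (P, Q, - x P - y Q). Then M_2
   consists of the vectors E x v with v homogeneous of degree n - 1, and
   gamma(M_1) of the multiples of D = grad F.

   The identity E x (D x eps_k) = X_k D - (E . D) eps_k with E . D = d F gives
   gamma(M_1) in M_2. If conversely E x v = a D in A, where a comes from a form
   G of large degree, then Z^e (E x v) = G D mod F; by smoothness the ideal
   (F, D) contains a power of (X, Y, Z), so G lies in (F, Z^e) and a in M_1.

   Lifts w_i of a global section to the charts satisfy
   X_j^N w_i - X_i^N w_j = h_ij D + F u_ij. By smoothness the h_ij are a Cech
   cocycle modulo F, and it is a coboundary because every monomial of degree
   at least 3 N - 2 is divisible by the N-th power of a variable: this is the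
   vanishing of H^1(C, O(n + 1 - d)) and uses n >= 2 d - 3. Koszul exactness
   then glues the corrected w_i to a vector E x v.

   M_2 / gamma(M_1) is presented by the coefficients of v, with relations
   generated by m E, m F eps_k and m (D x eps_k) for monomials m. Gaussian
   elimination with unit pivots only requires the test for units; when it
   stops, all relations have nonunit coefficients. As the quotient is torsion
   free and R is a valuation ring, a nonzero relation could be divided by its
   entry of least valuation, so there is none left. *)
From HB Require Import structures.
Require Import Defs.
From mathcomp Require Import all_boot all_order all_algebra all_field.
From mathcomp Require Import ring zify.
Import GRing.Theory.
Set Implicit Arguments.
Unset Strict Implicit.
Unset Printing Implicit Defensive.
Local Open Scope ring_scope.

(** * Divisibility by powers of variables *)

(** The commutative algebra is reduced to monomials. Multiplication by a power of a variable shifts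
    one exponent and leaves the others, so coprimality of powers, Koszul exactness and primality of
    a variable all follow by comparing coefficients of the parts with small exponents.

    Elements of A and of the function field are both represented by forms in X, Y, Z; in a fixed
    degree dehomogenisation is injective. The condition on the reduction of F is exploited twice: Z
    does not divide F, which allows powers of Z to be cancelled modulo F, and F has a unit
    coefficient, which through Gauss's lemma makes A torsion free over R.

    The absence of a zero test shapes the algorithm: the number of steps is fixed in advance by the
    number of relations, and a relation without unit entry is discarded although one cannot tell
    whether it is zero. The invariant of the elimination therefore describes relations only modulo
    the maximal ideal, and saturation shows at the end that nothing was lost. *)

Section PowersOfVariables.
Variables (R : idomainType) (n : nat).
Implicit Types (i j k : 'I_n) (m : 'X_{1..n}) (p q a b c : {mpoly R[n]}).

Lemma mcoeff_XUnM i N q m :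
  ('X_i ^+ N * q)@_m = if (m i < N)%N then 0 else q@_(m - U_(i) *+ N).
Proof.
rewrite mpolyXn mulrC; case: ltnP => [lt_mN|le_Nm].
  apply/memN_msupp_eq0; rewrite (perm_mem (msuppMX _ _)).
  apply/mapP => -[m' _ Dm]; move: lt_mN.
  by rewrite Dm mnmDE mulmnE mnm1E eqxx mul1n ltnNge leq_addr.
have le_UN : (U_(i) *+ N <= m)%MM.
  apply/mnm_lepP => j; rewrite mulmnE mnm1E.
  by case: eqP => [<-|_]; rewrite ?mul1n ?mul0n.
by rewrite -{1}(submK le_UN) addmC mcoeffMX.
Qed.

(** The canonical representative of [p] modulo ['X_i ^+ N]. Divisibility is proved below by showing
    that such a remainder vanishes. *)
Definition low i N p : {mpoly R[n]} :=
  \sum_(m <- msupp p | (m i < N)%N) p@_m *: 'X_[m].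

Lemma mcoeff_low i N p m : (low i N p)@_m = if (m i < N)%N then p@_m else 0.
Proof.
rewrite raddf_sum /= (eq_bigr (fun m' => if m' == m then p@_m else 0)); last first.
  by move=> m' _; rewrite mcoeffZ mcoeffX; case: eqP => [->|_]; rewrite ?mulr1 ?mulr0.
case: (boolP (m \in msupp p)) => [m_p|mNp].
  rewrite -big_filter -big_mkcond big_filter_cond /=.
  rewrite big_mkcond (bigD1_seq m) ?msupp_uniq //= eqxx andbT.
  rewrite big1 ?addr0; first by case: ifP.
  by move=> m' /negPf ->; rewrite andbF.
rewrite (memN_msupp_eq0 mNp) if_same; apply: big1 => m' _.
by case: eqP.
Qed.

Lemma low_split i N p : exists q, p = low i N p + 'X_i ^+ N * q.
Proof.
exists (\sum_(m <- msupp p | ~~ (m i < N)%N) p@_m *: 'X_[m - U_(i) *+ N]).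
rewrite {1}[p]mpolyE (bigID (fun m => (m i < N)%N)) /=; congr (_ + _).
rewrite mulr_sumr; apply: eq_bigr => m; rewrite -leqNgt => le_Nm.
rewrite -scalerAr mpolyXn -mpolyXD addmC submK //.
apply/mnm_lepP => j; rewrite mulmnE mnm1E.
by case: eqP => [<-|_]; rewrite ?mul1n ?mul0n.
Qed.

Lemma XUn_neq0 i N : 'X_i ^+ N != 0 :> {mpoly R[n]}.
Proof. by rewrite expf_neq0 // -msupp_eq0 msuppX. Qed.

(** Multiplication by ['X_i ^+ N] does not touch the exponent of ['X_j], so the remainder of [a]
    modulo ['X_j ^+ M] stays reduced while becoming a multiple of ['X_j ^+ M]: it is zero. *)
Lemma XUn_coprime i j N M a b : i != j ->
  'X_i ^+ N * a = 'X_j ^+ M * b -> exists c, a = 'X_j ^+ M * c.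
Proof.
move=> ne_ij eq_ab; have [q Da] := low_split j M a; exists q.
suff a'0 : low j M a = 0 by rewrite {1}Da a'0 add0r.
have eq_a' : 'X_i ^+ N * low j M a = 'X_j ^+ M * (b - 'X_i ^+ N * q).
  by rewrite mulrBr -eq_ab {2}Da; ring.
apply/mpolyP => m; rewrite mcoeff0 mcoeff_low; case: ltnP => // lt_mM.
have := congr1 (mcoeff (m + U_(i) *+ N)) eq_a'; rewrite !mcoeff_XUnM.
rewrite !mnmDE !mulmnE !mnm1E eqxx (negPf ne_ij) mul1n mul0n addn0 lt_mM.
by rewrite ltnNge leq_addl /= addmK mcoeff_low lt_mM.
Qed.

(** ['X_k] is a nonzerodivisor modulo powers of other variables: shifting the exponent of ['X_k]
    keeps the doubly reduced part of [c] reduced, whereas the right-hand side has no such terms. *)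
Lemma XUn_regular2 i j k N M e a b c : k != i -> k != j ->
  'X_k ^+ e * c = 'X_i ^+ N * a + 'X_j ^+ M * b ->
  exists a' b', c = 'X_i ^+ N * a' + 'X_j ^+ M * b'.
Proof.
move=> ne_ki ne_kj eq_c.
have [q1 Dc] := low_split i N c; have [q2 Dl] := low_split j M (low i N c).
exists q1, q2; rewrite {1}Dc {1}Dl.
suff -> : low j M (low i N c) = 0 by ring.
have eq_c' : 'X_k ^+ e * low j M (low i N c) =
   'X_i ^+ N * (a - 'X_k ^+ e * q1) + 'X_j ^+ M * (b - 'X_k ^+ e * q2).
  transitivity ('X_k ^+ e * (c - 'X_i ^+ N * q1 - 'X_j ^+ M * q2)).
    congr (_ * _); rewrite [X in _ = X - _ - _]Dc [X in _ = X + _ - _ - _]Dl.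
    by ring.
  by rewrite !mulrBr eq_c; ring.
apply/mpolyP => m; rewrite mcoeff0 !mcoeff_low.
case: ltnP => // lt_mM; case: ltnP => // lt_mN.
have := congr1 (mcoeff (m + U_(k) *+ e)) eq_c'.
rewrite mcoeffD !mcoeff_XUnM !mnmDE !mulmnE !mnm1E eqxx (negPf ne_ki) (negPf ne_kj).
rewrite mul1n mul0n !addn0 lt_mM lt_mN.
by rewrite ltnNge leq_addl /= addmK addr0 !mcoeff_low lt_mM lt_mN.
Qed.

(** Cancelling [F] gives ['X_j ^+ M * a = 'X_i ^+ N * b], so ['X_i ^+ N] divides its cofactor [a]
    and can be cancelled too. *)
Lemma XUn_dvd i j N M (F G : {mpoly R[n]}) a b : i != j -> F != 0 ->
  'X_i ^+ N * G = F * a -> 'X_j ^+ M * G = F * b -> exists c, G = F * c.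
Proof.
move=> ne_ij F0 Ga Gb.
have /XUn_coprime[|c Dc]: 'X_j ^+ M * a = 'X_i ^+ N * b.
- by apply: (mulfI F0); rewrite mulrCA -Ga [RHS]mulrCA -Gb; ring.
- by rewrite eq_sym.
exists c; apply: (mulfI (XUn_neq0 i N)).
by rewrite Ga Dc; ring.
Qed.

(** The remainders [low i 1] are the values at ['X_i = 0]. Their product is free of ['X_i] and
    divisible by it, hence zero, and the polynomial ring is a domain. *)
Lemma prime_XU i F G c : F * G = 'X_i * c ->
  (exists a, F = 'X_i * a) \/ (exists a, G = 'X_i * a).
Proof.
move=> eq_FG; have [a Da] := low_split i 1 F; have [b Db] := low_split i 1 G.
suff /eqP: low i 1 F * low i 1 G = 0.
  rewrite mulf_eq0 => /orP[/eqP F0|/eqP G0].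
  - by left; exists a; rewrite Da F0 add0r expr1.
  - by right; exists b; rewrite Db G0 add0r expr1.
have eq_low : low i 1 F * low i 1 G =
    'X_i ^+ 1 * (c - a * G - b * F + 'X_i * a * b).
  have -> : low i 1 F = F - 'X_i ^+ 1 * a by rewrite {2}Da addrK.
  have -> : low i 1 G = G - 'X_i ^+ 1 * b by rewrite {2}Db addrK.
  by rewrite !expr1 mulrDl !mulrDr eq_FG; ring.
apply/mpolyP => m; rewrite mcoeff0; case: (ltnP (m i) 1) => [lt_m1|].
  by rewrite eq_low mcoeff_XUnM lt_m1.
move=> m_gt0; rewrite mcoeffM big1 // => -[k l] /eqP /= Dm.
rewrite !mcoeff_low; case: ltnP => // k0; last by rewrite mul0r.
case: ltnP => // l0; last by rewrite mulr0.
by have := congr1 (fun m : 'X_{1..n} => m i) Dm; rewrite mnmDE; lia.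
Qed.

Lemma prime_XUn i e F G c : ~ (exists a, F = 'X_i * a) ->
  F * G = 'X_i ^+ e * c -> exists a, G = 'X_i ^+ e * a.
Proof.
move=> NdvdF; elim: e G c => [|e IH] G c.
  by move=> _; exists G; rewrite expr0 mul1r.
rewrite exprS -mulrA => eq_FG; have [//|[G' DG]] := prime_XU eq_FG.
have [|a Da] := IH G' c.
  by apply: (mulfI (XUn_neq0 i 1)); rewrite expr1 -eq_FG DG; ring.
by exists a; rewrite DG Da mulrA.
Qed.

(* F, X_k^e is a regular sequence, and X_i, X_j generate an ideal of positive
   grade modulo it. *)
Lemma XUn_dvd2 i j k N M e (F G : {mpoly R[n]}) a1 b1 a2 b2 :
  i != j -> k != i -> k != j -> ~ (exists a, F = 'X_k * a) ->
  'X_i ^+ N * G = F * a1 + 'X_k ^+ e * b1 ->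
  'X_j ^+ M * G = F * a2 + 'X_k ^+ e * b2 ->
  exists a b, G = F * a + 'X_k ^+ e * b.
Proof.
move=> ne_ij ne_ki ne_kj NdvdF G1 G2.
(* Eliminating [G] makes [F] times this difference of cofactors a multiple of ['X_k ^+ e], a power
   that [F] cannot absorb. *)
have [|c Dc] := @prime_XUn k e F ('X_j ^+ M * a1 - 'X_i ^+ N * a2)
    ('X_i ^+ N * b2 - 'X_j ^+ M * b1) NdvdF.
  rewrite !mulrBr [F * _]mulrCA [F * ('X_i ^+ _ * _)]mulrCA.
  have -> : F * a1 = 'X_i ^+ N * G - 'X_k ^+ e * b1 by rewrite G1 addrK.
  have -> : F * a2 = 'X_j ^+ M * G - 'X_k ^+ e * b2 by rewrite G2 addrK.
  by ring.
have [c1 [c2 Dc12]]: exists c1 c2, c = 'X_j ^+ M * c1 + 'X_i ^+ N * c2.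
  apply: (@XUn_regular2 j i k M N e a1 (- a2)) => //.
  by rewrite -Dc; ring.
(* Corrected by multiples of ['X_k ^+ e], the cofactors of [F] satisfy an exact proportion, so [a1]
   is ['X_i ^+ N * a] modulo ['X_k ^+ e]. *)
have /XUn_coprime[|a Da]: 'X_j ^+ M * (a1 - 'X_k ^+ e * c1) =
    'X_i ^+ N * (a2 + 'X_k ^+ e * c2).
- apply/eqP; rewrite -subr_eq0; apply/eqP.
  transitivity ('X_j ^+ M * a1 - 'X_i ^+ N * a2 - 'X_k ^+ e * c).
    by rewrite Dc12; ring.
  by rewrite Dc subrr.
- by rewrite eq_sym.
have /XUn_coprime[|b Db]: 'X_i ^+ N * (G - F * a) = 'X_k ^+ e * (b1 + F * c1).
- rewrite mulrBr G1; have -> : a1 = 'X_i ^+ N * a + 'X_k ^+ e * c1.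
    by rewrite -Da subrK.
  by ring.
- by rewrite eq_sym.
by exists a, b; rewrite -Db addrC subrK.
Qed.

(** Exactness of the Koszul complex on three powers of variables: up to sign, a syzygy is the cross
    product of the vector of powers with [(u, v, w)]. *)
Lemma koszul_XUn i j k N a b c : i != j -> k != i -> k != j ->
  'X_i ^+ N * a + 'X_j ^+ N * b + 'X_k ^+ N * c = 0 ->
  exists u v w, [/\ a = 'X_k ^+ N * v - 'X_j ^+ N * w,
    b = 'X_i ^+ N * w - 'X_k ^+ N * u & c = 'X_j ^+ N * u - 'X_i ^+ N * v].
Proof.
move=> ne_ij ne_ki ne_kj eq0.
have [v [u Dc]]: exists v u, c = 'X_i ^+ N * v + 'X_j ^+ N * u.
  apply: (@XUn_regular2 i j k N N N (- a) (- b)) => //.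
  by apply/eqP; rewrite -subr_eq0 -[X in _ == X]eq0; apply/eqP; ring.
have /XUn_coprime[|w Dw]:
    'X_i ^+ N * (a + 'X_k ^+ N * v) = 'X_j ^+ N * - (b + 'X_k ^+ N * u).
- by apply/eqP; rewrite -subr_eq0 -[X in _ == X]eq0 Dc; apply/eqP; ring.
- by [].
exists u, (- v), (- w); split.
- by rewrite -[a](addrK ('X_k ^+ N * v)) Dw; ring.
- apply: (mulfI (XUn_neq0 j N)); apply/eqP; rewrite -subr_eq0; apply/eqP.
  rewrite -[RHS]eq0 Dc -[a](addrK ('X_k ^+ N * v)) Dw; ring.
- by rewrite Dc; ring.
Qed.

End PowersOfVariables.

(** * Homogeneous components of products *)

Section Homogeneous.
Variables (R : idomainType) (n : nat).
Implicit Types (p q : {mpoly R[n]}) (d e : nat).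
Local Notation pih := (pihomog mdeg).

Lemma dhomogXU (i : 'I_n) : ('X_i : {mpoly R[n]}) \is 1.-homog.
Proof. by rewrite dhomogX /= mdeg1. Qed.

Lemma dhomogXUn (i : 'I_n) N : ('X_i ^+ N : {mpoly R[n]}) \is N.-homog.
Proof. by rewrite -[X in X.-homog]mul1n; apply/dhomogMn/dhomogXU. Qed.

Lemma dhomogXUM i e p : p \is e.-homog -> 'X_i * p \is e.+1.-homog.
Proof. by move=> hp; rewrite -add1n dhomogM ?dhomogXU. Qed.

Lemma pihomogM d e p q : p \is d.-homog ->
  pih (d + e)%N (p * q) = p * pih e q.
Proof.
move=> hp; rewrite [q]mpolyE mulr_sumr !linear_sum mulr_sumr /=.
apply: eq_bigr => m _; rewrite -scalerAr !linearZ /= -scalerAr pihomogX /=.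
have hpm : p * 'X_[m] \is (d + mdeg m).-homog by rewrite dhomogM ?dhomogX.
congr (_ *: _); case: eqP => [<-|/eqP ne]; first by rewrite pihomog_dE.
by rewrite (pihomog_ne0 _ hpm) ?mulr0 // eqn_add2l.
Qed.

Lemma pihomogXU i e p : pih e.+1 ('X_i * p) = 'X_i * pih e p.
Proof. by rewrite -add1n pihomogM ?dhomogXU. Qed.

Lemma pihomogM_lt d e p q : p \is d.-homog -> (e < d)%N -> pih e (p * q) = 0.
Proof.
move=> hp lt_ed; rewrite [q]mpolyE mulr_sumr !linear_sum big1 //= => m _.
rewrite -scalerAr linearZ /=.
have hpm : p * 'X_[m] \is (d + mdeg m).-homog by rewrite dhomogM ?dhomogX.
by rewrite (pihomog_ne0 _ hpm) ?scaler0 //; lia.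
Qed.

Lemma dhomog_mulIl d e p q : p != 0 -> p \is d.-homog ->
  p * q \is (d + e).-homog -> q \is e.-homog.
Proof.
move=> p0 hp hpq; have := pihomogM e q hp.
by rewrite (pihomog_dE hpq) => /(mulfI p0) ->; apply: pihomogP.
Qed.

Lemma dhomog_mul_eq0 d e p q : p != 0 -> p \is d.-homog ->
  p * q \is e.-homog -> (e < d)%N -> q = 0.
Proof.
move=> p0 hp hpq lt_ed; apply: (mulfI p0).
by rewrite mulr0 -(pihomogM_lt q hp lt_ed) pihomog_dE.
Qed.

(* If [e < d] then [q = 0], so the truncated subtraction is harmless. *)
Lemma dhomog_dvd d e p q : p != 0 -> p \is d.-homog ->
  p * q \is e.-homog -> q \is (e - d)%N.-homog.
Proof.
move=> p0 hp hpq; case: (leqP d e) => [le_de|lt_ed].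
  by apply: dhomog_mulIl p0 hp _; rewrite subnKC.
by rewrite (dhomog_mul_eq0 p0 hp hpq lt_ed) dhomog0.
Qed.

End Homogeneous.

(** * Vectors with three polynomial entries *)

Lemma ord3_ind (P : 'I_3 -> Prop) : P iX -> P iY -> P iZ -> forall l, P l.
Proof.
move=> PX PY PZ [[|[|[|//]]] lt_l].
- by rewrite (_ : Ordinal lt_l = iX) //; apply: val_inj.
- by rewrite (_ : Ordinal lt_l = iY) //; apply: val_inj.
- by rewrite (_ : Ordinal lt_l = iZ) //; apply: val_inj.
Qed.

Lemma sum3E (V : nmodType) (f : 'I_3 -> V) : \sum_l f l = f iX + f iY + f iZ.
Proof.
rewrite !big_ord_recl big_ord0 addr0 addrA.
by congr (f _ + f _ + f _); apply: val_inj.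
Qed.

Lemma mpolyX3E (R : idomainType) (m : 'X_{1..3}) :
  'X_[m] = 'X_iX ^+ m iX * 'X_iY ^+ m iY * 'X_iZ ^+ m iZ :> {mpoly R[3]}.
Proof.
rewrite mpolyXE_id !big_ord_recl big_ord0 mulr1 mulrA.
by congr ('X_[U_(_)] ^+ m _ * 'X_[U_(_)] ^+ m _ * 'X_[U_(_)] ^+ m _); apply: val_inj.
Qed.

Lemma mdeg3E (m : 'X_{1..3}) : mdeg m = (m iX + m iY + m iZ)%N.
Proof. by rewrite mdegE sum3E. Qed.

Definition cross (S : pzRingType) (a b : 'I_3 -> S) (l : 'I_3) : S :=
  match val l with
  | 0 => a iY * b iZ - a iZ * b iY
  | 1 => a iZ * b iX - a iX * b iZ
  | _ => a iX * b iY - a iY * b iX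
  end.

Definition unitv (S : pzRingType) (k l : 'I_3) : S := (k == l)%:R.

Lemma dot_cross (S : comPzRingType) (a b : 'I_3 -> S) :
  \sum_l a l * cross a b l = 0.
Proof. by rewrite sum3E /cross /=; ring. Qed.

(** Lagrange's formula for the triple product, with a basis vector as last factor. *)
Lemma cross_cross_unitv (S : comPzRingType) (a b : 'I_3 -> S) k l :
  cross a (cross b (unitv S k)) l =
  a k * b l - (\sum_i a i * b i) * unitv S k l.
Proof.
rewrite sum3E; elim/ord3_ind: k; elim/ord3_ind: l;
  rewrite /cross /unitv /=; ring.
Qed.

Lemma cross_lin (S : comPzRingType) (a b c : 'I_3 -> S) x l :
  cross a (fun k => b k + x * c k) l = cross a b l + x * cross a c l.
Proof. by elim/ord3_ind: l; rewrite /cross /=; ring. Qed.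

Section Forms.
Variables (R : idomainType).
Local Notation T := {mpoly R[3]}.
Local Notation E := (fun k : 'I_3 => 'X_k : T).
Local Notation pih := (pihomog mdeg).
Implicit Types (n d e N : nat) (v w : 'I_3 -> T).

Lemma pihomog_cross n v l :
  pih n.+1 (cross E v l) = cross E (fun k => pih n (v k)) l.
Proof.
elim/ord3_ind: l; rewrite /cross /= linearB /= !pihomogXU.
all: by [].
Qed.

Lemma dhomog_cross n v l :
  (forall k, v k \is n.-homog) -> cross E v l \is n.+1.-homog.
Proof.
by move=> hv; elim/ord3_ind: l; rewrite /cross /= dhomogD ?dhomogN //;
  apply: dhomogXUM.
Qed.

(** Koszul exactness for the variables themselves; [cross_eq0] is the exactness one step further. *)
Lemma dot_eq0 w : \sum_l 'X_l * w l = 0 -> exists v, forall l, w l = cross E v l.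
Proof.
rewrite sum3E => w0.
have [||||u [v' [w' [Da Db Dc]]]] := @koszul_XUn R 3 iX iY iZ 1 (w iX) (w iY) (w iZ).
1-3: by [].
- by rewrite !expr1.
exists (fun k : 'I_3 => match val k with 0 => - u | 1 => - v' | _ => - w' end).
by elim/ord3_ind; rewrite /cross /= ?Da ?Db ?Dc; ring.
Qed.

Lemma dot_eq0_homog n w : (forall l, w l \is n.+1.-homog) ->
  \sum_l 'X_l * w l = 0 ->
  exists2 v, forall k, v k \is n.-homog & forall l, w l = cross E v l.
Proof.
move=> hw /dot_eq0[v Dw]; exists (fun k => pih n (v k)) => [k|l].
  exact: pihomogP.
by rewrite -pihomog_cross -Dw pihomog_dE.
Qed.

Lemma cross_eq0 v : (forall l, cross E v l = 0) ->
  exists s, forall l, v l = 'X_l * s.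
Proof.
move=> v0; have := v0 iZ; have := v0 iY; rewrite /cross /=.
move=> /eqP; rewrite subr_eq0 => /eqP eq_zx /eqP; rewrite subr_eq0 => /eqP eq_xy.
have [||s Ds] := @XUn_coprime R 3 iZ iX 1 1 (v iX) (v iZ).
- by [].
- by rewrite !expr1.
exists s; rewrite expr1 in Ds; apply: ord3_ind => //.
- by apply: (mulfI (XUn_neq0 R iX 1)); rewrite expr1 eq_xy Ds; ring.
- by apply: (mulfI (XUn_neq0 R iX 1)); rewrite expr1 -eq_zx Ds; ring.
Qed.

(** Pigeonhole: three exponents below [N] add up to at most [3 N - 3], which is less than [D]. *)
Lemma irrelevant_power D N (p : T) : p \is D.-homog -> (3 * N <= D + 2)%N ->
  exists c : 'I_3 -> T, p = \sum_l 'X_l ^+ N * c l.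
Proof.
move=> hp leND.
have [q1 D1] := low_split iX N p; have [q2 D2] := low_split iY N (low iX N p).
have [q3 D3] := low_split iZ N (low iY N (low iX N p)).
have low0 : low iZ N (low iY N (low iX N p)) = 0.
  apply/mpolyP => m; rewrite mcoeff0 !mcoeff_low.
  case: ltnP => // ltZ; case: ltnP => // ltY; case: ltnP => // ltX.
  apply/(dhomog_nemf_coeff hp)/eqP => /=; rewrite mdegE sum3E => Dm.
  by move: ltX ltY ltZ; lia.
exists (fun k : 'I_3 => match val k with 0 => q1 | 1 => q2 | _ => q3 end).
by rewrite sum3E /= {1}D1 {1}D2 {1}D3 low0; ring.
Qed.

Lemma irrelevant_homog D (p : T) : p \is D.+1.-homog ->
  exists2 c : 'I_3 -> T, forall l, c l \is D.-homog & p = \sum_l 'X_l * c l.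
Proof.
move=> hp; have [|c Dp] := irrelevant_power (N := 1) hp; first by lia.
exists (fun l => pih D (c l)) => [l|]; first exact: pihomogP.
rewrite -(pihomog_dE hp) Dp linear_sum; apply: eq_bigr => l _.
by rewrite expr1 /= pihomogXU.
Qed.

Lemma pihomog_mul_ex d e (p q : T) : p \is d.-homog ->
  exists q', pih e (p * q) = p * q'.
Proof.
move=> hp; case: (leqP d e) => [le_de|lt_ed].
  by exists (pih (e - d) q); rewrite -{1}(subnKC le_de) pihomogM.
by exists 0; rewrite mulr0 (pihomogM_lt _ hp).
Qed.

(** The degree is given coefficient by coefficient so that [e < d], where [q = 0], is covered
    without truncated subtraction; the lists [mons] follow the same convention. *)
Lemma mdeg_dvd d e (p q : T) m : p != 0 -> p \is d.-homog ->
  p * q \is e.-homog -> q@_m != 0 -> (d + mdeg m)%N = e.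
Proof.
move=> p0 hp hpq qm; case: (leqP d e) => [le_de|lt_ed].
  move: hpq; rewrite -{1}(subnKC le_de) => hpq.
  have /dhomog_mf hq := dhomog_mulIl p0 hp hpq.
  by rewrite (hq m) ?subnKC // mcoeff_msupp.
by rewrite (dhomog_mul_eq0 p0 hp hpq lt_ed) mcoeff0 eqxx in qm.
Qed.

Lemma mderiv_homog d (p : T) i : p \is d.-homog -> p^`M(i) \is d.-1.-homog.
Proof.
move=> /dhomogP hp; apply/dhomogP => m; rewrite mcoeff_msupp mcoeff_mderiv.
move=> pm; have : (m + U_(i))%MM \in msupp p.
  by rewrite mcoeff_msupp; apply: contraNneq pm => ->; rewrite mul0rn.
by move=> /hp /=; rewrite mdegD mdeg1 addn1 => <-.
Qed.

Lemma euler d (p : T) : p \is d.-homog -> \sum_l 'X_l * p^`M(l) = p *+ d.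
Proof.
move=> /dhomogP hp; rewrite {2}[p]mpolyE -sumrMnl.
under eq_bigr do rewrite {1}[p]mpolyE linear_sum mulr_sumr.
rewrite exchange_big /=; apply: eq_big_seq => m /hp /= <-.
rewrite mdegE -sumrMnr; apply: eq_bigr => l _.
rewrite mderivZ mderivX -!scalerAr scalerMnr; congr (_ *: _).
case: (posnP (m l)) => [->|ml]; first by rewrite scale0r mulr0n.
rewrite scaler_nat -mpolyXD addmC submK //.
by apply/mnm_lepP => j; rewrite mnm1E; case: eqP => [<-|].
Qed.

End Forms.

(** * The Jacobian ideal *)

Section Jacobian.
Variables (R : idomainType) (d : nat) (F : {mpoly R[3]}).
Local Notation T := {mpoly R[3]}.
Local Notation E := (fun k : 'I_3 => 'X_k : T).
Local Notation DF := (fun k : 'I_3 => F^`M(k)).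
Local Notation pih := (pihomog mdeg).
Hypotheses (d_gt0 : (0 < d)%N) (F0 : F != 0) (hF : F \is d.-homog).

(** The homogeneous Jacobian criterion: [F] and its partial derivatives have no common zero in the
    projective plane over R. *)
Definition jacobian_irrelevant : Prop :=
  exists M, forall i : 'I_3, exists (a : T) (c : 'I_3 -> T),
    'X_i ^+ M = a * F + \sum_k c k * F^`M(k).

(** Multiplying [G] by the expression of ['X_i ^+ M] in the Jacobian ideal gives a multiple of [F];
    powers of two variables then suffice to conclude for [G]. *)
Lemma jacobian_dvd (G : T) : jacobian_irrelevant ->
  (forall k, exists t, G * F^`M(k) = F * t) -> exists t, G = F * t.
Proof.
move=> [M irrF] /fin_all_exists[t Dt].
have dvd i : exists b, 'X_i ^+ M * G = F * b.
  have [a [c ->]] := irrF i; exists (a * G + \sum_k c k * t k).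
  rewrite mulrDl mulrDr mulr_suml mulr_sumr; congr (_ + _); first by ring.
  by apply: eq_bigr => k _; rewrite mulrCA -Dt; ring.
have [[a Da] [b Db]] := (dvd iX, dvd iY).
exact: (@XUn_dvd _ _ iX iY M M F G a b).
Qed.

Lemma jacobian_dvd2 e (G : T) : jacobian_irrelevant ->
  ~ (exists a, F = 'X_iZ * a) ->
  (forall k, exists t s, G * F^`M(k) = F * t + 'X_iZ ^+ e * s) ->
  exists a b, G = F * a + 'X_iZ ^+ e * b.
Proof.
move=> [M irrF] NdvdF /fin_all_exists[t /fin_all_exists[s Ds]].
have dvd i : exists a b, 'X_i ^+ M * G = F * a + 'X_iZ ^+ e * b.
  have [a [c ->]] := irrF i.
  exists (a * G + \sum_k c k * t k), (\sum_k c k * s k).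
  rewrite mulrDl mulrDr mulr_suml !mulr_sumr -addrA -big_split /=.
  congr (_ + _); first by ring.
  by apply: eq_bigr => k _; rewrite -mulrA [_ * G]mulrC Ds; ring.
have [[a1 [b1 D1]] [a2 [b2 D2]]] := (dvd iX, dvd iY).
exact: (@XUn_dvd2 _ _ iX iY iZ M M e F G a1 b1 a2 b2).
Qed.

(* [w i / X_i^N] is a form on the chart [X_i != 0], and [h i j] describes its
   difference with the form on another chart modulo [F]. The [h i j] form a
   cocycle modulo [F], which bounds for degree reasons (H^1(C, O(n+1-d)) = 0);
   after subtracting a coboundary the forms glue, by exactness of the Koszul
   complex, to a vector of polynomials. *)
Lemma cech_gluing n N (w : 'I_3 -> 'I_3 -> T) (h : 'I_3 -> 'I_3 -> T)
    (u : 'I_3 -> 'I_3 -> 'I_3 -> T) :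
  jacobian_irrelevant -> (d <= n)%N -> (2 * d <= n + 3)%N -> (0 < N)%N ->
  (forall i l, w i l \is (N + n)%N.-homog) ->
  (forall i, \sum_l 'X_l * w i l = 0) ->
  (forall i j, h i j \is (2 * N + (n + 1 - d))%N.-homog) ->
  (forall i j l, 'X_j ^+ N * w i l - 'X_i ^+ N * w j l =
     h i j * F^`M(l) + F * u i j l) ->
  exists (v : 'I_3 -> T) p s, (forall k, v k \is n.-1.-homog) /\
    forall l, w iZ l = 'X_iZ ^+ N * cross E v l + p * F^`M(l) + F * s l.
Proof.
move=> irrF le_dn le_2dn N_gt0 hw w0 hh Dw.
(* The cocycle condition: the weighted differences telescope, so this combination of the [h i j]
   times the gradient is divisible by [F], and by smoothness so is the combination. *)
have [r Dr]: exists r,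
    'X_iX ^+ N * h iY iZ + 'X_iY ^+ N * h iZ iX + 'X_iZ ^+ N * h iX iY = F * r.
  apply: jacobian_dvd => // k; exists (- ('X_iX ^+ N * u iY iZ k
    + 'X_iY ^+ N * u iZ iX k + 'X_iZ ^+ N * u iX iY k)).
  have [D1 [D2 D3]] := (Dw iX iY k, (Dw iY iZ k, Dw iZ iX k)).
  apply/eqP; rewrite -subr_eq0; apply/eqP.
  transitivity ('X_iX ^+ N * (h iY iZ * F^`M(k) + F * u iY iZ k)
    + 'X_iY ^+ N * (h iZ iX * F^`M(k) + F * u iZ iX k)
    + 'X_iZ ^+ N * (h iX iY * F^`M(k) + F * u iX iY k)); first by ring.
  by rewrite -D1 -D2 -D3; ring.
have hr : r \is (3 * N + (n + 1 - d) - d)%N.-homog.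
  apply: dhomog_dvd F0 hF _; rewrite -Dr -[(3 * N)%N]/((N + 2 * N)%N) -addnA.
  by rewrite !dhomogD // dhomogM ?dhomogXUn.
(* The degree of [r] is at least [3 N - 2] precisely because [n >= 2 d - 3]. *)
have [|c Dc] := irrelevant_power (N := N) hr; first by lia.
have [||||p1 [p2 [p3 [E23 E31 E12]]]] := @koszul_XUn R 3 iX iY iZ N
  (h iY iZ - F * c iX) (h iZ iX - F * c iY) (h iX iY - F * c iZ).
1-3: by [].
  apply/eqP; move/eqP: Dr; rewrite -subr_eq0 Dc sum3E => /eqP <-.
  by apply/eqP; ring.
(* Once the [h i j] form an exact cocycle, [F] can be cancelled in what remains, and the parts
   [u i j] form an exact cocycle too after correction by [c]. *)
have /fin_all_exists[s1 /fin_all_exists[s2 /fin_all_exists[s3 Ds]]] :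
    forall l : 'I_3, exists a1 a2 a3,
   [/\ u iY iZ l + c iX * F^`M(l) = 'X_iZ ^+ N * a2 - 'X_iY ^+ N * a3,
       u iZ iX l + c iY * F^`M(l) = 'X_iX ^+ N * a3 - 'X_iZ ^+ N * a1 &
       u iX iY l + c iZ * F^`M(l) = 'X_iY ^+ N * a1 - 'X_iX ^+ N * a2].
  move=> l; apply: koszul_XUn => //; apply: (mulfI F0); rewrite mulr0.
  have [D1 [D2 D3]] := (Dw iX iY l, (Dw iY iZ l, Dw iZ iX l)).
  have <- : 'X_iX ^+ N * ('X_iZ ^+ N * w iY l - 'X_iY ^+ N * w iZ l)
   + 'X_iY ^+ N * ('X_iX ^+ N * w iZ l - 'X_iZ ^+ N * w iX l)
   + 'X_iZ ^+ N * ('X_iY ^+ N * w iX l - 'X_iX ^+ N * w iY l)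
   - F^`M(l) * ('X_iX ^+ N * (h iY iZ - F * c iX)
   + 'X_iY ^+ N * (h iZ iX - F * c iY) + 'X_iZ ^+ N * (h iX iY - F * c iZ)) = 0.
    by rewrite E23 E31 E12; ring.
  by rewrite D1 D2 D3; ring.
(* The corrected vectors agree exactly and no longer just modulo [F]; comparing the charts X and Z
   already removes the denominator. *)
pose w1 l := w iX l - p1 * F^`M(l) - F * s1 l.
pose w3 l := w iZ l - p3 * F^`M(l) - F * s3 l.
have w13 l : 'X_iX ^+ N * w3 l = 'X_iZ ^+ N * w1 l.
  have D3 := Dw iZ iX l; have [_ Eu _] := Ds l; apply/eqP.
  have -> : ('X_iX ^+ N * w3 l == 'X_iZ ^+ N * w1 l) =
    ('X_iX ^+ N * w iZ l - 'X_iZ ^+ N * w iX l ==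
      ('X_iX ^+ N * p3 - 'X_iZ ^+ N * p1) * F^`M(l)
      + F * ('X_iX ^+ N * s3 l - 'X_iZ ^+ N * s1 l)).
    by rewrite -subr_eq0 -[RHS]subr_eq0; congr (_ == 0); rewrite /w1 /w3; ring.
  by rewrite D3 -E31 -Eu; apply/eqP; ring.
have /fin_all_exists[x Dx] l : exists x, w3 l = 'X_iZ ^+ N * x.
  exact: XUn_coprime (w13 l).
have Dx1 l : w1 l = 'X_iX ^+ N * x l.
  by apply: (mulfI (XUn_neq0 R iZ N)); rewrite -w13 Dx; ring.
have dotw i p (s : 'I_3 -> T) :
    \sum_l 'X_l * (w i l - p * F^`M(l) - F * s l) =
    F * (- (p *+ d) - \sum_l 'X_l * s l).
  transitivity (\sum_l 'X_l * w i l - p * (\sum_l 'X_l * F^`M(l))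
      - F * \sum_l 'X_l * s l).
    by rewrite !sum3E; ring.
  by rewrite w0 (euler hF); ring.
(* Orthogonality to [E] survives only modulo [F]: the gradient correction contributes a multiple of
   [F] by Euler's identity. *)
have [q Dq]: exists q, \sum_l 'X_l * x l = F * q.
  apply: (@XUn_dvd R 3 iX iZ N N F _ (- (p1 *+ d) - \sum_l 'X_l * s1 l)
    (- (p3 *+ d) - \sum_l 'X_l * s3 l)) => //.
  - by rewrite -(dotw iX) mulr_sumr; apply: eq_bigr => l _; rewrite mulrCA -Dx1.
  - by rewrite -(dotw iZ) mulr_sumr; apply: eq_bigr => l _; rewrite mulrCA -Dx.
(* The witnesses of Koszul exactness carry no degree; taking homogeneous components restores it. *)
pose x' l := pih n (x l).
have Dw3 l : w iZ l = 'X_iZ ^+ N * x' l + pih (N + (n + 1 - d))%N p3 * F^`M(l)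
    + F * pih (N + n - d)%N (s3 l).
  rewrite -{1}(pihomog_dE (hw iZ l)).
  have -> : w iZ l = 'X_iZ ^+ N * x l + F^`M(l) * p3 + F * s3 l.
    by rewrite -Dx /w3; ring.
  rewrite !linearD /= pihomogM ?dhomogXUn //.
  have {1}-> : (N + n = d.-1 + (N + (n + 1 - d)))%N by lia.
  have -> : (N + n = d + (N + n - d))%N by lia.
  rewrite !pihomogM ?mderiv_homog //; rewrite addKn /x'.
  by rewrite [pih _ p3 * _]mulrC.
have Dq' : \sum_l 'X_l * x' l = F * pih (n + 1 - d)%N q.
  rewrite -(pihomogM _ _ hF) -Dq (_ : d + (n + 1 - d) = n.+1)%N; last by lia.
  by rewrite linear_sum; apply: eq_bigr => l _; rewrite /= pihomogXU.
(* As [d <= n], this component of [q] has positive degree and is a combination of the variables;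
   subtracting [F * y] makes the vector exactly orthogonal to [E]. *)
have [|y hy Dy] := @irrelevant_homog R (n - d) (pih (n + 1 - d)%N q).
  by rewrite (_ : (n - d).+1 = n + 1 - d)%N ?pihomogP //; lia.
have [l||v hv Dv] := @dot_eq0_homog R n.-1 (fun l => x' l - F * y l).
- rewrite prednK; last by lia.
  by have := dhomogM hF (hy l); rewrite subnKC // => hFy; rewrite rpredB ?pihomogP.
- transitivity (\sum_l 'X_l * x' l - F * \sum_l 'X_l * y l).
    by rewrite !sum3E; ring.
  by rewrite Dq' -Dy subrr.
exists v, (pih (N + (n + 1 - d))%N p3),
  (fun l => pih (N + n - d)%N (s3 l) + 'X_iZ ^+ N * y l); split=> // l.
by rewrite -Dv Dw3; ring.
Qed.

(** The cross product of the gradient with [G], expanded along the basis vectors because these terms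
    are the generators listed by the algorithm. *)
Definition jac_vector (G : 'I_3 -> T) (l : 'I_3) : T :=
  \sum_k G k * cross DF (unitv T k) l.

Lemma cross_jac_vector G l :
  cross E (jac_vector G) l =
  (\sum_k 'X_k * G k) * F^`M(l) - F * (G l *+ d).
Proof.
transitivity (\sum_k G k * cross E (cross DF (unitv T k)) l).
  by rewrite /jac_vector /cross; elim/ord3_ind: l; rewrite /= !sum3E /=; ring.
under eq_bigr do rewrite cross_cross_unitv mulrBr (euler hF).
rewrite sumrB; congr (_ - _).
  by rewrite mulr_suml; apply: eq_bigr => k _; ring.
rewrite (bigD1 l) //= big1 => [|k ne_kl].
  by rewrite /unitv eqxx mulr1 addr0; ring.
by rewrite /unitv (negPf ne_kl) mulr0 mulr0.
Qed.

Lemma jac_vector_homog e (c : 'I_3 -> T) l : (forall k, c k \is e.-homog) ->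
  jac_vector c l \is (e + d.-1)%N.-homog.
Proof.
move=> hc; rewrite rpred_sum // => k _.
apply: dhomogM => //; elim/ord3_ind: l; rewrite /cross /unitv;
by rewrite rpredB // mulrC; case: eqP; rewrite ?mul1r ?mul0r ?dhomog0 ?mderiv_homog.
Qed.

(** Completeness of the relations. Write [G] as [E . c]; then [E] x ([v] - [jac_vector c]) is [F]
    times a vector orthogonal to [E], hence [F] times some [E] x [w]. What is left of [v] after
    subtracting [F w] is killed by [E] x and is a multiple of [E]. *)
Lemma jacobian_relation n (v : 'I_3 -> T) G (t : 'I_3 -> T) : (d <= n)%N ->
  (forall k, v k \is n.-1.-homog) -> G \is (n + 1 - d)%N.-homog ->
  (forall l, cross E v l = G * F^`M(l) + F * t l) ->
  exists (c r : 'I_3 -> T) s,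
    [/\ forall k, c k \is (n - d)%N.-homog,
        forall k m, (r k)@_m != 0 -> (mdeg m).+1 = (n - d)%N,
        forall m, s@_m != 0 -> (mdeg m).+1 = n.-1 &
        forall l, v l = 'X_l * s + F * r l + jac_vector c l].
Proof.
move=> le_dn hv hG Dv.
have [|c hc DG] := @irrelevant_homog R (n - d) G.
  by rewrite (_ : (n - d).+1 = n + 1 - d)%N //; lia.
have Dv' l : cross E (fun k => v k - jac_vector c k) l = F * (t l + c l *+ d).
  have -> : cross E (fun k => v k - jac_vector c k) l =
      cross E (fun k => v k + (-1) * jac_vector c k) l.
    by elim/ord3_ind: l; rewrite /cross /=; ring.
  by rewrite cross_lin cross_jac_vector Dv DG; ring.
have [|w Dw] := @dot_eq0 R (fun l => t l + c l *+ d).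
  apply: (mulfI F0); rewrite mulr0 mulr_sumr.
  rewrite -[RHS](dot_cross E (fun k => v k - jac_vector c k)).
  by apply: eq_bigr => l _; rewrite Dv' mulrCA.
have [|s Ds] := @cross_eq0 R (fun k => v k - jac_vector c k + (- F) * w k).
  by move=> l; rewrite cross_lin Dv' Dw; ring.
have hjac l : jac_vector c l \is n.-1.-homog.
  by have := jac_vector_homog l hc; rewrite (_ : n - d + d.-1 = n.-1)%N //; lia.
have /fin_all_exists[r Dr] k : exists r, pih n.-1 (F * w k) = F * r.
  exact: pihomog_mul_ex hF.
have [s' Ds'] : exists s', forall l, pih n.-1 ('X_l * s) = 'X_l * s'.
  (* In degree 0 a multiple of a variable has no component, so the quotient is 0. *)
  case: (n.-1) => [|e]; last by exists (pih e s) => l; rewrite pihomogXU.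
  by exists 0 => l; rewrite mulr0 (pihomogM_lt _ (dhomogXU _ l)).
have hXs l : 'X_l * s' \is n.-1.-homog by rewrite -Ds' pihomogP.
exists c, r, s'; split=> [//|k m rm|m sm|l].
- have := mdeg_dvd F0 hF _ rm; move/(_ n.-1); rewrite -Dr pihomogP.
  by move=> /(_ isT); lia.
- by rewrite -add1n; apply: (mdeg_dvd _ (dhomogXU _ iX) (hXs iX) sm); apply: (XUn_neq0 R iX 1).
rewrite -Ds' -Dr -{1}(subrK (jac_vector c l) (v l)); congr (_ + _).
have hvl : v l - jac_vector c l \is n.-1.-homog by rewrite rpredB ?hv ?hjac.
by rewrite -{1}(pihomog_dE hvl) -linearD /= -Ds; congr (pih _ _); ring.
Qed.

End Jacobian.

(** * Valuation rings *)

Definition valuation_domain (R : idomainType) : Prop :=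
  forall a b : R, exists c, a = c * b \/ b = c * a.

Lemma padic_valuation_domain (R : idomainType) :
  padic_integer_ring R -> valuation_domain R.
Proof.
move=> [p [Qp [v [i [K [w [j [_ [wM _] _ inj_j jR]]]]]]]] a b.
have [->|a0] := eqVneq a 0; first by exists 0; left; rewrite mul0r.
have [->|b0] := eqVneq b 0; first by exists 0; right; rewrite mul0r.
have ja0 : j a != 0 by apply: contra_neq a0 => j0; apply: inj_j; rewrite j0 rmorph0.
have jb0 : j b != 0 by apply: contra_neq b0 => j0; apply: inj_j; rewrite j0 rmorph0.
have wV : w (j b / j a) = - w (j a / j b).
  have w1 : w 1 = 0.
    have := wM 1 1 (oner_neq0 _) (oner_neq0 _).
    by rewrite mulr1 => /eqP; rewrite -subr_eq0 opprD addNKr oppr_eq0 => /eqP.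
  have := wM (j b / j a) (j a / j b); rewrite !mulf_neq0 ?invr_neq0 //.
  rewrite mulrA divfK // divff // w1 => /(_ isT isT)/esym/eqP.
  by rewrite addr_eq0 => /eqP.
case: (Order.TotalTheory.leP 0 (w (j a / j b))) => [w_ge0|w_lt0].
  have [|r Dr] := (jR (j a / j b)).1; first by rewrite /val_ge w_ge0 orbT.
  by exists r; left; apply: inj_j; rewrite rmorphM -Dr divfK.
have [|r Dr] := (jR (j b / j a)).1.
  by rewrite /val_ge wV Num.Theory.oppr_ge0 (Order.POrderTheory.ltW w_lt0) orbT.
by exists r; right; apply: inj_j; rewrite rmorphM -Dr divfK.
Qed.

Section ValuationDomain.
Variable R : idomainType.
Hypothesis valR : valuation_domain R.

(** A valuation ring is local: one summand divides the other, so the sum is a multiple of a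
    nonunit. *)
Lemma nonunitD (x y : R) :
  x \isn't a GRing.unit -> y \isn't a GRing.unit -> x + y \isn't a GRing.unit.
Proof.
move=> Nx Ny; have [c [->|->]] := valR x y.
- by rewrite -[X in _ + X]mul1r -mulrDl unitrM (negPf Ny) andbF.
- by rewrite -[X in X + _]mul1r -mulrDl unitrM (negPf Nx) andbF.
Qed.

Lemma nonunitMl (x y : R) : x \isn't a GRing.unit -> x * y \isn't a GRing.unit.
Proof. by rewrite unitrM => /negPf ->. Qed.

Lemma nonunitMr (x y : R) : y \isn't a GRing.unit -> x * y \isn't a GRing.unit.
Proof. by rewrite unitrM => /negPf ->; rewrite andbF. Qed.

(** The index [i] is that of an entry of least valuation. *)
Lemma dvd_all (I : eqType) (s : seq I) (f : I -> R) : s != [::] ->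
  exists2 i, i \in s & exists q : I -> R, forall k, k \in s -> f k = q k * f i.
Proof.
elim: s => // i s IH _; have [->|/IH[k k_s [q Dq]]] := eqVneq s [::].
  exists i; first by rewrite inE.
  by exists (fun=> 1) => k; rewrite inE => /eqP ->; rewrite mul1r.
have [c [Di|Dk]] := valR (f i) (f k).
- exists k; first by rewrite inE k_s orbT.
  exists (fun l => if l == i then c else q l) => l; rewrite inE.
  by case: eqP => [-> _|_ /Dq].
- exists i; first by rewrite inE eqxx.
  exists (fun l => if l == i then 1 else q l * c) => l; rewrite inE.
  case: eqP => [-> _|_ /Dq ->]; first by rewrite mul1r.
  by rewrite Dk mulrA.
Qed.

(** * Gauss's lemma over a valuation ring *)

Section Gauss.
Variable n : nat.
Implicit Types p q : {mpoly R[n]}.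

Definition primitive_mpoly p : Prop := exists m, p@_m \is a GRing.unit.

(** Gauss's lemma without the residue field: [up] erases the nonunit coefficients, so it lifts the
    reduction. The leading coefficient of [up p * up q] is a product of units, and the erased terms
    only add nonunits. *)
Lemma primitive_mpolyM p q :
  primitive_mpoly p -> primitive_mpoly q -> primitive_mpoly (p * q).
Proof.
pose up p : {mpoly R[n]} := \sum_(m <- msupp p | p@_m \is a GRing.unit) p@_m *: 'X_[m].
have up_coef r m : (up r)@_m = if r@_m \is a GRing.unit then r@_m else 0.
  rewrite raddf_sum /= (eq_bigr (fun m' => if m' == m then r@_m else 0)); last first.
    by move=> m' _; rewrite mcoeffZ mcoeffX; case: eqP => [->|_]; rewrite ?mulr1 ?mulr0.
  case: (boolP (m \in msupp r)) => [m_r|mNr].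
    rewrite big_mkcond (bigD1_seq m) ?msupp_uniq //= eqxx.
    rewrite big1 ?addr0 // => m' /negPf ->.
    by rewrite if_same.
  rewrite (memN_msupp_eq0 mNr) if_same; apply: big1 => m' _.
  by case: eqP.
have up_lead r : primitive_mpoly r -> mleadc (up r) \is a GRing.unit.
  move=> [m Um]; have : up r != 0.
    have := up_coef r m; rewrite Um => Dm; apply: contraTneq Um => r0.
    by rewrite -Dm r0 mcoeff0 unitr0.
  rewrite -mleadc_eq0 up_coef; case: ifP => //.
  by rewrite eqxx.
move=> /up_lead Up /up_lead Uq; exists (mlead (up p) + mlead (up q))%MM.
have -> : p * q = up p * up q + ((p - up p) * q + (q - up q) * up p) by ring.
have Ndiff r s m : ((r - up r) * s)@_m \isn't a GRing.unit.
  rewrite mcoeffM; elim/big_rec: _ => [|[k l] x _ Nx]; first by rewrite unitr0.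
  apply: nonunitD Nx; apply: nonunitMl; rewrite mcoeffB up_coef /=.
  by case: ifP => [_|/negbT]; rewrite ?subrr ?unitr0 ?subr0.
rewrite mcoeffD; set m := (_ + _)%MM; set y := (_ * q + _)@_m.
have Ny : y \isn't a GRing.unit by rewrite /y mcoeffD nonunitD.
apply: contraT => Nxy; have: (up p * up q)@_m \isn't a GRing.unit.
  by rewrite -[_@_m](addrK y) nonunitD // unitrN.
by rewrite mleadcM unitrM Up Uq.
Qed.

(** Dividing [t] by its coefficient of least valuation leaves a primitive [t']; at a unit
    coefficient of [p * t'] the equation shows that [c] divides that coefficient of [t]. *)
Lemma gauss_dvdZ p q t (c : R) : primitive_mpoly p ->
  c *: q = p * t -> exists t', t = c *: t'.
Proof.
move=> prim_p eq_cq.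
have [t0|t_n0] := eqVneq t 0; first by exists 0; rewrite scaler0.
have [|m m_t [f Df]] := @dvd_all _ (msupp t) (fun m => t@_m).
  by rewrite msupp_eq0.
pose t' : {mpoly R[n]} := \sum_(k <- msupp t) f k *: 'X_[k].
have Dt : t = t@_m *: t'.
  rewrite {1}[t]mpolyE scaler_sumr; apply: eq_big_seq => k k_t.
  by rewrite scalerA Df // mulrC.
have t'm : t'@_m = 1.
  apply: (@mulfI _ t@_m); first by rewrite -mcoeff_msupp.
  by rewrite mulr1 -mcoeffZ -Dt.
have [|m1 Um1] := primitive_mpolyM (q := t') prim_p.
  by exists m; rewrite t'm unitr1.
have := congr1 (mcoeff m1) eq_cq; rewrite {1}Dt -scalerAr !mcoeffZ => eq_m1.
exists ((q@_m1 / (p * t')@_m1) *: t').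
by rewrite scalerA mulrA eq_m1 mulrK.
Qed.

End Gauss.
End ValuationDomain.

(** * Dehomogenization *)

Section Dehomogenization.
Variable R : idomainType.
Local Notation T := {mpoly R[3]}.
Implicit Types (G H : T) (g h : {mpoly R[2]}).

HB.instance Definition _ := GRing.RMorphism.copy (@affine_eq R)
  (comp_mpoly [tuple 'X_ix; 'X_iy; 1]).
HB.instance Definition _ := GRing.Linear.copy (@affine_eq R)
  (comp_mpoly [tuple 'X_ix; 'X_iy; 1]).

Definition restrict_mnm (m : 'X_{1..3}) : 'X_{1..2} :=
  [multinom m (widen_ord (leqnSn 2) i) | i < 2].


Lemma affine_eqX m : affine_eq 'X_[m] = 'X_[restrict_mnm m] :> {mpoly R[2]}.
Proof.
rewrite /affine_eq comp_mpolyX [RHS]mpolyXE_id !big_ord_recl !big_ord0 /=.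
rewrite !mnmE !(tnth_nth 0) /= expr1n mulr1.
by congr ('X_[U_(_)] ^+ m _ * ('X_[U_(_)] ^+ m _ * _)); apply: val_inj.
Qed.

Lemma affine_eqE G :
  affine_eq G = \sum_(m <- msupp G) G@_m *: 'X_[restrict_mnm m].
Proof.
rewrite {1}[G]mpolyE (@linear_sum _ _ _ _ (@affine_eq R)).
by apply: eq_bigr => m _; rewrite linearZ /= affine_eqX.
Qed.

Lemma affine_eqXU i : affine_eq ('X_i : T) =
  tnth [tuple 'X_ix; 'X_iy; 1] i.
Proof. by rewrite /affine_eq comp_mpolyXU -tnth_nth. Qed.

(** In a fixed degree the exponent of Z is determined by the other two, so distinct monomials stay
    distinct. *)
Lemma affine_eq_inj d G : G \is d.-homog -> affine_eq G = 0 -> G = 0.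
Proof.
move=> hG G0; apply/mpolyP => m; rewrite mcoeff0.
have [mNG|m_G] := boolP (m \notin msupp G); first exact: memN_msupp_eq0.
move/negbNE in m_G; rewrite -(mcoeff0 R (restrict_mnm m)) -G0.
rewrite affine_eqE raddf_sum (bigD1_seq m) ?msupp_uniq //=.
rewrite mcoeffZ mcoeffX eqxx mulr1.
rewrite big_seq_cond big1 ?addr0 // => m' /andP[m'_G ne_m].
rewrite mcoeffZ mcoeffX.
case: eqP => [eq_m|]; last by rewrite mulr0.
case/eqP: ne_m; apply/mnmP.
have e i := congr1 (fun m : 'X_{1..2} => m i) eq_m.
have /= e0 := e ix; have /= e1 := e iy; rewrite !mnmE in e0 e1.
have eX : m' iX = m iX.
  by rewrite (_ : iX = widen_ord (leqnSn 2) ix) ?e0 //; apply: val_inj.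
have eY : m' iY = m iY.
  by rewrite (_ : iY = widen_ord (leqnSn 2) iy) ?e1 //; apply: val_inj.
elim/ord3_ind => //.
have := dhomog_mf hG m_G; have := dhomog_mf hG m'_G; rewrite /= !mdegE !sum3E.
by lia.
Qed.

(** If [e] is below the degree of [g], the truncated exponent spoils homogeneity, but setting Z = 1
    still returns [g]. *)
Definition homogenize e g : T :=
  \sum_(m <- msupp g) g@_m *:
    ('X_iX ^+ m ix * 'X_iY ^+ m iy * 'X_iZ ^+ (e - (m ix + m iy))).

Lemma homogenizeK e g : affine_eq (homogenize e g) = g.
Proof.
rewrite (@linear_sum _ _ _ _ (@affine_eq R)) [RHS]mpolyE; apply: eq_bigr => m _; rewrite linearZ /=.
rewrite !rmorphM !rmorphXn /= !affine_eqXU /= !(tnth_nth 0) /= expr1n mulr1.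
congr (_ *: _); rewrite [RHS]mpolyXE_id !big_ord_recl big_ord0 mulr1.
by congr ('X_[U_(_)] ^+ m _ * 'X_[U_(_)] ^+ m _); apply: val_inj.
Qed.

Lemma homogenize_homog e g : (msize g <= e.+1)%N -> homogenize e g \is e.-homog.
Proof.
move=> le_ge; rewrite /homogenize big_seq rpred_sum // => m /msize_mdeg_lt lt_mg.
have : (m ix + m iy <= e)%N.
  apply: leq_trans (_ : mdeg m <= e)%N; last by move: lt_mg; lia.
  rewrite mdegE !big_ord_recl big_ord0 addn0.
  by apply/eq_leq; congr (m _ + m _)%N; apply: val_inj.
move=> le_me; rewrite rpredZ //.
have := dhomogM (dhomogM (dhomogXUn R iX (m ix)) (dhomogXUn R iY (m iy)))
  (dhomogXUn R iZ (e - (m ix + m iy))).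
by rewrite subnKC.
Qed.

Lemma mderiv_affine_eq G (i : 'I_2) :
  (affine_eq G)^`M(i) = affine_eq (G^`M(widen_ord (leqnSn 2) i)).
Proof.
rewrite affine_eqE linear_sum [in RHS](mpolyE G) (@linear_sum _ _ _ _ (mderiv (widen_ord _ i))) /=.
rewrite (@linear_sum _ _ _ _ (@affine_eq R)) /=; apply: eq_bigr => m _.
rewrite !mderivZ !mderivX !linearZ /= affine_eqX mnmE.
rewrite !scalerA [X in X *: _]mulrC; congr (_ *: 'X_[_]); apply/mnmP => j.
by rewrite !(mnmE, mnmBE, mnm1E) -!(inj_eq val_inj).
Qed.

End Dehomogenization.

(** * The coordinate ring of the affine part *)

Section Span.
Variables (R : idomainType) (V : lmodType R) (gen : V -> Prop).

Lemma Rspan_ind (P : V -> Prop) :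
  P 0 -> (forall c u v, gen u -> P v -> P (c *: u + v)) ->
  forall v, Rspan gen v -> P v.
Proof.
move=> P0 PD v [s gen_s ->]; elim: s gen_s => [|t s IH] gen_s; first by rewrite big_nil.
rewrite big_cons; apply: PD; first by apply: gen_s; rewrite inE eqxx.
by apply: IH => u u_s; apply: gen_s; rewrite inE u_s orbT.
Qed.

Lemma Rspan0 : Rspan gen 0.
Proof. by exists [::] => //; rewrite big_nil. Qed.

Lemma Rspan_gen v : gen v -> Rspan gen v.
Proof.
move=> gen_v; exists [:: (1, v)]; last by rewrite big_seq1 scale1r.
by move=> t; rewrite inE => /eqP ->.
Qed.

Lemma RspanD u v : Rspan gen u -> Rspan gen v -> Rspan gen (u + v).
Proof.
move=> [s gen_s ->] [s' gen_s' ->]; exists (s ++ s'); last by rewrite big_cat.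
by move=> t; rewrite mem_cat => /orP[/gen_s|/gen_s'].
Qed.

Lemma RspanZ c v : Rspan gen v -> Rspan gen (c *: v).
Proof.
move=> [s gen_s ->]; exists [seq (c * t.1, t.2) | t <- s].
  by move=> t /mapP[t' /gen_s gen_t' ->].
by rewrite big_map scaler_sumr; apply: eq_bigr => t _; rewrite scalerA.
Qed.

Lemma Rspan_sum (I : eqType) (s : seq I) (f : I -> V) :
  (forall i, i \in s -> Rspan gen (f i)) -> Rspan gen (\sum_(i <- s) f i).
Proof.
move=> f_s; rewrite big_seq; elim/big_rec: _ => [|i x /f_s]; first exact: Rspan0.
exact: RspanD.
Qed.

End Span.

Section AffinePart.
Variables (R : idomainType) (d : nat) (F : {mpoly R[3]}) (A : comAlgType R).
Variable pi : {lrmorphism {mpoly R[2]} -> A}.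
Local Notation T := {mpoly R[3]}.
Local Notation E := (fun k : 'I_3 => 'X_k : T).
Local Notation pih := (pihomog mdeg).
Implicit Types (G : T) (v : 'I_3 -> T).

Definition to_affine G : A := pi (affine_eq G).
Local Notation psi := to_affine.

HB.instance Definition _ := GRing.RMorphism.copy psi (pi \o @affine_eq R).
HB.instance Definition _ := GRing.Linear.copy psi (pi \o @affine_eq R).

Lemma to_affineZ : psi 'X_iZ = 1.
Proof. by rewrite /psi affine_eqXU /= (tnth_nth 0) rmorph1. Qed.

Lemma to_affine_mon i j k : psi ('X_iX ^+ i * 'X_iY ^+ j * 'X_iZ ^+ k) = monA pi i j.
Proof.
rewrite rmorphM rmorphXn /= to_affineZ expr1n mulr1.
by rewrite /psi /monA !rmorphM !rmorphXn /= !affine_eqXU !(tnth_nth 0).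
Qed.

Definition form_of v : A * A := (psi (cross E v iX), psi (cross E v iY)).

Lemma form_ofD c u v : form_of (fun k => c *: u k + v k) = c *: form_of u + form_of v.
Proof.
have lin l : cross E (fun k => c *: u k + v k) l = c *: cross E u l + cross E v l.
  by elim/ord3_ind: l; rewrite /cross /= -!mul_mpolyC; ring.
by rewrite /form_of !lin !linearP.
Qed.

Lemma form_of_eq u v : u =1 v -> form_of u = form_of v.
Proof. by move=> eq_uv; rewrite /form_of /cross /= !eq_uv. Qed.

Lemma form_of_sum (I : Type) (s : seq I) (c : I -> R) (f : I -> 'I_3 -> T) :
  form_of (fun k => \sum_(i <- s) c i *: f i k) = \sum_(i <- s) c i *: form_of (f i).
Proof.
elim: s => [|i s IH].
  rewrite big_nil (form_of_eq (v := fun=> 0)) => [|k]; last by rewrite big_nil.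
  by rewrite /form_of /cross /= !mulr0 subr0 !rmorph0.
rewrite big_cons -IH -form_ofD; apply: form_of_eq => k.
by rewrite big_cons.
Qed.

Lemma M1P n a :
  (M1 pi d n a) <-> exists2 G, G \is (n + 1 - d)%N.-homog & a = psi G.
Proof.
split=> [|[G hG ->]].
  move: a; apply: Rspan_ind => [|c u v [i [j [le_ij ->]]] [G hG ->]].
    by exists 0; rewrite ?dhomog0 ?rmorph0.
  exists (c *: ('X_iX ^+ i * 'X_iY ^+ j * 'X_iZ ^+ (n + 1 - d - (i + j))) + G).
    rewrite rpredD // rpredZ //.
    have := dhomogM (dhomogM (dhomogXUn R iX i) (dhomogXUn R iY j))
      (dhomogXUn R iZ (n + 1 - d - (i + j))).
    by rewrite subnKC.
  by rewrite linearD linearZ /= to_affine_mon.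
rewrite [G]mpolyE (@linear_sum _ _ _ _ psi); apply: Rspan_sum => m m_G.
rewrite linearZ /=; apply/RspanZ/Rspan_gen; exists (m iX), (m iY).
rewrite mpolyX3E to_affine_mon; split=> //.
have := dhomog_mf hG m_G; rewrite /= mdeg3E; lia.
Qed.

(** The basis vectors correspond to dy, -dx and y dx - x dy, the three kinds of generators of
    M_2. *)
Lemma form_of_unitv p k : form_of (fun l => p * unitv T k l) =
  match val k with
  | 0 => (0, psi p)
  | 1 => (- psi p, 0)
  | _ => (psi ('X_iY * p), - psi ('X_iX * p))
  end.
Proof.
have Z1 := to_affineZ; elim/ord3_ind: k; rewrite /form_of /cross /unitv /=.
all: rewrite ?mulr1 ?mulr0 ?subr0 ?sub0r ?rmorph0 ?rmorphN ?rmorph0 //.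
all: by rewrite /= rmorphM /= Z1 mul1r.
Qed.

Lemma form_of_split v :
  form_of v = \sum_k form_of (fun l => v k * unitv T k l).
Proof.
rewrite sum3E /form_of /cross /unitv /=; congr (_, _); rewrite /= -!rmorphD;
by congr psi; ring.
Qed.

Lemma M2P n u : (0 < n)%N ->
  M2 pi n u <-> exists2 v, forall k, v k \is n.-1.-homog & u = form_of v.
Proof.
move=> n_gt0.
split=> [|[v hv ->]].
  move: u; apply: Rspan_ind => [|c x y gen_x [v hv ->]].
    exists (fun=> 0) => [k|]; first exact: dhomog0.
    by rewrite /form_of /cross /= !mulr0 subr0 !rmorph0.
  suff [w hw ->] : exists2 w, forall k, w k \is n.-1.-homog & x = form_of w.
    exists (fun k => c *: w k + v k) => [k|]; last by rewrite form_ofD.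
    by rewrite rpredD ?rpredZ.
  have mon_hom i j k : (i + j + k = n.-1)%N ->
      ('X_iX ^+ i * 'X_iY ^+ j * 'X_iZ ^+ k : T) \is n.-1.-homog.
    by move=> <-; apply: dhomogM (dhomogM _ _) _; apply: dhomogXUn.
  have unit_hom (p : T) k l : p \is n.-1.-homog -> p * unitv T k l \is n.-1.-homog.
    by move=> hp; rewrite /unitv; case: eqP; rewrite ?mulr1 ?mulr0 ?dhomog0.
  case: gen_x => i [j [[le_ij ->]|[le_ij ->]|[eq_ij ->]]].
  - exists (fun l => - ('X_iX ^+ i * 'X_iY ^+ j * 'X_iZ ^+ (n - 1 - (i + j)))
      * unitv T iY l) => [l|].
      by apply: unit_hom; rewrite dhomogN mon_hom //; lia.
    by rewrite form_of_unitv /= rmorphN opprK /= to_affine_mon.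
  - exists (fun l => 'X_iX ^+ i * 'X_iY ^+ j * 'X_iZ ^+ (n - 1 - (i + j))
      * unitv T iX l) => [l|].
      by apply: unit_hom; rewrite mon_hom //; lia.
    by rewrite form_of_unitv /= to_affine_mon.
  - exists (fun l => 'X_iX ^+ i * 'X_iY ^+ j * 'X_iZ ^+ 0 * unitv T iZ l) => [l|].
      by apply: unit_hom; rewrite mon_hom //; lia.
    rewrite form_of_unitv /= -!(to_affine_mon _ _ 0) !exprS.
    by congr (psi _, - psi _); ring.
rewrite form_of_split; apply: Rspan_sum => k _.
have -> : form_of (fun l => v k * unitv T k l) =
    \sum_(m <- msupp (v k)) (v k)@_m *: form_of (fun l => 'X_[m] * unitv T k l).
  rewrite -form_of_sum; apply: form_of_eq => l.
  by rewrite {1}[v k]mpolyE mulr_suml; apply: eq_bigr => m _; rewrite scalerAl.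
apply: Rspan_sum => m m_v; apply: RspanZ; rewrite form_of_unitv.
have := dhomog_mf (hv k) m_v; rewrite /= mdeg3E => Dn.
elim/ord3_ind: k m_v => m_v /=; rewrite (mpolyX3E R m) ?to_affine_mon.
- apply: Rspan_gen; exists (m iX), (m iY); apply: Or32; split=> //; lia.
- have -> : (- monA pi (m iX) (m iY), 0) = (-1) *: (monA pi (m iX) (m iY), 0 : A).
    by apply: (congr2 pair); rewrite /= ?scaleN1r ?oppr0.
  apply: RspanZ; apply: Rspan_gen.
  exists (m iX), (m iY); apply: Or31; split=> //; lia.
have -> : 'X_iY * ('X_iX ^+ m iX * 'X_iY ^+ m iY * 'X_iZ ^+ m iZ) =
  'X_iX ^+ m iX * 'X_iY ^+ (m iY).+1 * 'X_iZ ^+ m iZ :> T by rewrite exprS; ring.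
have -> : 'X_iX * ('X_iX ^+ m iX * 'X_iY ^+ m iY * 'X_iZ ^+ m iZ) =
  'X_iX ^+ (m iX).+1 * 'X_iY ^+ m iY * 'X_iZ ^+ m iZ :> T by rewrite exprS; ring.
(* If Z occurs in the monomial, then i + j is at most n - 2, so both halves of the form lie among
   the generators in dx and in dy. *)
rewrite !to_affine_mon; case: (posnP (m iZ)) => [mZ0|mZ].
  apply: Rspan_gen; exists (m iX), (m iY); apply: Or33; split=> //; lia.
have -> : (monA pi (m iX) (m iY).+1, - monA pi (m iX).+1 (m iY)) =
    (monA pi (m iX) (m iY).+1, 0) + (-1) *: (0, monA pi (m iX).+1 (m iY)).
  by apply: (congr2 pair); rewrite /= scaleN1r ?oppr0 ?addr0 ?add0r.
apply: RspanD; [apply: Rspan_gen | apply/RspanZ/Rspan_gen].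
- by exists (m iX), (m iY).+1; apply: Or31; split=> //; lia.
- by exists (m iX).+1, (m iY); apply: Or32; split=> //; lia.
Qed.

End AffinePart.

(** * Multiplication by df in terms of forms in X, Y, Z *)

Section Rows.
Variables (R : idomainType) (d : nat) (F : {mpoly R[3]}) (A : comAlgType R).
Variable pi : {lrmorphism {mpoly R[2]} -> A}.
Local Notation T := {mpoly R[3]}.
Local Notation E := (fun k : 'I_3 => 'X_k : T).
Local Notation pih := (pihomog mdeg).
Local Notation psi := (to_affine pi).
Implicit Types (G : T) (v w : 'I_3 -> T).

Hypotheses (d_gt0 : (0 < d)%N) (hF : F \is d.-homog).
Hypothesis NdvdF : ~ exists a, F = 'X_iZ * a.
Hypothesis coordA : is_coordinate_ring F pi.

Lemma not_Zdvd_neq0 : F != 0.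
Proof. by apply/eqP => F0; apply: NdvdF; exists 0; rewrite mulr0. Qed.
Let F0 := not_Zdvd_neq0.

Lemma to_affineF : psi F = 0.
Proof. by apply/coordA.2; exists 1; rewrite mul1r. Qed.

(** Homogenising the cofactor shows that [F] divides [G] times a power of Z; that power cancels
    because Z is prime and does not divide [F]. *)
Lemma to_affine_ker e G : G \is e.-homog -> psi G = 0 -> exists t, G = F * t.
Proof.
move=> hG /coordA.2[h Dh]; pose K := (e + msize h)%N.
have hH : homogenize K h \is K.-homog by apply: homogenize_homog; rewrite /K; lia.
have DH : F * homogenize K h = 'X_iZ ^+ (d + K - e) * G.
  apply/eqP; rewrite -subr_eq0; apply/eqP; apply: (affine_eq_inj (d := d + K)).
    have le_e : (e <= d + K)%N by rewrite /K; lia.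
    have := dhomogM (dhomogXUn R iZ (d + K - e)) hG.
    by rewrite subnK // => hZG; rewrite rpredB ?(dhomogM hF hH).
  rewrite rmorphB !rmorphM /= homogenizeK rmorphXn /= affine_eqXU (tnth_nth 0) /=.
  by rewrite expr1n mul1r Dh mulrC subrr.
have [//|t Dt] := prime_XUn _ DH.
by exists t; apply: (mulfI (XUn_neq0 R iZ (d + K - e))); rewrite -DH Dt mulrCA.
Qed.

Lemma to_affine_surj a :
  exists K0, forall K, (K0 <= K)%N -> exists2 G, G \is K.-homog & a = psi G.
Proof.
have [g ->] := coordA.1 a; exists (msize g) => K le_gK.
exists (homogenize K g); last by rewrite /to_affine homogenizeK.
by apply: homogenize_homog; apply: leqW.
Qed.

Lemma mul_dfE a : mul_df F pi a = (a * psi F^`M(iX), a * psi F^`M(iY)).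
Proof.
rewrite /mul_df !mderiv_affine_eq.
by congr (_ * pi (affine_eq F^`M(_)), _ * pi (affine_eq F^`M(_))); apply: val_inj.
Qed.

(* The third component of a vector orthogonal to E is determined by the first
   two on the chart Z = 1. *)
Lemma dvd_of_to_affine e w : (forall l, w l \is e.-homog) ->
  psi (\sum_l 'X_l * w l) = 0 -> psi (w iX) = 0 -> psi (w iY) = 0 ->
  exists t, forall l, w l = F * t l.
Proof.
move=> hw; rewrite sum3E !rmorphD !rmorphM /= to_affineZ mul1r => w0 wX wY.
rewrite wX wY !mulr0 !add0r in w0.
suff /fin_all_exists : forall l, exists t, w l = F * t by [].
by elim/ord3_ind; apply: to_affine_ker.
Qed.

(** An equality of two components in A lifts to three components modulo [F]: the third follows from
    orthogonality to [E], which by Euler's identity holds modulo [F]. The factor ['X_iZ ^+ e]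
    matches the degrees when [a] is only known as the image of a form of large degree. *)
Lemma form_of_mul_df e n v a G : (forall k, v k \is n.-1.-homog) -> (0 < n)%N ->
  G \is (e + (n + 1 - d))%N.-homog -> (d <= n)%N ->
  a = psi G -> form_of pi v = mul_df F pi a ->
  exists t, forall l, 'X_iZ ^+ e * cross E v l = G * F^`M(l) + F * t l.
Proof.
move=> hv n_gt0 hG le_dn Da; rewrite mul_dfE => eq_v.
have vX : psi (cross E v iX) = a * psi F^`M(iX) := congr1 fst eq_v.
have vY : psi (cross E v iY) = a * psi F^`M(iY) := congr1 snd eq_v.
have [|||| t Dt] := @dvd_of_to_affine (e + n)
    (fun l => 'X_iZ ^+ e * cross E v l - G * F^`M(l)).
- move=> l; rewrite rpredB //.
    apply: dhomogM; first exact: dhomogXUn.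
    by have := dhomog_cross l hv; rewrite prednK.
  have -> : (e + n = e + (n + 1 - d) + d.-1)%N by lia.
  by rewrite dhomogM ?mderiv_homog.
- have -> : \sum_l 'X_l * ('X_iZ ^+ e * cross E v l - G * F^`M(l)) =
      'X_iZ ^+ e * (\sum_l 'X_l * cross E v l) - G * \sum_l 'X_l * F^`M(l).
    by rewrite !sum3E; ring.
  rewrite dot_cross mulr0 sub0r (euler hF) rmorphN rmorphM raddfMn /=.
  by rewrite to_affineF mul0rn mulr0 oppr0.
- rewrite rmorphB !rmorphM rmorphXn /= to_affineZ expr1n mul1r vX -Da.
  by rewrite subrr.
- rewrite rmorphB !rmorphM rmorphXn /= to_affineZ expr1n mul1r vY -Da.
  by rewrite subrr.
by exists t => l; rewrite -Dt addrC subrK.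
Qed.

Lemma M2_mul_df n v a : jacobian_irrelevant F -> (d <= n)%N ->
  (forall k, v k \is n.-1.-homog) -> form_of pi v = mul_df F pi a -> M1 pi d n a.
Proof.
move=> irrF le_dn hv eq_v; have [K0 /(_ (K0 + (n + 1 - d))%N)] := to_affine_surj a.
case=> [|G hG Da]; first exact: leq_addr.
have [|t Dt] := form_of_mul_df hv _ hG le_dn Da eq_v; first by lia.
have [|b1 [b2 DG]] := jacobian_dvd2 (e := K0) (G := G) irrF NdvdF.
  move=> k; exists (- t k), (cross E v k).
  by rewrite Dt; ring.
(* In the degree of [G], the cofactor of ['X_iZ ^+ K0] has degree [n + 1 - d]; in A the term in [F]
   vanishes and Z becomes 1. *)
apply/M1P; exists (pih (n + 1 - d)%N b2); first exact: pihomogP.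
have [q Dq] := pihomog_mul_ex (K0 + (n + 1 - d))%N b1 hF.
rewrite Da -(pihomog_dE hG) DG linearD /= Dq pihomogM ?dhomogXUn //.
rewrite rmorphD !rmorphM rmorphXn /= to_affineF to_affineZ.
by rewrite mul0r add0r expr1n mul1r.
Qed.

Lemma form_of_jac_vector (c : 'I_3 -> T) :
  form_of pi (jac_vector F c) = mul_df F pi (psi (\sum_k 'X_k * c k)).
Proof.
rewrite /form_of !(cross_jac_vector hF) mul_dfE.
by rewrite !rmorphB !rmorphM /= to_affineF !mul0r !subr0.
Qed.

Lemma mul_df_M2 n a : (d <= n)%N -> M1 pi d n a -> M2 pi n (mul_df F pi a).
Proof.
move=> le_dn /M1P[G hG ->]; apply/M2P; first by lia.
have [|c hc DG] := @irrelevant_homog R (n - d) G.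
  by rewrite (_ : (n - d).+1 = n + 1 - d)%N //; lia.
exists (jac_vector F c) => [k|]; last by rewrite form_of_jac_vector DG.
by have := jac_vector_homog hF k hc; rewrite (_ : n - d + d.-1 = n.-1)%N //; lia.
Qed.

Lemma form_ofXs s : form_of pi (fun k => 'X_k * s) = 0.
Proof.
have c0 l : cross E (fun k => 'X_k * s) l = 0.
  by elim/ord3_ind: l; rewrite /cross /=; ring.
by rewrite /form_of !c0 rmorph0.
Qed.

Lemma form_ofFr r : form_of pi (fun k => F * r k) = 0.
Proof.
have cF l : cross E (fun k => F * r k) l = F * cross E r l.
  by elim/ord3_ind: l; rewrite /cross /=; ring.
by rewrite /form_of !cF !rmorphM /= to_affineF !mul0r.
Qed.

Lemma form_of_relation n v : (d <= n)%N -> (forall k, v k \is n.-1.-homog) ->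
  (exists2 a, M1 pi d n a & form_of pi v = mul_df F pi a) ->
  exists (c r : 'I_3 -> T) s,
    [/\ forall k, c k \is (n - d)%N.-homog,
        forall k m, (r k)@_m != 0 -> (mdeg m).+1 = (n - d)%N,
        forall m, s@_m != 0 -> (mdeg m).+1 = n.-1 &
        forall l, v l = 'X_l * s + F * r l + jac_vector F c l].
Proof.
move=> le_dn hv [a /M1P[G hG Da] eq_v].
have [|t Dt] := @form_of_mul_df 0 n v a G hv _ hG le_dn Da eq_v; first by lia.
apply: (jacobian_relation d_gt0 F0 hF le_dn hv hG (t := t)) => l.
by rewrite -Dt expr0 mul1r.
Qed.

Section Smooth.
Hypothesis smoothA : exists a b : A, a * psi F^`M(iX) + b * psi F^`M(iY) = 1.

(** A Bezout relation between f_x and f_y in A recovers [a] from [a df]. *)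
Lemma mul_df_inj : injective (mul_df F pi).
Proof.
have [x [y xy1]] := smoothA; move=> a b; rewrite !mul_dfE => eq_ab.
have abX : a * psi F^`M(iX) = b * psi F^`M(iX) := congr1 fst eq_ab.
have abY : a * psi F^`M(iY) = b * psi F^`M(iY) := congr1 snd eq_ab.
by rewrite -[a]mulr1 -[b]mulr1 -xy1 !mulrDr !(mulrCA a) !(mulrCA b) abX abY.
Qed.

(** If [c *: G = F * t], then [c] divides [t] by Gauss's lemma, and cancelling it leaves [G]
    divisible by [F]. *)
Lemma to_affine_torsion_free (c : R) (a : A) : valuation_domain R -> primitive_mpoly F ->
  c != 0 -> c *: a = 0 -> a = 0.
Proof.
move=> valR primF c0; have [K0 /(_ K0 (leqnn _))[G hG ->]] := to_affine_surj a.
move=> cG0; have [||t eq_cG] := @to_affine_ker K0 (c *: G).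
- exact: rpredZ.
- by rewrite linearZ.
have [t' Dt] := gauss_dvdZ valR primF eq_cG.
suff -> : G = F * t' by rewrite rmorphM /= to_affineF mul0r.
apply: (mulfI (_ : c%:MP_[3] != 0)); first by rewrite mpolyC_eq0.
by rewrite !mul_mpolyC eq_cG Dt scalerAr.
Qed.

(** Torsion freeness of the differentials of A: the Bezout relation shows that [a] is divisible by
    [c], which cancels since A is torsion free. *)
Lemma mul_df_saturated (c : R) (u : A * A) (a : A) : valuation_domain R -> primitive_mpoly F ->
  c != 0 -> c *: u = mul_df F pi a -> exists a', u = mul_df F pi a'.
Proof.
move=> valR primF c0; case: u => u1 u2; rewrite mul_dfE => eq_u.
have uX : c *: u1 = a * psi F^`M(iX) := congr1 fst eq_u.
have uY : c *: u2 = a * psi F^`M(iY) := congr1 snd eq_u.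
have [x [y xy1]] := smoothA; exists (x * u1 + y * u2).
have Da : a = c *: (x * u1 + y * u2).
  by rewrite scalerDr !scalerAr uX uY -[a in LHS]mulr1 -xy1; ring.
have free (b : A) : c *: b = 0 -> b = 0 by apply: to_affine_torsion_free.
rewrite mul_dfE; apply: (congr2 pair); apply/eqP; rewrite -subr_eq0;
  apply/eqP/free.
- by rewrite scalerBr uX scalerAl -Da subrr.
- by rewrite scalerBr uY scalerAl -Da subrr.
Qed.

End Smooth.
End Rows.

(** * Charts of the projective plane *)

(** Denominators can be cleared by every sufficiently high power, so finitely many lifts can share
    one exponent. *)
Definition eventually (P : nat -> Prop) : Prop :=
  exists N0, forall N, (N0 <= N)%N -> P N.

Lemma eventually_all (I : finType) (P : I -> nat -> Prop) :
  (forall i, eventually (P i)) -> eventually (fun N => forall i, P i N).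
Proof.
move=> /fin_all_exists[N0 P_N0]; exists (\max_i N0 i)%N => N le_N i.
by apply: P_N0; apply: leq_trans le_N; apply: leq_bigmax.
Qed.

Lemma frac_pow (K : fieldType) (g x y : K) m n : x != 0 -> y != 0 ->
  g / (y / x) ^+ n * (x * y) ^+ (m + n) = g * x ^+ (m + n + n) * y ^+ m.
Proof.
move=> x0 y0; rewrite expr_div_n !exprMn !exprD invf_div.
field; by rewrite expf_neq0.
Qed.

Lemma frac_Omega (K : fieldType) (x y c s u : K) m : x != 0 ->
  x ^- 2 * (x * c - s * u) * (x * y) ^+ (m + 2) =
  y ^+ 2 * (x * (c * (x * y) ^+ m) - s * (x * y) ^+ m * u).
Proof. by move=> x0; rewrite exprD; field. Qed.

Section Charts.
Variable R : idomainType.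
Local Notation T := {mpoly R[3]}.
Local Notation E := (fun k : 'I_3 => 'X_k : T).
Local Notation Fun := {fraction {mpoly R[2]}}.
Local Notation Form := 'rV[Fun]_2.
Local Notation h := (@hcoord R).
Implicit Types (i j k l : 'I_3) (G H : T) (e u w : Form) (a : Fun).

Definition to_fun G : Fun := tofrac (affine_eq G).

HB.instance Definition _ := GRing.RMorphism.copy to_fun (@tofrac _ \o @affine_eq R).
HB.instance Definition _ i := GRing.RMorphism.copy (@at_chart R i)
  (mmap (@tofrac _ \o @mpolyC 2 R) (@Defs.coord R i)).

Lemma to_funX k : to_fun 'X_k = h k.
Proof.
rewrite /to_fun affine_eqXU /hcoord.
by elim/ord3_ind: k; rewrite !(tnth_nth 0) //= tofrac1.
Qed.

Lemma hcoord_neq0 k : h k != 0.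
Proof.
elim/ord3_ind: k; rewrite /hcoord (tnth_nth 0) /= ?oner_neq0 //.
all: by rewrite tofrac_eq0 -msupp_eq0 msuppX.
Qed.

Lemma hcoordZ : h iZ = 1.
Proof. by rewrite /hcoord (tnth_nth 0). Qed.

Lemma to_fun_inj n G : G \is n.-homog -> to_fun G = 0 -> G = 0.
Proof. by move=> hG /eqP; rewrite tofrac_eq0 => /eqP /(affine_eq_inj hG). Qed.

Lemma to_funZ (c : R) G : to_fun (c *: G) = tofrac c%:MP * to_fun G.
Proof. by rewrite /to_fun linearZ /= -mul_mpolyC tofracM. Qed.

Lemma at_chartC i (c : R) : at_chart i c%:MP = tofrac c%:MP.
Proof. exact: (@mmapC 3 R Fun (@Defs.coord R i) (@tofrac _ \o @mpolyC 2 R)). Qed.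

Lemma at_chartZ i (c : R) G : at_chart i (c *: G) = tofrac c%:MP * at_chart i G.
Proof. by rewrite -mul_mpolyC rmorphM /= at_chartC. Qed.

Lemma at_chartXU i k : at_chart i ('X_k : T) = h k / h i.
Proof.
rewrite -[RHS](mmap1U (@Defs.coord R i)).
exact: (@mmapX 3 R Fun (@Defs.coord R i) (@tofrac _ \o @mpolyC 2 R)).
Qed.

Lemma at_chartX i m : at_chart i 'X_[m] * h i ^+ mdeg m = to_fun 'X_[m].
Proof.
rewrite mpolyXE_id !rmorph_prod mdegE -prodrXr -big_split; apply: eq_bigr => k _ /=.
by rewrite !rmorphXn /= at_chartXU to_funX -exprMn divfK ?hcoord_neq0.
Qed.

Lemma at_chart_homog i n G : G \is n.-homog ->
  at_chart i G * h i ^+ n = to_fun G.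
Proof.
move=> hG; rewrite [G]mpolyE !rmorph_sum mulr_suml /=.
rewrite big_seq [RHS]big_seq; apply: eq_bigr => m /(dhomog_mf hG) /= <-.
by rewrite at_chartZ to_funZ -mulrA at_chartX.
Qed.

Lemma at_chart_lift i G : eventually (fun N =>
  exists2 H, H \is N.-homog & at_chart i G * h i ^+ N = to_fun H).
Proof.
exists (msize G) => N le_GN.
have le_mN m : m \in msupp G -> (mdeg m <= N)%N.
  by move=> /msize_mdeg_lt lt_mG; apply: leq_trans (ltnW lt_mG) le_GN.
exists (\sum_(m <- msupp G) G@_m *: ('X_[m] * 'X_i ^+ (N - mdeg m))).
  rewrite big_seq rpred_sum // => m /le_mN le_m; rewrite rpredZ //.
  by rewrite -{2}(subnKC le_m) dhomogM ?dhomogX ?dhomogXUn.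
rewrite {1}[G]mpolyE !rmorph_sum mulr_suml /=.
rewrite big_seq [RHS]big_seq; apply: eq_bigr => m /le_mN le_m.
rewrite at_chartZ to_funZ rmorphM rmorphXn /= to_funX -(at_chartX i m) -!mulrA.
by rewrite -exprD subnKC.
Qed.

Lemma regular_lift i j a : regular i j a -> eventually (fun N =>
  exists2 H, H \is (2 * N)%N.-homog & a * (h i * h j) ^+ N = to_fun H).
Proof.
move=> [G [n ->]]; have [N0 GN] := at_chart_lift i G.
exists (N0 + n)%N => N le_N; have [m Dm] : exists m, N = (m + n)%N.
  by exists (N - n)%N; lia.
rewrite {}Dm in le_N *; have [|H hH DH] := GN (m + n + n)%N; first by lia.
exists (H * 'X_j ^+ m).
  rewrite (_ : 2 * (m + n) = m + n + n + m)%N; last by lia.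
  exact: dhomogM hH (dhomogXUn R j m).
rewrite rmorphM rmorphXn /= to_funX -DH /Defs.coord.
exact: frac_pow (hcoord_neq0 _) (hcoord_neq0 _).
Qed.

(* The third coordinate extends a form P dx + Q dy to the vector (P, Q, S) that
   is orthogonal to (x, y, 1). *)
Definition extend e l : Fun :=
  match val l with
  | 0 => e ord0 ix
  | 1 => e ord0 iy
  | _ => - (h iX * e ord0 ix + h iY * e ord0 iy)
  end.

Lemma extendD a u w l : extend (a *: u + w) l = a * extend u l + extend w l.
Proof. by elim/ord3_ind: l; rewrite /extend /= !mxE //; ring. Qed.

Lemma extend0 l : extend 0 l = 0.
Proof. by elim/ord3_ind: l; rewrite /extend /= !mxE //; ring. Qed.

Lemma extend_sum (c : 'I_3 -> Fun) (f : 'I_3 -> Form) l :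
  extend (\sum_k c k *: f k) l = \sum_k c k * extend (f k) l.
Proof.
rewrite !sum3E -[c iZ *: _]addr0 -addrA !extendD extend0.
by ring.
Qed.

Lemma extend_inj u w : extend u =1 extend w -> u = w.
Proof.
move=> eq_uw; apply/rowP => -[[|[|//]] lt_i].
- have := eq_uw iX; rewrite /extend /= !ord1.
  by rewrite (_ : Ordinal lt_i = ix) //; apply: val_inj.
- have := eq_uw iY; rewrite /extend /= !ord1.
  by rewrite (_ : Ordinal lt_i = iy) //; apply: val_inj.
Qed.

Lemma dot_extend e : \sum_l h l * extend e l = 0.
Proof. by rewrite sum3E /extend /= hcoordZ; ring. Qed.

Lemma extend_dhcoord k l :
  extend (dhcoord R k) l = unitv Fun k l - h k * unitv Fun iZ l.
Proof.
have hZ := hcoordZ; elim/ord3_ind: k; elim/ord3_ind: l;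
  rewrite /extend /unitv /dhcoord !(tnth_nth 0) /= !mxE /= ?hZ; ring.
Qed.

Lemma extend_dcoord i k l :
  extend (dcoord R i k) l =
  h i ^- 2 * (h i * unitv Fun k l - h k * unitv Fun i l).
Proof.
rewrite /dcoord -[_ *: _]addr0 extendD extend0 addr0 -scaleNr extendD.
rewrite -[_ *: dhcoord _ i]addr0 extendD extend0 !extend_dhcoord.
by congr (_ * _); ring.
Qed.

Lemma extend_Omega (c : 'I_3 -> Fun) i l :
  extend (\sum_k c k *: dcoord R i k) l =
  h i ^- 2 * (h i * c l - (\sum_k h k * c k) * unitv Fun i l).
Proof.
rewrite extend_sum; under eq_bigr do rewrite extend_dcoord mulrCA mulrBr.
rewrite -mulr_sumr sumrB; congr (_ * (_ - _)); last first.
  by rewrite mulr_suml; apply: eq_bigr => k _; ring.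
rewrite (bigD1 l) //= big1 => [|k ne_kl]; first by rewrite /unitv eqxx mulr1 addr0 mulrC.
by rewrite /unitv (negPf ne_kl) mulr0 mulr0.
Qed.

(** The Euler sequence embeds the differentials of the plane into three copies of O(-1), whence the
    degree [2 N - 1] over a denominator of degree [2 N]. *)
Lemma Omega_lift i j w : Omega_P2 i j w -> eventually (fun N =>
  exists2 W : 'I_3 -> T, forall l, W l \is (2 * N - 1)%N.-homog &
    forall l, extend w l * (h i * h j) ^+ N = to_fun (W l)).
Proof.
move=> [c reg_c ->]; have [N0 cN] := eventually_all (fun k => regular_lift (reg_c k)).
exists (N0 + 2)%N => N le_N; have [m Dm] : exists m, N = (m + 2)%N.
  by exists (N - 2)%N; lia.
rewrite {}Dm in le_N *; have [|C hC DC] := fin_all_exists2 (cN m _); first by lia.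
exists (fun l => 'X_j ^+ 2 * ('X_i * C l - (\sum_k 'X_k * C k) * unitv T i l)) => l.
  rewrite (_ : 2 * (m + 2) - 1 = 2 + (2 * m).+1)%N; last by lia.
  apply: dhomogM; first exact: dhomogXUn.
  rewrite rpredB ?dhomogXUM // /unitv mulrC.
  case: eqP => _; rewrite ?mul1r ?mul0r ?dhomog0 //.
  by rewrite rpred_sum // => k _; apply: dhomogXUM.
have dotC : to_fun (\sum_k 'X_k * C k) = (\sum_k h k * c k) * (h i * h j) ^+ m.
  rewrite rmorph_sum mulr_suml; apply: eq_bigr => k _.
  by rewrite rmorphM /= to_funX -DC mulrA.
rewrite extend_Omega rmorphM rmorphXn rmorphB !rmorphM /= dotC !to_funX rmorph_nat -DC.
exact: frac_Omega (hcoord_neq0 _).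
Qed.

(** The Jacobian identity on the chart is homogenised: evaluation at the chart kills ['X_i - 1], and
    a large power of ['X_i] turns the other coefficients into forms of complementary degree. *)
Lemma irrelevant_of_smooth d (F : T) : F \is d.-homog -> smooth_curve F ->
  jacobian_irrelevant F.
Proof.
move=> hF smoothF.
suff /eventually_all[N irrF] : forall i, eventually (fun N =>
    exists (a : T) (c : 'I_3 -> T), 'X_i ^+ N = a * F + \sum_k c k * F^`M(k)).
  by exists N; apply: irrF.
move=> i; have [a [b [c Dabc]]] := smoothF i.
have [N1 aN] := at_chart_lift i a.
have [N2 cN] := eventually_all (fun k => at_chart_lift i (c k)).
exists (N1 + N2 + d)%N => N le_N.
have [|H hH DH] := aN (N - d)%N; first by lia.
have [|C hC DC] := fin_all_exists2 (cN (N - d.-1)%N _); first by lia.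
exists H, (fun k => if k != i then C k else 0).
apply/eqP; rewrite -subr_eq0; apply/eqP/(@to_fun_inj N).
  rewrite rpredB ?dhomogXUn // rpredD // ?rpred_sum //.
    by rewrite -{1}(@subnK d N) ?dhomogM //; lia.
  move=> k _; rewrite -{1}(@subnK d.-1 N); last by lia.
  by rewrite dhomogM ?mderiv_homog //; case: ifP; rewrite ?dhomog0.
apply/eqP; rewrite rmorphB subr_eq0 rmorphXn /= to_funX; apply/eqP.
have := congr1 (fun G => at_chart i G * h i ^+ N) Dabc.
rewrite rmorph1 mul1r => ->; rewrite !rmorphD !rmorphM rmorphB rmorph1 /= at_chartXU.
rewrite divff ?hcoord_neq0 // subrr mulr0 addr0 mulrDl; congr (_ + _).
  rewrite -DH -(at_chart_homog i hF) mulrACA -exprD subnK //; lia.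
rewrite !rmorph_sum mulr_suml big_mkcond /=; apply: eq_bigr => k _.
case: ifP => _; last by rewrite mul0r rmorph0.
rewrite !rmorphM /= -DC -(at_chart_homog i (mderiv_homog k hF)) mulrACA -exprD.
by rewrite subnK //; lia.
Qed.

End Charts.

(** The field identity behind [null_lift]: [P], [Q] stand for X_i, X_j, while [f], [g] stand for F
    and a partial derivative. Here [d] is the degree of F minus one. *)
Lemma frac_null (K : fieldType) (P Q D f g u U W a H : K) m m0 d : P != 0 ->
  P ^- m * D = f / P ^+ d.+1 * U +
    a * (P ^- 2 * (P * (g / P ^+ d) - f *+ d.+1 / P ^+ d * u)) ->
  U * (P * Q) ^+ m0.+1 = W -> a * (P * Q) ^+ m0 = H ->
  D * (P * Q) ^+ (m0 + d.+2) = P ^+ m.+1 * Q ^+ d.+2 * H * g +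
    f * (P ^+ m * Q ^+ d.+1 * W - P ^+ m * Q ^+ d.+2 * H * (u *+ d.+1)).
Proof.
move=> P0 eqD <- <-.
have -> : D = P ^+ m * (P ^- m * D) by rewrite mulrA divff ?mul1r // expf_neq0.
rewrite eqD -[f *+ _]mulr_natr -[u *+ _]mulr_natr; move: (d.+1%:R) => c.
rewrite !exprMn !exprD !exprS; field.
by rewrite P0 ?expf_neq0.
Qed.

(** * Lifts of global sections to vectors of forms *)

Section GlobalSections.
Variables (R : idomainType) (d : nat) (F : {mpoly R[3]}).
Local Notation T := {mpoly R[3]}.
Local Notation E := (fun k : 'I_3 => 'X_k : T).
Local Notation Fun := {fraction {mpoly R[2]}}.
Local Notation Form := 'rV[Fun]_2.
Local Notation h := (@hcoord R).
Implicit Types (i j k l : 'I_3) (G H : T) (u w : Form) (a : Fun).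
Hypotheses (d_gt0 : (0 < d)%N) (hF : F \is d.-homog).

Lemma extend_scale a u l : extend (a *: u) l = a * extend u l.
Proof. by rewrite -[a *: u]addr0 extendD extend0 addr0. Qed.

Lemma coordZE i : Defs.coord R i iZ = (h i)^-1.
Proof. by rewrite /Defs.coord hcoordZ mul1r. Qed.

(** The twist by n + 1 raises the degree of the components from -1 to n. *)
Lemma section_lift n i w : Omega_P2 i i (Defs.coord R i iZ ^+ n.+1 *: w) ->
  eventually (fun N => exists2 W : 'I_3 -> T,
    forall l, W l \is (2 * N + n)%N.-homog &
    forall l, extend w l * h i ^+ (2 * N) = to_fun (W l)).
Proof.
move=> /Omega_lift[N0 wN]; exists N0.+1 => N lt_N.
have [|W hW DW] := wN N; first exact: ltnW.
exists (fun l => 'X_i ^+ n.+1 * W l) => l.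
  rewrite (_ : 2 * N + n = n.+1 + (2 * N - 1))%N; last by lia.
  by rewrite dhomogM ?dhomogXUn.
rewrite rmorphM rmorphXn /= to_funX -DW extend_scale coordZE exprVn exprM -expr2.
by rewrite !mulrA divff ?mul1r // expf_neq0 ?hcoord_neq0.
Qed.

Lemma null_lift n i j w : (d <= n)%N ->
  null_on_C F i j (Defs.coord R i iZ ^+ n.+1 *: w) ->
  eventually (fun N => exists H (u : 'I_3 -> T),
    [/\ H \is (2 * N + (n + 1 - d))%N.-homog,
        forall l, u l \is (2 * N + n - d)%N.-homog &
        forall l, extend w l * (h i * h j) ^+ N =
          to_fun (H * F^`M(l) + F * u l)]).
Proof.
move=> le_dn [u [a [/Omega_lift[N1 uN] /regular_lift[N2 aN] Dw]]].
exists (N1 + N2 + d.+1)%N => N le_N.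
have [m Dm] : exists m, N = (m + d.+1)%N by exists (N - d.+1)%N; lia.
rewrite {}Dm in le_N *; have [|W hW DW] := uN m.+1; first by lia.
have [|H hH DH] := aN m; first by lia.
(* Read off from [frac_null]. The second term of [u] comes from projecting dg to a vector orthogonal
   to [E]: by Euler's identity the correction is a multiple of F. *)
exists ('X_i ^+ n.+2 * 'X_j ^+ d.+1 * H),
  (fun l => 'X_i ^+ n.+1 * 'X_j ^+ d * W l
     - 'X_i ^+ n.+1 * 'X_j ^+ d.+1 * H * (unitv T i l *+ d)).
have XX := fun e e' => dhomogM (dhomogXUn R i e) (dhomogXUn R j e').
split=> [|l|l].
- rewrite (_ : _ + _ = n.+2 + d.+1 + 2 * m)%N; last by lia.
  exact: dhomogM (XX _ _) hH.
- rewrite rpredB //.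
    rewrite (_ : _ - _ = n.+1 + d + (2 * m.+1 - 1))%N; last by lia.
    exact: dhomogM (XX _ _) (hW l).
  rewrite (_ : _ - _ = n.+1 + d.+1 + 2 * m)%N; last by lia.
  rewrite mulrnAr rpredMn // /unitv mulrC; case: eqP => _; rewrite ?mul0r ?dhomog0 //.
  by rewrite mul1r; apply: dhomogM (XX _ _) hH.
have atF : at_chart i F = to_fun F / h i ^+ d.
  by rewrite -(at_chart_homog i hF) mulfK // expf_neq0 ?hcoord_neq0.
have atFk k : at_chart i F^`M(k) = to_fun F^`M(k) / h i ^+ d.-1.
  by rewrite -(at_chart_homog i (mderiv_homog k hF)) mulfK // expf_neq0 ?hcoord_neq0.
have eulF : \sum_k h k * at_chart i F^`M(k) = to_fun F *+ d / h i ^+ d.-1.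
  rewrite -raddfMn -(euler hF) /= rmorph_sum mulr_suml; apply: eq_bigr => k _.
  by rewrite rmorphM /= to_funX atFk mulrA.
have [d' Dd] : exists d', d = d'.+1 by exists d.-1; rewrite prednK.
have := congr1 (fun x => extend x l) Dw.
rewrite extend_scale coordZE exprVn extendD extend_scale extend_Omega eulF atFk atF.
rewrite Dd /= => /frac_null/(_ (DW l) DH) ->; last exact: hcoord_neq0.
rewrite rmorphD !rmorphM rmorphB !rmorphM !rmorphXn raddfMn /= rmorph_nat !to_funX.
by [].
Qed.

Lemma global_section_lift n (e : 'I_3 -> Form) : (d <= n)%N ->
  global_section F n.+1 e ->
  exists N (w : 'I_3 -> 'I_3 -> T) (H : 'I_3 -> 'I_3 -> T)
      (u : 'I_3 -> 'I_3 -> 'I_3 -> T),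
    [/\ (0 < N)%N, forall i l, w i l \is (N + n)%N.-homog,
        forall i l, extend (e i) l * h i ^+ N = to_fun (w i l),
        forall i j, H i j \is (2 * N + (n + 1 - d))%N.-homog &
        forall i j l, 'X_j ^+ N * w i l - 'X_i ^+ N * w j l =
          H i j * F^`M(l) + F * u i j l].
Proof.
move=> le_dn [/(_ _)/section_lift eN nullN].
have [N1 {}eN] := eventually_all eN.
have {nullN}[N2 nN] := eventually_all (fun i =>
  eventually_all (fun j => null_lift le_dn (nullN i j))).
(* [section_lift] clears denominators with an even power of X_i, so the common exponent is taken
   even. *)
pose N := (N1 + N2).+1; exists (2 * N)%N.
have [|w hw Dw] := fin_all_exists2 (eN N _); first by rewrite /N; lia.
have le_N2 : (N2 <= 2 * N)%N by rewrite /N; lia.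
have /fin_all_exists[Hu DHu] (ij : 'I_3 * 'I_3) := nN _ le_N2 ij.1 ij.2.
have [u {}DHu] := fin_all_exists DHu.
exists w, (fun i j => Hu (i, j)), (fun i j => u (i, j)).
split=> [||||i j l]; rewrite ?muln_gt0 //.
- by move=> i j; have [] := DHu (i, j).
have /= [hH hu {}DHu] := DHu (i, j); apply/eqP; rewrite -subr_eq0; apply/eqP.
apply: (@to_fun_inj _ (2 * N + (2 * N + n))).
  rewrite rpredB //; first by rewrite rpredB // dhomogM ?dhomogXUn.
  rewrite rpredD //.
    rewrite (_ : _ + _ = 2 * (2 * N) + (n + 1 - d) + d.-1)%N; last by lia.
    by rewrite dhomogM ?mderiv_homog.
  by rewrite (_ : _ + _ = d + (2 * (2 * N) + n - d))%N ?dhomogM //; lia.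
rewrite rmorphB /= -DHu rmorphB !rmorphM !rmorphXn /= !to_funX -!Dw.
rewrite (_ : e i - e j = (-1) *: e j + e i); last by rewrite scaleN1r addrC.
by rewrite extendD exprMn; ring.
Qed.

End GlobalSections.

Lemma frac_twist (K : fieldType) (x g : K) n : x != 0 ->
  x^-1 ^+ n.+1 * g = x ^- 2 * (x * (g / x ^+ n)).
Proof. by move=> x0; rewrite exprVn exprS; field; rewrite x0 expf_neq0. Qed.

(** * Global sections and M_3 *)

Section ImageH0.
Variables (R : idomainType) (d n : nat) (F : {mpoly R[3]}) (A : comAlgType R).
Variables (pi : {lrmorphism {mpoly R[2]} -> A}) (Omega : lmodType A).
Variable delta : {linear (A^o * A^o)%type -> Omega}.
Local Notation T := {mpoly R[3]}.
Local Notation E := (fun k : 'I_3 => 'X_k : T).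
Local Notation Fun := {fraction {mpoly R[2]}}.
Local Notation psi := (to_affine pi).

Hypotheses (d_gt0 : (0 < d)%N) (hF : F \is d.-homog) (le_dn : (d <= n)%N).

Lemma regular_at_chart i (G : T) : regular i i (at_chart i G).
Proof. by exists G, 0%N; rewrite expr0 divr1. Qed.

Lemma Omega_P2_0 i j : Omega_P2 i j (0 : 'rV[Fun]_2).
Proof.
exists (fun=> 0) => [k|]; first by exists 0, 0%N; rewrite rmorph0 mul0r.
by rewrite big1 // => k _; rewrite scale0r.
Qed.

Lemma null_on_C0 i j : null_on_C F i j 0.
Proof.
exists 0, 0; split; first exact: Omega_P2_0.
  by exists 0, 0%N; rewrite rmorph0 mul0r.
by rewrite scaler0 scale0r addr0.
Qed.

(** The vector [E] x [v] is a single rational form on the plane and serves as the lift on all three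
    charts; its degree n bounds the pole along Z = 0. *)
Lemma M3_image_H0 w : M3 pi n delta w -> image_H0 F pi n.+1 delta w.
Proof.
have n_gt0 : (0 < n)%N by lia.
move=> [u /(M2P _ _ n_gt0)[v hv ->] ->].
pose e : 'rV[Fun]_2 := to_fun (cross E v iX) *: dx R + to_fun (cross E v iY) *: dy R.
exists (fun=> e), (affine_eq (cross E v iX)), (affine_eq (cross E v iY)).
split=> //; split=> [i|i j]; last by rewrite subrr scaler0; apply: null_on_C0.
have ext_e l : extend e l = to_fun (cross E v l).
  have := congr1 (@to_fun R) (dot_cross E v).
  rewrite sum3E !rmorphD !rmorphM rmorph0 /= !to_funX hcoordZ mul1r => /eqP.
  rewrite addr_eq0 => /eqP dot0.
  elim/ord3_ind: l; rewrite /extend /= !mxE /= ?mulr1 ?mulr0 ?addr0 ?add0r //.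
  by rewrite dot0 opprK.
have hcv l : cross E v l \is n.-homog by have := dhomog_cross l hv; rewrite prednK.
have atcv l : at_chart i (cross E v l) = to_fun (cross E v l) / hcoord R i ^+ n.
  by rewrite -(at_chart_homog i (hcv l)) mulfK ?expf_neq0 ?hcoord_neq0.
exists (fun k => at_chart i (cross E v k)) => [k|].
  exact: regular_at_chart.
apply: extend_inj => l; rewrite extend_scale coordZE extend_Omega ext_e.
have -> : \sum_k hcoord R k * at_chart i (cross E v k) = 0.
  transitivity (to_fun (\sum_k 'X_k * cross E v k) / hcoord R i ^+ n); last first.
    by rewrite dot_cross rmorph0 mul0r.
  rewrite rmorph_sum mulr_suml; apply: eq_bigr => k _.
  by rewrite atcv rmorphM /= to_funX mulrA.
rewrite mul0r subr0 atcv; exact: frac_twist (hcoord_neq0 _ _).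
Qed.

Hypothesis le_2dn : (2 * d <= n + 3)%N.
Hypothesis irrF : jacobian_irrelevant F.
Hypotheses (F0 : F != 0) (coordA : is_coordinate_ring F pi).
Hypothesis difA : is_differentials F pi delta.

(** On the chart Z the section and the glued vector differ by a multiple of the gradient and one of
    F; in A this is a multiple of df, which [delta] kills. *)
Lemma image_H0_M3 w : image_H0 F pi n.+1 delta w -> M3 pi n delta w.
Proof.
move=> [e [a [b [gse DeZ ->]]]].
have [N [W [H [u [N_gt0 hW DW hH DHu]]]]] := global_section_lift d_gt0 hF le_dn gse.
have [|v [p [s [hv Dv]]]] := cech_gluing d_gt0 F0 hF irrF le_dn le_2dn N_gt0 hW _ hH DHu.
  move=> i; apply: (@to_fun_inj _ (N + n).+1).
    by rewrite rpred_sum // => l _; apply: dhomogXUM.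
  rewrite -(mul0r (hcoord R i ^+ N)) -(dot_extend (e i)) rmorph_sum mulr_suml.
  by apply: eq_bigr => l _; rewrite rmorphM /= to_funX -DW mulrA.
have Da : a = affine_eq (W iZ iX).
  apply/eqP; rewrite -subr_eq0 -tofrac_eq0 rmorphB subr_eq0; apply/eqP.
  rewrite -[RHS]/(to_fun _) -DW hcoordZ expr1n mulr1 DeZ /extend /= !mxE /=.
  by rewrite mulr1 mulr0 addr0.
have Db : b = affine_eq (W iZ iY).
  apply/eqP; rewrite -subr_eq0 -tofrac_eq0 rmorphB subr_eq0; apply/eqP.
  rewrite -[RHS]/(to_fun _) -DW hcoordZ expr1n mulr1 DeZ /extend /= !mxE /=.
  by rewrite mulr1 mulr0 add0r.
have psiW l : psi (W iZ l) = psi (cross E v l) + psi p * psi F^`M(l).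
  rewrite Dv !rmorphD !rmorphM rmorphXn /= to_affineZ expr1n mul1r.
  by rewrite (to_affineF coordA) mul0r addr0.
exists (form_of pi v); first by apply/M2P; [lia | exists v].
apply/eqP; rewrite -subr_eq0 -linearB; apply/eqP/difA.2; exists (psi p).
rewrite mul_dfE Da Db; apply: (congr2 pair).
- by rewrite /= -[X in X - _]/(psi (W iZ iX)) psiW addrC addKr.
- by rewrite /= -[X in X - _]/(psi (W iZ iY)) psiW addrC addKr.
Qed.

End ImageH0.

(** * Computable functions *)

(** Quantifying over [R] after the program makes it uniform: one program serves all rings. *)
Definition computable a b (f : forall R : unitRingType, sem R a -> sem R b) : Prop :=
  exists P : prog a b, forall (R : unitRingType) x, run P x (f R x).

Section Computable.
Implicit Types (a b c e : ty).

Lemma cp_ext a b (f g : forall R : unitRingType, sem R a -> sem R b) :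
  computable f -> (forall R x, f R x = g R x) -> computable g.
Proof. by move=> [P runP] eq_fg; exists P => R x; rewrite -eq_fg. Qed.

Lemma cp_comp a b c g f : @computable b c g -> @computable a b f ->
  computable (fun R x => g R (f R x)).
Proof. by move=> [Q runQ] [P runP]; exists (Comp Q P) => R x /=; exists (f R x). Qed.

Lemma cp_pair a b c f g : @computable a b f -> @computable a c g ->
  @computable a (Prod b c) (fun R x => (f R x, g R x)).
Proof. by move=> [P runP] [Q runQ]; exists (Pair P Q) => R x /=. Qed.

Lemma cp_fst a b : @computable (Prod a b) a (fun R x => x.1).
Proof. by exists (Fst a b). Qed.

Lemma cp_snd a b : @computable (Prod a b) b (fun R x => x.2).
Proof. by exists (Snd a b). Qed.

Lemma cp_zero a : @computable a Nat (fun R x => 0%N).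
Proof. by exists (Zero a). Qed.

Lemma cp_succ : @computable Nat Nat (fun R x => x.+1).
Proof. by exists Succ. Qed.

Lemma cp_natcase a b f g h : @computable a Nat h -> @computable a b f ->
  @computable (Prod Nat a) b g ->
  @computable a b (fun R x => if h R x is k.+1 then g R (k, x) else f R x).
Proof.
move=> [H runH] [P runP] [Q runQ].
exists (Comp (NatCase P Q) (Pair H (Id a))) => R x /=.
by exists (h R x, x) => //=; case: (h R x).
Qed.

Lemma cp_if a b f g h : @computable a Nat h -> @computable a b f ->
  @computable a b g ->
  @computable a b (fun R x => if h R x == 0%N then g R x else f R x).
Proof.
move=> cph cpf cpg; have := cp_natcase cph cpg (cp_comp cpf (@cp_snd Nat a)).
by move/cp_ext; apply=> R x; case: (h R x).
Qed.

Lemma cp_nil a b : @computable a (List b) (fun R x => [::]).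
Proof. by exists (Defs.Nil a b). Qed.

Lemma cp_cons a b f g : @computable a b f -> @computable a (List b) g ->
  @computable a (List b) (fun R x => f R x :: g R x).
Proof.
move=> [P runP] [Q runQ]; exists (Comp (Defs.Cons b) (Pair P Q)) => R x /=.
by exists (f R x, g R x).
Qed.

Lemma cp_listcase a b c f g h : @computable a (List b) h -> @computable a c f ->
  @computable (Prod b (Prod (List b) a)) c g ->
  @computable a c (fun R x => if h R x is y :: s then g R (y, (s, x)) else f R x).
Proof.
move=> [H runH] [P runP] [Q runQ].
exists (Comp (ListCase P Q) (Pair H (Id a))) => R x /=.
by exists (h R x, x) => //=; case: (h R x).
Qed.

(** The loop state holds the unread list, the accumulator and the environment. Only this lemma and
    [cp_iota] build a [While]; other iterations are folds. *)
Lemma cp_foldl a b e l z f : @computable e (List a) l -> @computable e b z ->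
  @computable (Prod a (Prod b e)) b f ->
  @computable e b (fun R x => foldl (fun acc y => f R (y, (acc, x))) (z R x) (l R x)).
Proof.
move=> [L runL] [Z runZ] [P runP].
pose body : prog (Prod (List a) (Prod b e)) (Prod (List a) (Prod b e)) :=
  ListCase (Pair (Defs.Nil _ a) (Id _))
    (Pair (Comp (Fst _ _) (Snd _ _))
      (Pair (Comp P (Pair (Fst _ _) (Comp (Snd _ _) (Snd _ _))))
         (Comp (Snd _ _) (Comp (Snd _ _) (Snd _ _))))).
pose test : prog (Prod (List a) (Prod b e)) Nat :=
  ListCase (Zero _) (Comp Succ (Zero _)).
exists (Comp (Comp (Fst _ _) (Snd _ _))
  (Comp (While test body) (Pair L (Pair Z (Id _))))) => R x.
have runW s acc : loop (run (R := R) test) (run body) (s, (acc, x))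
    ([::], (foldl (fun acc y => f R (y, (acc, x))) acc s, x)).
  elim: s acc => [|y s IH] acc /=; first exact: LoopStop.
  apply: (@LoopStep _ _ _ _ (s, (f R (y, (acc, x)), x)) _ 0) (IH _).
    by exists 0%N.
  split; first by exists (s, (acc, x)).
  split; first by exists (y, (acc, x)) => //; split=> //; exists (s, (acc, x)).
  by exists (acc, x) => //; exists (s, (acc, x)).
exists ([::], (foldl (fun acc y => f R (y, (acc, x))) (z R x) (l R x), x)).
  by exists (l R x, (z R x, x)) => //; apply: runW.
by exists (foldl (fun acc y => f R (y, (acc, x))) (z R x) (l R x), x).
Qed.

Lemma cp_rev a e l : @computable e (List a) l ->
  @computable e (List a) (fun R x => rev (l R x)).
Proof.
move=> cpl; have := cp_foldl cpl (@cp_nil e a)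
  (cp_cons (@cp_fst a _) (cp_comp (cp_fst _ _) (cp_snd _ (Prod (List a) e)))).
move/cp_ext; apply=> R x /=; rewrite -[rev _]cats0 -catrevE.
by elim: (l R x) [::] => //= y s IH acc; rewrite IH.
Qed.

Lemma cp_foldr a b e l z f : @computable e (List a) l -> @computable e b z ->
  @computable (Prod a (Prod b e)) b f ->
  @computable e b (fun R x => foldr (fun y acc => f R (y, (acc, x))) (z R x) (l R x)).
Proof.
move=> cpl cpz cpf; have := cp_foldl (cp_rev cpl) cpz cpf.
by move/cp_ext; apply=> R x; rewrite foldl_rev.
Qed.

Lemma cp_map a b e l f : @computable e (List a) l -> @computable (Prod a e) b f ->
  @computable e (List b) (fun R x => [seq f R (y, x) | y <- l R x]).
Proof.
move=> cpl cpf; refine (cp_foldr cpl (@cp_nil e b) (cp_cons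
  (cp_comp cpf (cp_pair (@cp_fst a (Prod (List b) e)) (cp_comp (cp_snd _ _) (cp_snd _ _))))
  (cp_comp (cp_fst _ _) (cp_snd _ _)))).
Qed.

Lemma cp_cat a e l l' : @computable e (List a) l -> @computable e (List a) l' ->
  @computable e (List a) (fun R x => l R x ++ l' R x).
Proof.
move=> cpl cpl'; have := cp_foldr cpl cpl'
  (cp_cons (@cp_fst a _) (cp_comp (cp_fst _ _) (cp_snd _ (Prod (List a) e)))).
by move/cp_ext; apply=> R x /=; elim: (l R x) => //= y s ->.
Qed.

Lemma cp_flatten a e l : @computable e (List (List a)) l ->
  @computable e (List a) (fun R x => flatten (l R x)).
Proof.
move=> cpl; exact (cp_foldr cpl (@cp_nil e a)
  (cp_cat (@cp_fst (List a) _) (cp_comp (cp_fst _ _) (cp_snd _ (Prod (List a) e))))).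
Qed.

Lemma cp_zip a b e l l' : @computable e (List a) l -> @computable e (List b) l' ->
  @computable e (List (Prod a b)) (fun R x => zip (l R x) (l' R x)).
Proof.
move=> cpl cpl'; pose st := Prod (List b) (List (Prod a b)).
have cpf : @computable (Prod a (Prod st e)) st (fun R x =>
    if x.2.1.1 is y :: s then (s, (x.1, y) :: x.2.1.2) else ([::], x.2.1.2)).
  have acc := cp_comp (@cp_fst st e) (@cp_snd a (Prod st e)).
  have out := cp_comp (cp_snd _ _) acc.
  refine (cp_listcase (cp_comp (cp_fst _ _) acc) (cp_pair (cp_nil _ b) out)
    (cp_pair (cp_comp (cp_fst _ _) (cp_snd _ _)) (cp_cons
      (cp_pair (cp_comp (cp_fst _ _) (cp_comp (cp_snd _ _) (cp_snd _ _))) (cp_fst _ _))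
      (cp_comp out (cp_comp (cp_snd _ _) (cp_snd _ _)))))).
have := cp_rev (cp_comp (cp_snd _ _) (cp_foldl cpl (cp_pair cpl' (cp_nil e _)) cpf)).
move/cp_ext; apply=> R x /=.
set step := (X in foldl X).
have stepE s s' acc : (foldl step (s', acc) s).2 = rev (zip s s') ++ acc.
  elim: s s' acc => [|y s IH] [|y' s'] acc //=; first by rewrite IH; case: (s).
  by rewrite IH rev_cons cat_rcons.
by rewrite stepE cats0 revK.
Qed.

Lemma cp_iota e f : @computable e Nat f ->
  @computable e (List Nat) (fun R x => iota 0 (f R x)).
Proof.
move=> [P runP].
pose body : prog (Prod Nat (List Nat)) (Prod Nat (List Nat)) :=
  NatCase (Pair (Zero _) (Id _)) (Pair (Fst _ _) (Defs.Cons Nat)).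
pose test : prog (Prod Nat (List Nat)) Nat := NatCase (Zero _) (Comp Succ (Zero _)).
exists (Comp (Snd _ _) (Comp (While test body) (Pair P (Defs.Nil _ _)))) => R x.
have runW n s : loop (run (R := R) test) (run body) (n, s) (0%N, iota 0 n ++ s).
  elim: n s => [|n IH] s; first exact: LoopStop.
  apply: (@LoopStep _ _ _ _ (n, n :: s) _ 0); first by exists 0%N.
    by [].
  by rewrite -addn1 iotaD -catA; apply: IH.
exists (0%N, iota 0 (f R x)) => //=; exists (f R x, [::]) => //.
by rewrite -[iota 0 _]cats0; apply: runW.
Qed.

Lemma cp_pred e f : @computable e Nat f -> @computable e Nat (fun R x => (f R x).-1).
Proof.
move=> cpf; have := cp_natcase cpf (cp_zero e) (cp_fst _ _).
by move/cp_ext; apply=> R x; case: (f R x).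
Qed.

Lemma cp_addn e f g : @computable e Nat f -> @computable e Nat g ->
  @computable e Nat (fun R x => (f R x + g R x)%N).
Proof.
move=> cpf cpg; have := cp_foldr (cp_iota cpf) cpg
  (cp_comp cp_succ (cp_comp (cp_fst _ _) (@cp_snd Nat (Prod Nat e)))).
move/cp_ext; apply=> R x /=; rewrite -{2}(size_iota 0 (f R x)).
by elim: (iota _ _) => //= y s ->.
Qed.

Lemma cp_subn e f g : @computable e Nat f -> @computable e Nat g ->
  @computable e Nat (fun R x => (f R x - g R x)%N).
Proof.
move=> cpf cpg; have := cp_foldr (cp_iota cpg) cpf
  (cp_pred (cp_comp (cp_fst _ _) (@cp_snd Nat (Prod Nat e)))).
move/cp_ext; apply=> R x /=; rewrite -{2}(size_iota 0 (g R x)).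
by elim: (iota _ _) => [|y s /= ->]; rewrite ?subn0 // subnS.
Qed.

Lemma cp_eqn e f g : @computable e Nat f -> @computable e Nat g ->
  @computable e Nat (fun R x => (f R x == g R x) : nat).
Proof.
move=> cpf cpg; have := cp_if (cp_addn (cp_subn cpf cpg) (cp_subn cpg cpf))
  (cp_zero e) (cp_comp cp_succ (cp_zero e)).
move/cp_ext; apply=> R x; rewrite addn_eq0 !subn_eq0 -eqn_leq.
by case: eqP.
Qed.

Lemma cp_scal0 a : @computable a Scal (fun R x => 0).
Proof. by exists (Scal0 a). Qed.

Lemma cp_scal1 a : @computable a Scal (fun R x => 1).
Proof. by exists (Scal1 a). Qed.

Lemma cp_opp e f : @computable e Scal f -> @computable e Scal (fun R x => - f R x).
Proof. by move=> [P runP]; exists (Comp Opp P) => R x; exists (f R x). Qed.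

Lemma cp_inv e f : @computable e Scal f -> @computable e Scal (fun R x => (f R x)^-1).
Proof. by move=> [P runP]; exists (Comp Inv P) => R x; exists (f R x). Qed.

Lemma cp_unit e f : @computable e Scal f ->
  @computable e Nat (fun R x => (f R x \is a GRing.unit) : nat).
Proof. by move=> [P runP]; exists (Comp IsUnit P) => R x; exists (f R x). Qed.

Lemma cp_add e f g : @computable e Scal f -> @computable e Scal g ->
  @computable e Scal (fun R x => f R x + g R x).
Proof.
by move=> [P runP] [Q runQ]; exists (Comp Add (Pair P Q)) => R x; exists (f R x, g R x).
Qed.

Lemma cp_mul e f g : @computable e Scal f -> @computable e Scal g ->
  @computable e Scal (fun R x => f R x * g R x).
Proof.
by move=> [P runP] [Q runQ]; exists (Comp Mul (Pair P Q)) => R x; exists (f R x, g R x).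
Qed.

Lemma cp_mulrn e f g : @computable e Scal f -> @computable e Nat g ->
  @computable e Scal (fun R x => f R x *+ g R x).
Proof.
move=> cpf cpg; have := cp_foldr (cp_iota cpg) (cp_scal0 e)
  (cp_add (cp_comp cpf (cp_comp (cp_snd _ _) (cp_snd _ _)))
     (cp_comp (cp_fst _ _) (@cp_snd Nat (Prod Scal e)))).
move/cp_ext; apply=> R x /=; rewrite -{2}(size_iota 0 (g R x)).
by elim: (iota _ _) => [|y s /= ->]; rewrite ?mulr0n // mulrS.
Qed.

End Computable.

(** * The algorithm *)

Local Notation mon := (nat * (nat * nat))%type.

(* The exponents of the monomials of degree [e - 1], none if [e = 0]. *)
Definition mons (e : nat) : seq mon :=
  [seq (i, (j, (e - (i + j)).-1)) | i <- iota 0 e, j <- iota 0 (e - i)].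

Section Algorithm.
Variable R : unitRingType.
Local Notation poly := (seq (R * mon)).
Local Notation poly_xy := (seq (R * (nat * nat))).
Local Notation column := ((poly_xy * poly_xy) * seq R)%type.
Implicit Types (s : poly) (m : mon) (r : poly * (poly * poly)).

Definition mulmon s m : poly :=
  [seq (t.1, (t.2.1 + m.1, (t.2.2.1 + m.2.1, t.2.2.2 + m.2.2)))%N | t <- s].

Definition coefm s m : R :=
  foldr (fun t acc => if t.2 == m then t.1 + acc else acc) 0 s.

Definition opps s : poly := [seq (- t.1, t.2) | t <- s].

Definition derX s : poly := [seq (t.1 *+ t.2.1, (t.2.1.-1, t.2.2)) | t <- s].
Definition derY s : poly :=
  [seq (t.1 *+ t.2.2.1, (t.2.1, (t.2.2.1.-1, t.2.2.2))) | t <- s].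
Definition derZ s : poly :=
  [seq (t.1 *+ t.2.2.2, (t.2.1, (t.2.2.1, t.2.2.2.-1))) | t <- s].

(* The generators m E, m F eps_k and m (grad F x eps_k) of the module of
   vectors v of degree n - 1 whose form lies in A df. *)
Definition relations (d n : nat) s : seq (poly * (poly * poly)) :=
  [seq ([:: (1, (m.1.+1, m.2))], ([:: (1, (m.1, (m.2.1.+1, m.2.2)))],
     [:: (1, (m.1, (m.2.1, m.2.2.+1)))])) | m <- mons n.-1] ++
  ([seq (mulmon s m, ([::], [::])) | m <- mons (n - d)] ++
  ([seq ([::], (mulmon s m, [::])) | m <- mons (n - d)] ++
  ([seq ([::], ([::], mulmon s m)) | m <- mons (n - d)] ++
  ([seq ([::], (mulmon (derZ s) m, opps (mulmon (derY s) m)))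
      | m <- mons (n - d).+1] ++
  ([seq (opps (mulmon (derZ s) m), ([::], mulmon (derX s) m))
      | m <- mons (n - d).+1] ++
   [seq (mulmon (derY s) m, (opps (mulmon (derX s) m), [::]))
      | m <- mons (n - d).+1]))))).

(** The relation matrix is stored by columns: each generator of M_2, labelled by its form, carries
    its coefficients in all relations. *)
Definition columns (n : nat) (rs : seq (poly * (poly * poly))) : seq column :=
  [seq (([::], [:: (1, (m.1, m.2.1))]), [seq coefm r.1 m | r <- rs]) | m <- mons n] ++
  ([seq (([:: (-1, (m.1, m.2.1))], [::]), [seq coefm r.2.1 m | r <- rs]) | m <- mons n] ++
   [seq (([:: (1, (m.1, m.2.1.+1))], [:: (-1, (m.1.+1, m.2.1))]),
      [seq coefm r.2.2 m | r <- rs]) | m <- mons n]).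

Definition pivot (cols : seq column) : seq column * seq column :=
  foldr (fun c acc =>
    if acc.1 is _ :: _ then (acc.1, c :: acc.2)
    else if head 0 c.2 \is a GRing.unit then ([:: c], acc.2)
    else ([::], c :: acc.2)) ([::], [::]) cols.

(** A row operation seen in the column [c]: each later relation loses the multiple of the first one
    that clears its entry in the pivot column [p]. *)
Definition eliminate_col (p c : seq R) : seq R :=
  [seq t.1 - t.2 * (head 0 c / head 0 p) | t <- zip (behead c) (behead p)].

(* Eliminate the first relation, and its pivot if it has a unit coefficient. *)
Definition eliminate_step (cols : seq column) : seq column :=
  if (pivot cols).1 is p :: _
  then [seq (c.1, eliminate_col p.2 c.2) | c <- (pivot cols).2]
  else [seq (c.1, behead c.2) | c <- (pivot cols).2].

(** In the fold [rs] is only a counter: each step consumes one relation, and the labels that survive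
    form the basis. *)
Definition quotient_basis_alg (d n : nat) s : seq (poly_xy * poly_xy) :=
  let rs := relations d n s in
  [seq c.1 | c <- foldl (fun cols _ => eliminate_step cols) (columns n rs) rs].

End Algorithm.

(** * Computability of the algorithm *)

Section AlgorithmComputable.
Let Mon := Prod Nat (Prod Nat Nat).
Let Rel := Prod Poly3 (Prod Poly3 Poly3).
Let Label := Prod Poly2 Poly2.
Let Col := Prod Label (List Scal).
Implicit Types e : ty.

Lemma cp_mons e f : @computable e Nat f ->
  @computable e (List Mon) (fun R x => mons (f R x)).
Proof.
move=> cpf; pose e1 := Prod Nat e; pose e2 := Prod Nat e1.
have cpi : @computable e2 Nat (fun R x => x.2.1).
  exact (cp_comp (cp_fst _ _) (cp_snd _ _)).
have cpf2 : @computable e2 Nat (fun R x => f R x.2.2).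
  exact (cp_comp cpf (cp_comp (cp_snd _ _) (cp_snd _ _))).
have cpj : @computable e2 Nat (fun R x => x.1) := cp_fst _ _.
exact (cp_flatten (cp_map (cp_iota cpf)
  (cp_map (cp_iota (cp_subn (cp_comp cpf (cp_snd _ _)) (cp_fst _ _)))
    (cp_pair cpi (cp_pair cpj (cp_pred (cp_subn cpf2 (cp_addn cpi cpj)))))))).
Qed.

Lemma cp_mulmon e s m : @computable e Poly3 s -> @computable e Mon m ->
  @computable e Poly3 (fun R x => mulmon (s R x) (m R x)).
Proof.
move=> cps cpm; pose e1 := Prod (Prod Scal Mon) e.
have cpc : @computable e1 Scal (fun R x => x.1.1) := cp_comp (cp_fst _ _) (cp_fst _ _).
have cpt : @computable e1 Mon (fun R x => x.1.2) := cp_comp (cp_snd _ _) (cp_fst _ _).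
have cpm1 : @computable e1 Mon (fun R x => m R x.2) := cp_comp cpm (cp_snd _ _).
have cpm2 := cp_comp (cp_snd _ _) cpm1; have cpt2 := cp_comp (cp_snd _ _) cpt.
exact (cp_map cps (cp_pair cpc (cp_pair
  (cp_addn (cp_comp (cp_fst _ _) cpt) (cp_comp (cp_fst _ _) cpm1))
  (cp_pair (cp_addn (cp_comp (cp_fst _ _) cpt2) (cp_comp (cp_fst _ _) cpm2))
    (cp_addn (cp_comp (cp_snd _ _) cpt2) (cp_comp (cp_snd _ _) cpm2)))))).
Qed.

Lemma cp_coefm e s m : @computable e Poly3 s -> @computable e Mon m ->
  @computable e Scal (fun R x => coefm (s R x) (m R x)).
Proof.
move=> cps cpm; pose e1 := Prod (Prod Scal Mon) (Prod Scal e).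
have cpc : @computable e1 Scal (fun R x => x.1.1) := cp_comp (cp_fst _ _) (cp_fst _ _).
have cpt : @computable e1 Mon (fun R x => x.1.2) := cp_comp (cp_snd _ _) (cp_fst _ _).
have cpa : @computable e1 Scal (fun R x => x.2.1) := cp_comp (cp_fst _ _) (cp_snd _ _).
have cpm1 : @computable e1 Mon (fun R x => m R x.2.2).
  exact (cp_comp cpm (cp_comp (cp_snd _ _) (cp_snd _ _))).
have cpm2 := cp_comp (cp_snd _ _) cpm1; have cpt2 := cp_comp (cp_snd _ _) cpt.
have := cp_foldr cps (cp_scal0 e) (cp_if
  (cp_eqn (cp_comp (cp_fst _ _) cpt) (cp_comp (cp_fst _ _) cpm1))
  (cp_if (cp_eqn (cp_comp (cp_fst _ _) cpt2) (cp_comp (cp_fst _ _) cpm2))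
    (cp_if (cp_eqn (cp_comp (cp_snd _ _) cpt2) (cp_comp (cp_snd _ _) cpm2))
      (cp_add cpc cpa) cpa) cpa) cpa).
move/cp_ext; apply=> R x; rewrite /coefm; elim: (s R x) => //= t s' ->.
case: t (m R x) => c [i [j k]] [i' [j' k']] /=; rewrite !xpair_eqE.
by case: (i == i'); case: (j == j'); case: (k == k').
Qed.

Lemma cp_opps e s : @computable e Poly3 s ->
  @computable e Poly3 (fun R x => opps (s R x)).
Proof.
move=> cps; exact (cp_map cps (cp_pair (cp_opp (cp_comp (cp_fst Scal Mon) (cp_fst _ _)))
  (cp_comp (cp_snd _ _) (cp_fst _ _)))).
Qed.

Section Derivatives.
Variables (e : ty) (s : forall R : unitRingType, sem R e -> sem R Poly3).
Hypothesis cps : @computable e Poly3 s.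
Let e1 := Prod (Prod Scal Mon) e.
Let cpc : @computable e1 Scal (fun R x => x.1.1) := cp_comp (cp_fst _ _) (cp_fst _ _).
Let cpt : @computable e1 Mon (fun R x => x.1.2) := cp_comp (cp_snd _ _) (cp_fst _ _).
Let cptX := cp_comp (cp_fst _ _) cpt.
Let cptYZ := cp_comp (cp_snd _ _) cpt.
Let cptY := cp_comp (cp_fst _ _) cptYZ.
Let cptZ := cp_comp (cp_snd _ _) cptYZ.

Lemma cp_derX : @computable e Poly3 (fun R x => derX (s x)).
Proof.
exact (cp_map cps (cp_pair (cp_mulrn cpc cptX) (cp_pair (cp_pred cptX) cptYZ))).
Qed.

Lemma cp_derY : @computable e Poly3 (fun R x => derY (s x)).
Proof.
exact (cp_map cps (cp_pair (cp_mulrn cpc cptY)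
  (cp_pair cptX (cp_pair (cp_pred cptY) cptZ)))).
Qed.

Lemma cp_derZ : @computable e Poly3 (fun R x => derZ (s x)).
Proof.
exact (cp_map cps (cp_pair (cp_mulrn cpc cptZ)
  (cp_pair cptX (cp_pair cptY (cp_pred cptZ))))).
Qed.

End Derivatives.

Let cp_sing e t (b := t) f (cpf : @computable e b f) := cp_cons cpf (cp_nil e b).

Lemma cp_relations : @computable (Prod Nat (Prod Nat Poly3)) (List Rel)
  (fun R x => relations x.1 x.2.1 x.2.2).
Proof.
pose e := Prod Nat (Prod Nat Poly3).
have cpd : @computable e Nat (fun R x => x.1) := cp_fst _ _.
have cpn : @computable e Nat (fun R x => x.2.1) := cp_comp (cp_fst _ _) (cp_snd _ _).
have cps : @computable (Prod Mon e) Poly3 (fun R x => x.2.2.2).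
  exact (cp_comp (cp_comp (cp_snd _ _) (cp_snd _ _)) (cp_snd _ _)).
have cpm : @computable (Prod Mon e) Mon (fun R x => x.1) := cp_fst _ _.
have cpX := cp_comp (cp_fst _ _) cpm; have cpYZ := cp_comp (cp_snd _ _) cpm.
have cpY := cp_comp (cp_fst _ _) cpYZ; have cpZ := cp_comp (cp_snd _ _) cpYZ.
have cp1 := cp_scal1 (Prod Mon e); have cp0 := cp_nil (Prod Mon e) (Prod Scal Mon).
have cpnd := cp_subn cpn cpd.
have cpF := cp_mulmon cps cpm.
have cpFX := cp_mulmon (cp_derX cps) cpm; have cpFY := cp_mulmon (cp_derY cps) cpm.
have cpFZ := cp_mulmon (cp_derZ cps) cpm.
exact (cp_cat (cp_map (cp_mons (cp_pred cpn)) (cp_pair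
    (cp_sing (cp_pair cp1 (cp_pair (cp_comp cp_succ cpX) cpYZ))) (cp_pair
    (cp_sing (cp_pair cp1 (cp_pair cpX (cp_pair (cp_comp cp_succ cpY) cpZ))))
    (cp_sing (cp_pair cp1 (cp_pair cpX (cp_pair cpY (cp_comp cp_succ cpZ))))))))
  (cp_cat (cp_map (cp_mons cpnd) (cp_pair cpF (cp_pair cp0 cp0)))
  (cp_cat (cp_map (cp_mons cpnd) (cp_pair cp0 (cp_pair cpF cp0)))
  (cp_cat (cp_map (cp_mons cpnd) (cp_pair cp0 (cp_pair cp0 cpF)))
  (cp_cat (cp_map (cp_mons (cp_comp cp_succ cpnd))
    (cp_pair cp0 (cp_pair cpFZ (cp_opps cpFY))))
  (cp_cat (cp_map (cp_mons (cp_comp cp_succ cpnd))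
    (cp_pair (cp_opps cpFZ) (cp_pair cp0 cpFX)))
  (cp_map (cp_mons (cp_comp cp_succ cpnd))
    (cp_pair cpFY (cp_pair (cp_opps cpFX) cp0))))))))).
Qed.

Lemma cp_columns e n rs : @computable e Nat n -> @computable e (List Rel) rs ->
  @computable e (List Col) (fun R x => columns (n R x) (rs R x)).
Proof.
move=> cpn cprs; pose e1 := Prod Mon e; pose e2 := Prod Rel e1.
have cpm : @computable e1 Mon (fun R x => x.1) := cp_fst _ _.
have cpm2 : @computable e2 Mon (fun R x => x.2.1) := cp_comp cpm (cp_snd _ _).
have cpr : @computable e2 Rel (fun R x => x.1) := cp_fst _ _.
have cpX := cp_comp (cp_fst _ _) cpm.
have cpY := cp_comp (cp_fst _ _) (cp_comp (cp_snd _ _) cpm).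
have cp1 := cp_scal1 e1; have cpN1 := cp_opp cp1.
have cp0 := cp_nil e1 (Prod Scal (Prod Nat Nat)).
have cpl k : @computable e2 Poly3 k -> @computable e1 (List Scal)
    (fun R x => [seq coefm (k R (y, x)) x.1 | y <- rs R x.2]).
  move=> cpk; exact (cp_map (cp_comp cprs (cp_snd _ _)) (cp_coefm cpk cpm2)).
exact (cp_cat (cp_map (cp_mons cpn) (cp_pair
    (cp_pair cp0 (cp_sing (cp_pair cp1 (cp_pair cpX cpY))))
    (cpl _ (cp_comp (cp_fst _ _) cpr))))
  (cp_cat (cp_map (cp_mons cpn) (cp_pair
    (cp_pair (cp_sing (cp_pair cpN1 (cp_pair cpX cpY))) cp0)
    (cpl _ (cp_comp (cp_fst _ _) (cp_comp (cp_snd _ _) cpr)))))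
  (cp_map (cp_mons cpn) (cp_pair
    (cp_pair (cp_sing (cp_pair cp1 (cp_pair cpX (cp_comp cp_succ cpY))))
      (cp_sing (cp_pair cpN1 (cp_pair (cp_comp cp_succ cpX) cpY))))
    (cpl _ (cp_comp (cp_snd _ _) (cp_comp (cp_snd _ _) cpr))))))).
Qed.

Lemma cp_head e s : @computable e (List Scal) s ->
  @computable e Scal (fun R x => head 0 (s R x)).
Proof.
by move=> cps; exact (cp_listcase cps (cp_scal0 e) (cp_fst _ _)).
Qed.

Lemma cp_behead e s : @computable e (List Scal) s ->
  @computable e (List Scal) (fun R x => behead (s R x)).
Proof.
by move=> cps; exact (cp_listcase cps (cp_nil e _) (cp_comp (cp_fst _ _) (cp_snd _ _))).
Qed.

Lemma cp_pivot e cols : @computable e (List Col) cols ->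
  @computable e (Prod (List Col) (List Col)) (fun R x => pivot (cols R x)).
Proof.
move=> cpcols; pose e1 := Prod Col (Prod (Prod (List Col) (List Col)) e).
have cpc : @computable e1 Col (fun R x => x.1) := cp_fst _ _.
have cpa : @computable e1 (Prod (List Col) (List Col)) (fun R x => x.2.1).
  exact (cp_comp (cp_fst _ _) (cp_snd _ _)).
have cpa1 := cp_comp (cp_fst _ _) cpa; have cpa2 := cp_comp (cp_snd _ _) cpa.
have cpca2 := cp_cons cpc cpa2; have cp0 := cp_nil e1 Col.
have cpok := cp_comp (cp_pair cpa1 cpca2) (cp_comp (cp_snd _ _) (cp_snd Col (Prod (List Col) e1))).
have := cp_foldr cpcols (cp_pair (cp_nil e Col) (cp_nil e Col))
  (cp_listcase cpa1 (cp_if (cp_unit (cp_head (cp_comp (cp_snd _ _) cpc)))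
    (cp_pair (cp_sing cpc) cpa2) (cp_pair cp0 cpca2)) cpok).
move/cp_ext; apply=> R x; rewrite /pivot; elim: (cols R x) => //= c s ->.
by case: (foldr _ _ _) => -[|p p'] r //=; case: (_ \is a GRing.unit).
Qed.

Lemma cp_eliminate_step e cols : @computable e (List Col) cols ->
  @computable e (List Col) (fun R x => eliminate_step (cols R x)).
Proof.
move=> cpcols; have cpp := cp_pivot cpcols.
have cpr := cp_comp (cp_snd _ _) cpp.
pose e1 := Prod Col (Prod (List Col) e); pose e2 := Prod Col e1.
have cplab : @computable e2 Label (fun R x => x.1.1) := cp_comp (cp_fst _ _) (cp_fst _ _).
have cpc : @computable e2 (List Scal) (fun R x => x.1.2).
  exact (cp_comp (cp_snd _ _) (cp_fst _ _)).
have cpq : @computable e2 (List Scal) (fun R x => x.2.1.2).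
  exact (cp_comp (cp_comp (cp_snd _ _) (cp_fst _ _)) (cp_snd _ _)).
have cpelim : @computable e2 (List Scal) (fun R x => eliminate_col x.2.1.2 x.1.2).
  have cpr1 := cp_comp (cp_mul (cp_head cpc) (cp_inv (cp_head cpq)))
    (cp_snd (Prod Scal Scal) e2).
  exact (cp_map (cp_zip (cp_behead cpc) (cp_behead cpq))
    (cp_add (cp_comp (cp_fst _ _) (cp_fst _ _))
       (cp_opp (cp_mul (cp_comp (cp_snd _ _) (cp_fst _ _)) cpr1)))).
have cpr1 : @computable e1 (List Col) (fun R x => (pivot (cols R x.2.2)).2).
  exact (cp_comp cpr (cp_comp (cp_snd _ _) (cp_snd _ _))).
exact (cp_listcase (cp_comp (cp_fst _ _) cpp)
  (cp_map cpr (cp_pair (cp_comp (cp_fst _ _) (cp_fst _ _))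
     (cp_behead (cp_comp (cp_snd Label (List Scal)) (cp_fst _ _)))))
  (cp_map cpr1 (cp_pair cplab cpelim))).
Qed.

Lemma computable_quotient_basis :
  @computable (Prod Nat (Prod Nat Poly3)) (List Label)
    (fun R x => quotient_basis_alg x.1 x.2.1 x.2.2).
Proof.
have cpcols := cp_columns (cp_comp (cp_fst _ _) (cp_snd Nat (Prod Nat Poly3))) cp_relations.
exact (cp_map (cp_foldl cp_relations cpcols
  (cp_eliminate_step (cp_comp (cp_fst _ _) (cp_snd Rel _))))
  (cp_comp (cp_fst Label (List Scal)) (cp_fst _ _))).
Qed.

End AlgorithmComputable.

(** * Correctness of the elimination *)

Section Elimination.
Variables (R : idomainType) (V : lmodType R) (N N2 : V -> Prop).
Hypothesis valR : valuation_domain R.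
Hypotheses (N_D : forall u v, N u -> N v -> N (u + v)).
Hypothesis N_Z : forall (c : R) u, N u -> N (c *: u).

Local Notation label := (seq (R * (nat * nat)) * seq (R * (nat * nat)))%type.
Local Notation column := (label * seq R)%type.
Variables (I : eqType) (lab : I -> label) (g : I -> V).
Implicit Types (L : seq I) (col : I -> seq R).

Definition elim_state L col : seq column := [seq (lab i, col i) | i <- L].

Lemma pivotP L col :
  (pivot (elim_state L col) = ([::], elim_state L col) /\
    forall i, i \in L -> head 0 (col i) \isn't a GRing.unit) \/
  exists L1 p L2, [/\ L = L1 ++ p :: L2, head 0 (col p) \is a GRing.unit &
    pivot (elim_state L col) = ([:: (lab p, col p)], elim_state (L1 ++ L2) col)].
Proof.
elim: L => [|i L [[IH NL]|[L1 [p [L2 [-> Up IH]]]]]] /=; first by left.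
- rewrite IH /=; case: (boolP (head 0 (col i) \is a GRing.unit)) => [Ui|Ni].
    by right; exists [::], i, L.
  by left; split=> // k; rewrite inE => /predU1P[->|/NL].
- by right; exists (i :: L1), p, L2; rewrite IH.
Qed.

(* [col i] lists the coefficients of [g i] in [k] relations. These, together
   with relations with nonunit coefficients, generate all relations. *)
Definition elim_inv k L col : Prop :=
  [/\ uniq L, forall i, i \in L -> size (col i) = k,
      forall u, N2 u -> exists c : I -> R, N (u - \sum_(i <- L) c i *: g i),
      forall c : I -> R, N (\sum_(i <- L) c i *: g i) ->
        exists a : nat -> R, forall i, i \in L ->
          c i - \sum_(j < k) a j * (col i)`_j \isn't a GRing.unit &
      forall j, (j < k)%N -> N (\sum_(i <- L) (col i)`_j *: g i)].

Lemma elim_inv_step k L col : elim_inv k.+1 L col -> exists L' col',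
  [/\ eliminate_step (elim_state L col) = elim_state L' col',
      elim_inv k L' col' & {subset L' <= L}].
Proof.
move=> [uL szL genL relL N_L]; rewrite /eliminate_step.
case: (pivotP L col) => [[-> NL]|[L1 [p [L2 [DL Up ->]]]]] /=.
  (* Without a pivot, dropping the relation alters each coefficient by a nonunit, which the
     invariant tolerates. *)
  exists L, (fun i => behead (col i)); split=> //; first by rewrite -map_comp.
  split=> // [i iL|c /relL[a Na]|j lt_jk].
  - by rewrite size_behead szL.
  - exists (fun j => a j.+1) => i iL; have := Na i iL; rewrite big_ord_recl.
    rewrite opprD addrA addrAC => Ni.
    have := nonunitD valR Ni (nonunitMr (a 0%N) (NL i iL)).
    rewrite -nth0 subrK; congr (~~ (_ - _ \is a GRing.unit)).
    by apply: eq_bigr => j _; rewrite nth_behead.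
  - have := N_L j.+1 lt_jk; congr N.
    by apply: eq_bigr => i _; rewrite nth_behead.
pose L' := L1 ++ L2; pose h i := (col i)`_0; pose q i := h i / h p.
have hp : h p \is a GRing.unit by rewrite /h nth0.
have permL : perm_eq L (p :: L') by rewrite DL perm_catC /= perm_cons perm_catC.
have pNL' : p \notin L' by have := uL; rewrite (perm_uniq permL) => /andP[].
have sL' : {subset L' <= L} by move=> i iL'; rewrite (perm_mem permL) inE iL' orbT.
have pL : p \in L by rewrite (perm_mem permL) inE eqxx.
have N_0 : N (\sum_(i <- L) h i *: g i) by apply: N_L.
have colE j i : i \in L -> (j < k)%N ->
    (eliminate_col (col p) (col i))`_j = (col i)`_j.+1 - (col p)`_j.+1 * q i.
  move=> iL lt_jk; rewrite (nth_map (0, 0)) ?size_zip ?size_behead ?szL //=.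
    by rewrite nth_zip ?size_behead ?szL //= !nth_behead /q /h !nth0.
  by rewrite minnn.
have sumL (c : I -> R) x : \sum_(i <- L) c i *: g i - (x * (h p)^-1) *: (\sum_(i <- L) h i *: g i) =
    (c p - x) *: g p + \sum_(i <- L') (c i - x * q i) *: g i.
  rewrite scaler_sumr -sumrB (perm_big _ permL) big_cons /=; congr (_ + _).
    by rewrite scalerA mulrVK // scalerBl.
  by apply: eq_bigr => i _; rewrite scalerA scalerBl /q -mulrA [_^-1 * _]mulrC.
exists L', (fun i => eliminate_col (col p) (col i)); split=> //.
  by rewrite /elim_state -map_comp.
split=> [|i iL'|u /genL[c Nc]|c Nc|j lt_jk].
- by have := uL; rewrite (perm_uniq permL) => /andP[].
- by rewrite size_map size_zip !size_behead !szL ?minnn // sL'.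
- exists (fun i => c i - c p * q i).
  have := sumL c (c p); rewrite subrr scale0r add0r => <-.
  by rewrite opprB addrA addrAC; apply: N_D (N_Z _ N_0).
(* A relation among the remaining generators has coefficient 0 at [p]; its expansion there,
   multiplied by [- q i], eliminates the coefficient [a 0] modulo nonunits. *)
- pose c0 i := if i == p then 0 else c i.
  have [|a Na] := relL c0.
    rewrite (perm_big _ permL) big_cons /c0 eqxx scale0r /= add0r.
    move: Nc; congr N; apply: eq_big_seq => i iL'.
    by case: eqP iL' => // ->; rewrite (negPf pNL').
  exists (fun j => a j.+1) => i iL'.
  have := nonunitD valR (Na i (sL' i iL')) (nonunitMr (- q i) (Na p pL)).
  rewrite /c0 eqxx (negPf (_ : i != p)); last by apply: contraNneq pNL' => <-.
  congr (~~ (_ \is a GRing.unit)).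
  rewrite sub0r mulrNN [X in _ * X]big_ord_recl [X in c i - X]big_ord_recl /=.
  have -> : \sum_(j < k) a j.+1 * (eliminate_col (col p) (col i))`_j =
      \sum_(j < k) a j.+1 * (col i)`_j.+1 - q i * \sum_(j < k) a j.+1 * (col p)`_j.+1.
    rewrite mulr_sumr -sumrB; apply: eq_bigr => j _.
    by rewrite colE ?sL' //; ring.
  rewrite -/(h i) -/(h p).
  have -> : a 0%N * h i = q i * (a 0%N * h p).
    by rewrite /q mulrCA divrK.
  by ring.
- have := sumL (fun i => (col i)`_j.+1) (col p)`_j.+1.
  rewrite subrr scale0r add0r => eq_sum.
  rewrite (eq_big_seq (fun i => ((col i)`_j.+1 - (col p)`_j.+1 * q i) *: g i)).
    by rewrite -eq_sum -scaleNr; apply: N_D (N_Z _ N_0); apply: N_L.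
  by move=> i iL'; rewrite colE ?sL'.
Qed.

Lemma elim_inv_loop (T : Type) (s : seq T) L col : elim_inv (size s) L col ->
  exists L' col', [/\ foldl (fun cols _ => eliminate_step cols) (elim_state L col) s
      = elim_state L' col', elim_inv 0 L' col' & {subset L' <= L}].
Proof.
elim: s L col => [|x s IH] L col /=; first by move=> inv; exists L, col; split.
move=> /elim_inv_step[L1 [col1 [-> inv1 sL1]]].
have [L' [col' [-> inv' sL']]] := IH _ _ inv1.
by exists L', col'; split=> // i /sL' /sL1.
Qed.

(* A vector of coordinates of a relation has nonunit entries; were it nonzero,
   it could be divided by the entry of least valuation. *)
Lemma elim_inv0_free L col :
  (forall (c : R) u, c != 0 -> N (c *: u) -> N2 u -> N u) ->
  (forall c, N2 (\sum_(i <- L) c i *: g i)) ->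
  elim_inv 0 L col ->
  forall c, N (\sum_(i <- L) c i *: g i) -> forall i, i \in L -> c i = 0.
Proof.
move=> satN N2g [uL _ _ relL _] c Nc i iL.
have [|k kL [q Dq]] := dvd_all valR (s := L) c; first by case: (L) iL.
have [ck0|ck_n0] := eqVneq (c k) 0; first by rewrite Dq // ck0 mulr0.
pose q1 l := if l == k then 1 else q l.
have [|a /(_ k kL)] := relL q1.
  apply: (satN (c k)) => //; move: Nc; congr N.
  rewrite scaler_sumr; apply: eq_big_seq => l lL; rewrite scalerA /q1.
  by case: eqP => [->|_]; rewrite ?mulr1 // mulrC -Dq.
by rewrite big_ord0 subr0 /q1 eqxx unitr1.
Qed.

Lemma quotient_basis_of_elim (i0 : I) L col :
  (forall i, i \in L -> N2 (g i)) ->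
  (forall (c : R) u, c != 0 -> N (c *: u) -> N2 u -> N u) ->
  (forall c, N2 (\sum_(i <- L) c i *: g i)) ->
  elim_inv 0 L col -> quotient_basis N N2 [seq g i | i <- L].
Proof.
move=> N2L satN N2g inv; have [uL _ genL _ _] := inv.
set b := map g L.
have sum_b (c : 'I_(size b) -> R) (C : I -> R) :
    (forall k, c k = C (nth i0 L k)) ->
    \sum_k c k *: b`_k = \sum_(i <- L) C i *: g i.
  move=> Dc; rewrite (big_nth i0) big_mkord -(size_map g).
  by apply: eq_bigr => k _; rewrite Dc (nth_map i0) // -(size_map g).
split=> [v /mapP[i iL ->]|v /genL[C NC]|c Nc k]; first exact: N2L.
  by exists (fun k => C (nth i0 L k)); rewrite (sum_b _ C).
pose C i := if insub (index i L) is Some k then c k else 0.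
have Dc l : c l = C (nth i0 L l).
  by rewrite /C index_uniq // -?(size_map g) // valK.
rewrite Dc; apply: (elim_inv0_free satN N2g inv); first by rewrite -(sum_b c).
by rewrite mem_nth // -(size_map g).
Qed.

End Elimination.

(** * Term lists *)

Section TermLists.
Variable R : idomainType.
Local Notation T := {mpoly R[3]}.
Local Notation poly := (seq (R * mon)).
Implicit Types (s : poly) (m : mon) (r : poly * (poly * poly)) (p : T).

Definition mnm3 m : 'X_{1..3} :=
  [multinom match val i with 0 => m.1 | 1 => m.2.1 | _ => m.2.2 end | i < 3].

Definition mon_of (m : 'X_{1..3}) : mon := (m iX, (m iY, m iZ)).

Lemma mon_ofK : cancel mon_of mnm3.
Proof. by move=> m; apply/mnmP; elim/ord3_ind; rewrite mnmE. Qed.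

Lemma mnm3K : cancel mnm3 mon_of.
Proof. by move=> [i [j k]]; rewrite /mon_of /mnm3 !mnmE. Qed.

Lemma mdeg_mnm3 m : mdeg (mnm3 m) = (m.1 + m.2.1 + m.2.2)%N.
Proof. by rewrite mdeg3E !mnmE. Qed.

Lemma poly3E s : poly3 s = \sum_(t <- s) t.1 *: 'X_[mnm3 t.2].
Proof. by apply: eq_bigr => t _; rewrite (mpolyX3E _ (mnm3 _)) !mnmE. Qed.

Lemma coefmE s m : coefm s m = (poly3 s)@_(mnm3 m).
Proof.
rewrite poly3E; elim: s => [|t s IH]; first by rewrite big_nil mcoeff0.
rewrite big_cons mcoeffD mcoeffZ mcoeffX (can_eq mnm3K) /= IH.
by case: eqP => _; rewrite ?mulr1 ?mulr0 ?add0r.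
Qed.

Lemma poly3_mulmon s m : poly3 (mulmon s m) = poly3 s * 'X_[mnm3 m].
Proof.
rewrite !poly3E big_map mulr_suml; apply: eq_bigr => t _ /=.
rewrite -scalerAl -mpolyXD; congr (_ *: 'X_[_]); apply/mnmP.
by elim/ord3_ind; rewrite !mnmE.
Qed.

Lemma poly3_opps s : poly3 (opps s) = - poly3 s.
Proof.
rewrite !poly3E big_map -sumrN; apply: eq_bigr => t _ /=.
by rewrite scaleNr.
Qed.

Lemma poly3_der s :
  [/\ poly3 (derX s) = (poly3 s)^`M(iX), poly3 (derY s) = (poly3 s)^`M(iY) &
      poly3 (derZ s) = (poly3 s)^`M(iZ)].
Proof.
have der i (f : R * mon -> R * mon) :
    (forall t, (f t).1 = t.1 *+ mnm3 t.2 i) ->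
    (forall t, mnm3 (f t).2 = (mnm3 t.2 - U_(i))%MM) ->
    poly3 [seq f t | t <- s] = (poly3 s)^`M(i).
  move=> f1 f2; rewrite !poly3E big_map (@linear_sum _ _ _ _ (mderiv i)).
  apply: eq_bigr => t _; rewrite /= mderivZ mderivX scalerA -f2 f1.
  by rewrite mulr_natr.
by split; apply: der => t; rewrite ?mnmE //; apply/mnmP; elim/ord3_ind;
  rewrite !(mnmBE, mnmE, mnm1E) ?subn1 ?subn0.
Qed.

Lemma mem_mons e m : (m \in mons e) = ((m.1 + m.2.1 + m.2.2).+1 == e)%N.
Proof.
apply/allpairsPdep/eqP => [[i [j [+ + ->]]]|].
  by rewrite !mem_iota /=; lia.
case: m => i [j k] /= De; exists i, j; rewrite !mem_iota /=; split; try lia.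
by congr (_, (_, _)); lia.
Qed.

Lemma mons_uniq e : uniq (mons e).
Proof.
apply: allpairs_uniq_dep => [|i _|]; rewrite ?iota_uniq //.
by move=> [i j] [i' j'] _ _ /= [-> ->].
Qed.

Lemma mons_sum e p : (forall m : 'X_{1..3}, p@_m != 0 -> (mdeg m).+1 = e) ->
  p = \sum_(m <- mons e) p@_(mnm3 m) *: 'X_[mnm3 m].
Proof.
move=> hp; apply/mpolyP => m; rewrite raddf_sum /=.
have [m_e|mNe] := boolP (mon_of m \in mons e).
  rewrite (bigD1_seq (mon_of m)) ?mons_uniq //= mon_ofK mcoeffZ mcoeffX eqxx mulr1.
  rewrite big1 ?addr0 // => m' ne_m; rewrite mcoeffZ mcoeffX.
  by case: (mnm3 m' =P m) ne_m => [<-|_ _]; rewrite ?mnm3K ?eqxx ?mulr0.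
rewrite big_seq big1 => [|m' m'_e].
  apply/eqP; apply: contraNT mNe => pm.
  by rewrite mem_mons -(hp _ pm) mdeg3E.
rewrite mcoeffZ mcoeffX; case: eqP => [Dm|]; last by rewrite mulr0.
by rewrite -Dm mnm3K m'_e in mNe.
Qed.

Lemma dhomog_mons n p : (0 < n)%N -> p \is n.-1.-homog ->
  p = \sum_(m <- mons n) p@_(mnm3 m) *: 'X_[mnm3 m].
Proof.
move=> n_gt0 /dhomogP hp; apply: mons_sum => m pm.
by have /= -> := hp m; rewrite ?mcoeff_msupp // prednK.
Qed.

Lemma mons_homog n m : m \in mons n -> ('X_[mnm3 m] : T) \is n.-1.-homog.
Proof. by rewrite mem_mons => /eqP <-; rewrite dhomogX /= mdeg_mnm3. Qed.

(** * The initial columns *)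

Definition rel_vec r (k : 'I_3) : T :=
  match val k with 0 => poly3 r.1 | 1 => poly3 r.2.1 | _ => poly3 r.2.2 end.

Definition gen_vec (i : 'I_3 * mon) (l : 'I_3) : T := 'X_[mnm3 i.2] * unitv T i.1 l.

Definition gen_index n : seq ('I_3 * mon) :=
  [seq (iX, m) | m <- mons n] ++ ([seq (iY, m) | m <- mons n] ++
  [seq (iZ, m) | m <- mons n]).

Definition gen_label (i : 'I_3 * mon) :
    seq (R * (nat * nat)) * seq (R * (nat * nat)) :=
  let m := i.2 in
  match val i.1 with
  | 0 => ([::], [:: (1, (m.1, m.2.1))])
  | 1 => ([:: (-1, (m.1, m.2.1))], [::])
  | _ => ([:: (1, (m.1, m.2.1.+1))], [:: (-1, (m.1.+1, m.2.1))])
  end.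

Definition gen_col (rs : seq (poly * (poly * poly))) (i : 'I_3 * mon) : seq R :=
  [seq (rel_vec r i.1)@_(mnm3 i.2) | r <- rs].

Lemma columnsE n rs :
  columns n rs = elim_state gen_label (gen_index n) (gen_col rs).
Proof.
rewrite /elim_state !map_cat -!map_comp /columns /gen_col.
by congr (_ ++ (_ ++ _)); apply: eq_map => m; congr (_, _); apply: eq_map => r;
  rewrite coefmE.
Qed.

Lemma gen_index_uniq n : uniq (gen_index n).
Proof.
rewrite !cat_uniq !map_inj_uniq ?mons_uniq /=; try by move=> m m' [].
apply/and3P; split=> //; apply/hasPn => i; rewrite ?mem_cat => /=.
  by case/orP=> /mapP[m _ ->]; apply/mapP => -[].
by case/mapP=> m _ ->; apply/mapP => -[].
Qed.

Lemma mem_gen_index n i : (i \in gen_index n) = (i.2 \in mons n).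
Proof.
case: i => k m; rewrite !mem_cat /=; apply/or3P/idP => [[]|m_n].
1-3: by case/mapP=> m' + [_ ->].
by elim/ord3_ind: k; [apply: Or31|apply: Or32|apply: Or33]; apply: map_f.
Qed.

Lemma sum_gen_index (V : nmodType) n (f : 'I_3 * mon -> V) :
  \sum_(i <- gen_index n) f i = \sum_k \sum_(m <- mons n) f (k, m).
Proof. by rewrite !big_cat !big_map sum3E /= addrA. Qed.

End TermLists.

(** * Combinations of the listed relations *)

Section RelationSpan.
Variable R : idomainType.
Local Notation T := {mpoly R[3]}.
Local Notation poly := (seq (R * mon)).
Local Notation E := (fun k : 'I_3 => 'X_k : T).
Implicit Types (rs : seq (poly * (poly * poly))) (v w : 'I_3 -> T).

Definition rel_span rs v : Prop :=
  exists2 a : seq R, size a = size rs &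
    forall l, v l = \sum_(t <- zip a rs) t.1 *: rel_vec t.2 l.

Lemma rel_span_cat rs rs' v w : rel_span rs v -> rel_span rs' w ->
  rel_span (rs ++ rs') (fun l => v l + w l).
Proof.
move=> [a sz_a Dv] [b sz_b Dw]; exists (a ++ b); first by rewrite !size_cat sz_a sz_b.
by move=> l; rewrite zip_cat // big_cat Dv Dw.
Qed.

Lemma rel_span_family (f : mon -> poly * (poly * poly)) w e (p : T) :
  (forall m l, rel_vec (f m) l = 'X_[mnm3 m] * w l) ->
  p = \sum_(m <- mons e) p@_(mnm3 m) *: 'X_[mnm3 m] ->
  rel_span [seq f m | m <- mons e] (fun l => p * w l).
Proof.
move=> Df Dp; exists [seq p@_(mnm3 m) | m <- mons e]; first by rewrite !size_map.
move=> l; rewrite {1}Dp mulr_suml.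
elim: (mons e) => [|m s IH]; first by rewrite !big_nil.
by rewrite /= !big_cons IH Df scalerAl.
Qed.

Variables (d n : nat) (s : poly).
Local Notation F := (poly3 s).
Local Notation DF := (fun k : 'I_3 => F^`M(k)).

Definition rel_E m : poly * (poly * poly) :=
  ([:: (1, (m.1.+1, m.2))], ([:: (1, (m.1, (m.2.1.+1, m.2.2)))],
     [:: (1, (m.1, (m.2.1, m.2.2.+1)))])).

Lemma rel_vecE m l : rel_vec (rel_E m) l = 'X_[mnm3 m] * 'X_l.
Proof.
elim/ord3_ind: l; rewrite /rel_vec /= poly3E big_seq1 scale1r -mpolyXD;
by congr 'X_[_]; apply/mnmP; elim/ord3_ind; rewrite !(mnmDE, mnmE, mnm1E) ?addn0 ?addn1.
Qed.

Definition rel_F (k : 'I_3) m : poly * (poly * poly) :=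
  match val k with
  | 0 => (mulmon s m, ([::], [::]))
  | 1 => ([::], (mulmon s m, [::]))
  | _ => ([::], ([::], mulmon s m))
  end.

Let poly3_nil : poly3 (R := R) [::] = 0 := big_nil _ _ _ _.

Lemma rel_vecF (k : 'I_3) m l : rel_vec (rel_F k m) l = 'X_[mnm3 m] * (F * unitv T k l).
Proof.
elim/ord3_ind: k; elim/ord3_ind: l; rewrite /rel_vec /rel_F /unitv /= ?poly3_nil;
by rewrite ?poly3_mulmon ?mulr1 ?mulr0 // mulrC.
Qed.

Definition rel_J (k : 'I_3) m : poly * (poly * poly) :=
  match val k with
  | 0 => ([::], (mulmon (derZ s) m, opps (mulmon (derY s) m)))
  | 1 => (opps (mulmon (derZ s) m), ([::], mulmon (derX s) m))
  | _ => (mulmon (derY s) m, (opps (mulmon (derX s) m), [::]))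
  end.

Lemma rel_vecJ (k : 'I_3) m l :
  rel_vec (rel_J k m) l = 'X_[mnm3 m] * cross DF (unitv T k) l.
Proof.
have [dX dY dZ] := poly3_der s.
elim/ord3_ind: k; elim/ord3_ind: l; rewrite /rel_vec /rel_J /cross /unitv /= ?poly3_nil;
by rewrite ?poly3_opps ?poly3_mulmon ?dX ?dY ?dZ; ring.
Qed.

Lemma relationsE : relations d n s =
  [seq rel_E m | m <- mons n.-1] ++ ([seq rel_F iX m | m <- mons (n - d)] ++
  ([seq rel_F iY m | m <- mons (n - d)] ++ ([seq rel_F iZ m | m <- mons (n - d)] ++
  ([seq rel_J iX m | m <- mons (n - d).+1] ++ ([seq rel_J iY m | m <- mons (n - d).+1]
  ++ [seq rel_J iZ m | m <- mons (n - d).+1]))))).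
Proof. by []. Qed.

Lemma relation_cases r : r \in relations d n s ->
  [\/ exists2 m, m \in mons n.-1 & r = rel_E m,
      exists k : 'I_3, exists2 m, m \in mons (n - d) & r = rel_F k m |
      exists k : 'I_3, exists2 m, m \in mons (n - d).+1 & r = rel_J k m].
Proof.
rewrite relationsE !mem_cat; case/or4P=> [|||/or4P[]] /mapP[m m_e ->].
- by apply: Or31; exists m.
- by apply: Or32; exists iX, m.
- by apply: Or32; exists iY, m.
- by apply: Or32; exists iZ, m.
- by apply: Or33; exists iX, m.
- by apply: Or33; exists iY, m.
- by apply: Or33; exists iZ, m.
Qed.

Lemma rel_span_relations v (c r : 'I_3 -> T) (q : T) :
  (forall k, c k \is (n - d)%N.-homog) ->
  (forall k (m : 'X_{1..3}), (r k)@_m != 0 -> (mdeg m).+1 = (n - d)%N) ->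
  (forall m : 'X_{1..3}, q@_m != 0 -> (mdeg m).+1 = n.-1) ->
  (forall l, v l = 'X_l * q + F * r l + jac_vector F c l) ->
  rel_span (relations d n s) v.
Proof.
move=> hc hr hq Dv; rewrite relationsE.
have spanF k := rel_span_family (rel_vecF k) (mons_sum (hr k)).
have spanJ k := rel_span_family (rel_vecJ k) (dhomog_mons (ltn0Sn (n - d)) (hc k)).
have spanE := rel_span_family rel_vecE (mons_sum hq).
have [a sz_a Da] := rel_span_cat spanE (rel_span_cat (spanF iX) (rel_span_cat
  (spanF iY) (rel_span_cat (spanF iZ) (rel_span_cat (spanJ iX)
  (rel_span_cat (spanJ iY) (spanJ iZ)))))).
exists a => // l; rewrite Dv -Da /jac_vector sum3E.
have -> : r l = r iX * unitv T iX l + r iY * unitv T iY l + r iZ * unitv T iZ l.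
  by elim/ord3_ind: l; rewrite /unitv /= ?mulr1 ?mulr0 ?addr0 ?add0r.
by ring.
Qed.

End RelationSpan.

(** * Correctness of the computed basis *)

Section Basis.
Variables (R : idomainType) (d n : nat) (A : comAlgType R).
Variable pi : {lrmorphism {mpoly R[2]} -> A}.
Variable s : seq (R * mon).
Local Notation T := {mpoly R[3]}.
Local Notation E := (fun k : 'I_3 => 'X_k : T).
Local Notation psi := (to_affine pi).
Local Notation F := (poly3 s).
Hypotheses (d_gt0 : (0 < d)%N) (hF : F \is d.-homog) (le_dn : (d <= n)%N).
Hypothesis NdvdF : ~ exists a, F = 'X_iZ * a.
Hypothesis coordA : is_coordinate_ring F pi.
Hypothesis irrF : jacobian_irrelevant F.
Hypothesis smoothA : exists a b : A, a * psi F^`M(iX) + b * psi F^`M(iY) = 1.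
Hypotheses (valR : valuation_domain R) (primF : primitive_mpoly F).

Local Notation N := (fun u => exists2 a, M1 pi d n a & u = mul_df F pi a).
Local Notation g := (fun i => form_of pi (gen_vec R i)).

Let n_gt0 : (0 < n)%N := leq_trans d_gt0 le_dn.

Lemma relation_homog r k : r \in relations d n s -> rel_vec r k \is n.-1.-homog.
Proof.
case/relation_cases=> [[m m_e ->]|[j [m m_e ->]]|[j [m m_e ->]]].
- have := mons_homog R m_e; rewrite rel_vecE mulrC => hm.
  have := dhomogXUM k hm; rewrite prednK //.
  by move: m_e; rewrite mem_mons; lia.
- rewrite rel_vecF mulrCA; have hm := mons_homog R m_e.
  have -> : (n.-1 = d + (n - d).-1)%N by move: m_e; rewrite mem_mons; lia.
  apply: dhomogM hF _; rewrite /unitv mulrC.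
  by case: eqP; rewrite ?mul1r ?mul0r ?dhomog0.
- rewrite rel_vecJ; have hm := mons_homog R m_e.
  have -> : (n.-1 = (n - d) + d.-1)%N by lia.
  apply: dhomogM hm _; elim/ord3_ind: k; rewrite /cross /unitv;
  by rewrite rpredB // mulrC; case: eqP; rewrite ?mul1r ?mul0r ?dhomog0 ?mderiv_homog.
Qed.

Lemma N_0 : N 0.
Proof.
exists 0; first by apply/M1P; exists 0; rewrite ?dhomog0 ?rmorph0.
by rewrite /mul_df !mul0r.
Qed.

(** The relations in [E] and in [F] give the zero form; the one built from the gradient and the j-th
    basis vector gives df times ['X_[mnm3 m] * 'X_j]. *)
Lemma relation_N r : r \in relations d n s -> N (form_of pi (rel_vec r)).
Proof.
case/relation_cases=> [[m m_e ->]|[j [m m_e ->]]|[j [m m_e ->]]].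
- rewrite (form_of_eq _ (v := fun k => 'X_k * 'X_[mnm3 m])) ?form_ofXs; first exact: N_0.
  by move=> k; rewrite rel_vecE mulrC.
- rewrite (form_of_eq _ (v := fun k => F * ('X_[mnm3 m] * unitv T j k))).
    by rewrite (form_ofFr coordA); apply: N_0.
  by move=> k; rewrite rel_vecF mulrCA.
- pose c k := 'X_[mnm3 m] * unitv T j k.
  exists (psi (\sum_k 'X_k * c k)).
    apply/M1P; exists (\sum_k 'X_k * c k) => //.
    rewrite rpred_sum // => k _; rewrite (_ : n + 1 - d = (n - d).+1)%N; last by lia.
    apply: dhomogXUM; rewrite /c /unitv mulrC.
    by case: eqP; rewrite ?mul1r ?mul0r ?dhomog0 // (mons_homog R m_e).
  rewrite -(form_of_jac_vector hF coordA); apply: form_of_eq => l.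
  rewrite rel_vecJ /jac_vector (bigD1 j) //= big1 => [|k ne_k].
    by rewrite /c /unitv eqxx mulr1 addr0.
  by rewrite /c /unitv eq_sym (negPf ne_k) mulr0 mul0r.
Qed.

Lemma N_D u v : N u -> N v -> N (u + v).
Proof.
move=> [a Ma ->] [b Mb ->]; exists (a + b); first exact: RspanD.
by rewrite /mul_df !mulrDl.
Qed.

Lemma N_Z (c : R) u : N u -> N (c *: u).
Proof.
move=> [a Ma ->]; exists (c *: a); first exact: RspanZ.
by rewrite /mul_df -!scalerAl.
Qed.

Lemma gen_vec_homog i k : i \in gen_index n -> gen_vec R i k \is n.-1.-homog.
Proof.
rewrite mem_gen_index => /(mons_homog R) hm; rewrite /gen_vec /unitv mulrC.
by case: eqP; rewrite ?mul1r ?mul0r ?dhomog0.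
Qed.

Lemma M2_gen i : i \in gen_index n -> M2 pi n (g i).
Proof.
move=> i_n; apply/M2P => //; exists (gen_vec R i) => // k.
exact: gen_vec_homog.
Qed.

Lemma sum_gen (c : 'I_3 * mon -> R) :
  \sum_(i <- gen_index n) c i *: g i =
  form_of pi (fun k => \sum_(m <- mons n) c (k, m) *: 'X_[mnm3 m]).
Proof.
rewrite -form_of_sum; apply: form_of_eq => l; rewrite sum_gen_index (bigD1 l) //=.
rewrite [X in _ + X]big1 => [|k ne_k].
  rewrite addr0; apply: eq_bigr => m _.
  by rewrite /gen_vec /unitv eqxx mulr1.
rewrite big1 // => m _.
by rewrite /gen_vec /unitv (negPf ne_k) mulr0 scaler0.
Qed.

Lemma form_of_gen v : (forall k, v k \is n.-1.-homog) ->
  form_of pi v = \sum_(i <- gen_index n) (v i.1)@_(mnm3 i.2) *: g i.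
Proof.
move=> hv; rewrite (sum_gen (fun i => (v i.1)@_(mnm3 i.2))).
by apply: form_of_eq => k; apply: dhomog_mons.
Qed.

(** At the start every relation is an exact combination of the listed ones, so the differences in
    the invariant are 0, a nonunit. *)
Lemma initial_elim_inv : elim_inv N (M2 pi n) g (size (relations d n s))
  (gen_index n) (gen_col (relations d n s)).
Proof.
set rs := relations d n s; split.
- exact: gen_index_uniq.
- by move=> i _; rewrite size_map.
- move=> u /(M2P _ _ n_gt0)[v hv ->]; exists (fun i => (v i.1)@_(mnm3 i.2)).
  by rewrite -form_of_gen // subrr; apply: N_0.
- move=> c; rewrite sum_gen; set v := (fun k : 'I_3 => _) => Nv.
  have hv k : v k \is n.-1.-homog.
    rewrite /v big_seq rpred_sum // => m m_n.
    by rewrite rpredZ ?(mons_homog R m_n).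
  have [c' [r [q [hc hr hq Dv]]]] := form_of_relation d_gt0 hF NdvdF coordA le_dn hv Nv.
  have [a sz_a Da] := rel_span_relations hc hr hq Dv.
  exists (nth 0 a) => -[k m] km_n; suff -> : c (k, m) =
      \sum_(j < size rs) a`_j * (gen_col rs (k, m))`_j by rewrite subrr unitr0.
  have -> : c (k, m) = (v k)@_(mnm3 m).
    rewrite mem_gen_index /= in km_n.
    rewrite /v raddf_sum (bigD1_seq m) ?mons_uniq //= mcoeffZ mcoeffX eqxx mulr1.
    rewrite big1 ?addr0 // => m' ne_m.
    by rewrite mcoeffZ mcoeffX (can_eq mnm3K) (negPf ne_m) mulr0.
  rewrite Da raddf_sum (big_nth (0, ([::], ([::], [::])))) big_mkord size_zip.
  rewrite sz_a minnn; apply: eq_bigr => j _.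
  by rewrite nth_zip //= mcoeffZ (nth_map ([::], ([::], [::]))).
- move=> j lt_j; pose r := nth ([::], ([::], [::])) rs j.
  have r_rs : r \in rs by apply: mem_nth.
  have := relation_N r_rs; rewrite form_of_gen => [|k]; last exact: relation_homog.
  congr N; apply: eq_bigr => i _.
  by rewrite (nth_map ([::], ([::], [::]))).
Qed.

(** The differentials of A are torsion free, and a multiple of df lying in M_2 comes from M_1. *)
Lemma N_saturated (c : R) u : c != 0 -> N (c *: u) -> M2 pi n u -> N u.
Proof.
move=> c0 [a _ Da] /(M2P _ _ n_gt0)[v hv Du].
have [a' Da'] := mul_df_saturated d_gt0 hF NdvdF coordA smoothA valR primF c0 Da.
exists a' => //; apply: (M2_mul_df d_gt0 hF NdvdF coordA irrF le_dn hv).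
by rewrite -Du.
Qed.

Lemma gen_labelE i :
  (pi (poly2 (gen_label R i).1), pi (poly2 (gen_label R i).2)) = g i.
Proof.
have p2nil : pi (poly2 (R := R) [::]) = 0 by rewrite /poly2 big_nil rmorph0.
have p2sing (c : R) a b : pi (poly2 [:: (c, (a, b))]) = c *: monA pi a b.
  by rewrite /poly2 big_seq1 linearZ.
have X3 (m : mon) := mpolyX3E R (mnm3 m).
case: i => k m; rewrite form_of_unitv /gen_label /= X3 !mnmE /= to_affine_mon.
elim/ord3_ind: k => /=; rewrite ?p2nil ?p2sing ?scale1r ?scaleN1r //.
congr (_, - _); rewrite -(to_affine_mon _ _ _ m.2.2) exprS; congr psi; ring.
Qed.

Lemma quotient_basis_algP : quotient_basis N (M2 pi n)
  (basis_of_output pi (quotient_basis_alg d n s)).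
Proof.
have [L [col [DL inv sL]]] := elim_inv_loop valR N_D N_Z (gen_label R) initial_elim_inv.
rewrite /quotient_basis_alg columnsE DL /basis_of_output /elim_state -!map_comp.
rewrite (eq_map (g := g)); last by move=> i /=; apply: gen_labelE.
apply: (quotient_basis_of_elim valR (iX, (0, (0, 0)))%N _ _ _ inv).
- by move=> i /sL; apply: M2_gen.
- exact: N_saturated.
- move=> c; apply: Rspan_sum => i /sL i_n; apply: RspanZ; exact: M2_gen.
Qed.

End Basis.

(** * The exact rows, the global sections and the basis together *)

Lemma smooth_affine (R : idomainType) (F : {mpoly R[3]}) (A : comAlgType R)
    (pi : {lrmorphism {mpoly R[2]} -> A}) :
  smooth_curve F -> is_coordinate_ring F pi ->
  exists a b : A, a * to_affine pi F^`M(iX) + b * to_affine pi F^`M(iY) = 1.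
Proof.
move=> /(_ iZ)[a [b [c Dabc]]] coordA.
exists (to_affine pi (c iX)), (to_affine pi (c iY)).
(* F and Z - 1 vanish in A, which leaves the two partial derivatives. *)
have := congr1 (to_affine pi) Dabc.
rewrite big_mkcond sum3E /= addr0 !rmorphD !rmorphM rmorphB !rmorph1 /=.
by rewrite (to_affineF coordA) to_affineZ subrr !mulr0 !add0r => <-.
Qed.

Theorem proposition13p13 :
  exists P : prog (Prod Nat (Prod Nat Poly3)) (List (Prod Poly2 Poly2)),
  forall (R : idomainType) (d n : nat) (F : {mpoly R[3]})
         (A : comAlgType R) (pi : {lrmorphism {mpoly R[2]} -> A})
         (Omega : lmodType A) (delta : {linear (A^o * A^o)%type -> Omega}),
    padic_integer_ring R ->
    (0 < d)%N ->
    F \is d.-homog ->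
    smooth_curve F ->
    ~ reduction_divisible_by_Z F ->
    is_coordinate_ring F pi ->
    is_differentials F pi delta ->
    (maxn (2 * d - 3) d <= n)%N ->
    [/\ short_exact (mul_df F pi) delta
          (fun _ => True) (fun _ => True) (fun _ => True),
        short_exact (mul_df F pi) delta (M1 pi d n) (M2 pi n) (M3 pi n delta),
        forall w : Omega, M3 pi n delta w <-> image_H0 F pi n.+1 delta w &
        forall s : sem R Poly3, poly3 s = F ->
          exists2 out, run P (d, (n, s)) out &
            quotient_basis
              (fun u => exists2 a, M1 pi d n a & u = mul_df F pi a)
              (M2 pi n) (basis_of_output pi out)].
Proof.
have [P runP] := computable_quotient_basis; exists P.
move=> R d n F A pi Omega delta padicR d_gt0 hF smoothF primF coordA difA.
rewrite geq_max => /andP[le_2dn le_dn].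
have le_2dn3 : (2 * d <= n + 3)%N by lia.
have valR := padic_valuation_domain padicR.
have irrF := irrelevant_of_smooth hF smoothF.
have smoothA := smooth_affine smoothF coordA.
have NdvdF : ~ exists a, F = 'X_iZ * a.
  move=> [G DG]; apply: primF; exists G => m.
  by rewrite DG mulrC subrr mcoeff0 unitr0.
(* Were all coefficients nonunits, the reduction of F would be 0, which is divisible by Z. *)
have {primF} : primitive_mpoly F.
  have [/hasP[m _ Um]|NF] := boolP (has (fun m => F@_m \is a GRing.unit) (msupp F)).
    by exists m.
  case: primF; exists 0 => m; rewrite mul0r subr0.
  have [/(hasPn NF) //|/memN_msupp_eq0 ->] := boolP (m \in msupp F).
  by rewrite unitr0.
move=> primF; have F0 := not_Zdvd_neq0 NdvdF.
have injF := mul_df_inj smoothA.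
have kerM u : M2 pi n u -> delta u = 0 <-> exists2 a, M1 pi d n a & u = mul_df F pi a.
  move=> /M2P[|v hv Du]; first by lia.
  split=> [/difA.2[a Da]|[a _ Da]]; last by apply/difA.2; exists a.
  exists a => //; apply: (M2_mul_df d_gt0 hF NdvdF coordA irrF le_dn hv).
  by rewrite -Du.
split.
- split=> // [a b _ _ /injF //|u _|w _].
    by rewrite difA.2; split=> [[a Da]|[a _ Da]]; exists a.
  by have [u Du] := difA.1 w; exists u.
- split=> [a Ma|u Mu|a b _ _ /injF //|//|w //].
  + exact: (mul_df_M2 d_gt0 hF NdvdF coordA).
  + by exists u.
- move=> w; split.
    exact: (M3_image_H0 d_gt0 hF le_dn).
  exact: (image_H0_M3 d_gt0 hF le_dn le_2dn3 irrF F0 coordA difA).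
- move=> s Ds; exists (quotient_basis_alg d n s); first exact: runP.
  rewrite -Ds; apply: quotient_basis_algP => //; rewrite ?Ds //.
Qed.
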